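(* Let $X=H_1\cap\cdots\cap H_c\subset\mathbb{P}^N$ be a generic smooth complete intersection, where $H_i$ is a hypersurface of degree $d_i$ (defined by a section in $H^0(\mathbb{P}^N,\mathcal{O}_{\mathbb{P}^N}(d_i))$) and $d_i\ge\delta$ for all $i$. Then there is an algebraic subset $Y\subset X$ of dimension $N-3c$ such that $dl(X)\subseteq Y$. In particular $X$ is hyperbolic if $c\ge\frac{N}{3}$.
   Context: Everything is over $\mathbb{C}$. For a projective variety $X$, the algebraic degeneracy locus $dl(X)$ is the Zariski closure of the union $\bigcup f(\mathbb{C})$ of the images of all non-constant entire curves (holomorphic maps) $f:\mathbb{C}\to X$. Hyperbolic means hyperbolic in the sense of Kobayashi (equivalently here, there is no non-constant entire curve in $X$). A set of negative dimension is understood to be empty. Let $\mathbb{P}^{N_d}$ be the projective space parametrizing hypersurfaces of degree $d$ in $\mathbb{P}^N$, let $H_{d,t}\subset\mathbb{P}^N$ be the hypersurface corresponding to $t\in\mathbb{P}^{N_d}$, and let $\mathcal{H}_d=\{(x,t)\in\mathbb{P}^N\times\mathbb{P}^{N_d} : x\in H_{d,t}\}$ be the universal hypersurface. ''Generic'' means that the tuple of equations of $H_1,\dots,H_c$ lies in a suitable nonempty Zariski open subset of $\mathbb{P}^{N_{d_1}}\times\cdots\times\mathbb{P}^{N_{d_c}}$. $\delta\in\mathbb{N}$ is an integer (depending on $N$) provided by the algebraic degeneracy theorem of Diverio--Merker--Rousseau and Diverio--Trapani: for every $d\ge\delta$ there exist a nonempty Zariski open subset $U_d\subset\mathbb{P}^{N_d}$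 and an algebraic subset $\mathcal{Y}_d$ of the restriction of $\mathcal{H}_d$ over $U_d$ such that for all $t\in U_d$ the fibre $Y_{d,t}\subset H_{d,t}$ has codimension at least two in $H_{d,t}$ and $dl(H_{d,t})\subset Y_{d,t}$. (Such a $\delta$ exists, and one may take $\delta\le 2^{(N-1)^5}$.) *)

(* Defs.v *)
From HB Require Import structures.
From mathcomp Require Import all_boot all_order all_algebra.
From mathcomp Require Import complex.
From mathcomp Require Import all_classical all_reals all_analysis.
(* The notations of mpoly and of MathComp-Analysis clash, hence the
   import of everything but the notations. *)
From mathcomp Require Import -(notations) mpoly.

Set Implicit Arguments.
Unset Strict Implicit.
Unset Printing Implicit Defensive.

Import Order.TTheory GRing.Theory Num.Theory.
Import numFieldNormedType.Exports.

Local Open Scope ring_scope.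
Local Open Scope classical_set_scope.
Local Open Scope complex_scope.

(* Points are lines, so equality of points is Leibniz equality. *)
Definition proj (K : fieldType) (V : vectType K) : Type :=
  {L : {vspace V} | \dim L == 1%N}.

Definition represents (K : fieldType) (V : vectType K) (v : V) (x : proj V) :
  Prop := v != 0 /\ v \in val x.

Section ZariskiTopology.
Variables (K : fieldType) (P T I : Type).
Variables (rep : T -> P -> Prop) (coords : I -> T -> K).

Definition polynomial_function (g : T -> K) : Prop :=
  exists (n : nat) (s : 'I_n -> I) (p : mpoly n K),
    forall t, g t = meval (fun k => coords (s k) t) p.

(* P is a product of projective spaces, T the corresponding product of vector
   spaces, with coordinate functions coords, and rep t x says that all the
   components of t are nonzero and that they are homogeneous coordinates of
   those of x. The Zariski topology of P is the quotient of the Zariski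
   topology of the tuples of nonzero vectors: A is closed when its
   multicone is cut out by polynomials. These need not be multihomogeneous:
   over an infinite field, the multihomogeneous components of a polynomial
   vanishing on a multicone vanish on it too. *)
Definition zariski_closed (A : set P) : Prop :=
  exists S : set (T -> K), S `<=` polynomial_function /\
    forall t x, rep t x -> (A x <-> forall g, S g -> g t = 0).

Definition zariski_open (A : set P) : Prop := zariski_closed (~` A).

End ZariskiTopology.

Section ProjectiveSpaces.
Variables (R : realType) (N : nat).
Local Notation C := R[i].

Definition PP : Type := proj 'rV[C]_N.+1.

Definition PPclosed : set PP -> Prop :=
  zariski_closed (@represents _ 'rV[C]_N.+1)
    (fun (j : 'I_N.+1) (v : 'rV[C]_N.+1) => v 0 j).

(* H^0(P^N, O(d)), as homogeneous polynomials of degree d in N + 1 variables;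
   PForm d is P^{N_d}. *)
Definition form (d : nat) : vectType C := dhomog N.+1 C d.

Definition PForm (d : nat) : Type := proj (form d).

Definition form_coeff (d : nat) (m : multinom N.+1) (F : form d) : C :=
  mcoeff m (mpoly_of_dhomog F).

Definition form_eval (d : nat) (F : form d) (v : 'rV[C]_N.+1) : C :=
  meval (fun j => v 0 j) (mpoly_of_dhomog F).

Definition form_deriv (d : nat) (j : 'I_N.+1) (F : form d) (v : 'rV[C]_N.+1) :
  C :=
  meval (fun k => v 0 k) (mderiv j (mpoly_of_dhomog F)).

Definition PFormopen (d : nat) : set (PForm d) -> Prop :=
  zariski_open (@represents _ (form d)) (@form_coeff d).

Definition PPxPForm_closed (d : nat) : set (PP * PForm d) -> Prop :=
  zariski_closed
    (fun (vF : 'rV[C]_N.+1 * form d) (xt : PP * PForm d) =>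
       represents vF.1 xt.1 /\ represents vF.2 xt.2)
    (fun (k : 'I_N.+1 + multinom N.+1) vF =>
       match k with
       | inl j => vF.1 0 j
       | inr m => form_coeff m vF.2
       end).

Definition PForms_open (c : nat) (d : 'I_c -> nat) :
    set (forall i : 'I_c, PForm (d i)) -> Prop :=
  zariski_open
    (fun (F : forall i, form (d i)) (t : forall i, PForm (d i)) =>
       forall i, represents (F i) (t i))
    (fun (k : 'I_c * multinom N.+1) F => form_coeff k.2 (F k.1)).

Definition hypersurface (d : nat) (t : PForm d) : set PP :=
  [set x | forall F v, represents F t -> represents v x -> form_eval F v = 0].

Definition universal_hypersurface (d : nat) : set (PP * PForm d) :=
  [set xt | hypersurface xt.2 xt.1].

Definition irreducible_closed (Z : set PP) : Prop :=
  [/\ PPclosed Z, Z !=set0 &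
      forall A B, PPclosed A -> PPclosed B -> Z `<=` A `|` B ->
        Z `<=` A \/ Z `<=` B].

Definition irreducible_chain (n : nat) (W : nat -> set PP) : Prop :=
  (forall i, (i <= n)%N -> irreducible_closed (W i)) /\
  (forall i, (i < n)%N -> W i `<` W i.+1).

(* For a closed subset Y of P^N, its closed subsets are those of P^N that lie
   in Y, so this is the Krull dimension of Y. *)
Definition has_dim (Y : set PP) (k : int) : Prop :=
  match k with
  | Posz n =>
      (exists W, irreducible_chain n W /\ W n `<=` Y) /\
      (forall m W, irreducible_chain m W -> W m `<=` Y -> (m <= n)%N)
  | Negz _ => Y = set0
  end.

(* The codimension of Y in X is at least k: every irreducible closed subset
   of Y starts a chain of length k in X. *)
Definition codim_ge (k : nat) (Y X : set PP) : Prop :=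
  forall Z, irreducible_closed Z -> Z `<=` Y ->
    exists W, [/\ irreducible_chain k W, W 0%N = Z & W k `<=` X].

Definition intersection (c : nat) (d : 'I_c -> nat)
    (t : forall i, PForm (d i)) : set PP :=
  [set x | forall i, hypersurface (t i) x].

(* Jacobian criterion: the c equations have independent differentials at every
   point of the affine cone. *)
Definition smooth_complete_intersection (c : nat) (d : 'I_c -> nat)
    (t : forall i, PForm (d i)) : Prop :=
  has_dim (intersection t) (N%:Z - c%:Z) /\
  (forall (x : PP) (v : 'rV[C]_N.+1) (F : forall i, form (d i)),
     intersection t x -> represents v x ->
     (forall i, represents (F i) (t i)) ->
     \rank (\matrix_(i < c, j < N.+1) form_deriv j (F i) v) = c).

(* Near every point of D, f is given by homogeneous coordinates that are
   holomorphic functions without common zeros. *)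
Definition holomorphic_on (D : set C) (f : C -> PP) : Prop :=
  forall z0, D z0 -> exists F : 'I_N.+1 -> C -> C,
    \forall z \near (z0 : C^o),
      (forall j, derivable (F j : C^o -> C^o) z 1) /\
      represents (\row_j F j z) (f z).

Definition entire_curve (X : set PP) (f : C -> PP) : Prop :=
  holomorphic_on setT f /\ forall z, X (f z).

Definition nonconstant (f : C -> PP) : Prop := exists z w, f z <> f w.

Definition dl (X : set PP) : set PP :=
  smallest PPclosed
    (\bigcup_(f in [set f | entire_curve X f /\ nonconstant f]) range f).

Definition cabs (z : C) : R := complex.Re `|z|.

Definition unit_disc : set C := [set z | cabs z < 1].

Definition poincare_dist (a b : C) : R :=
  let r := cabs ((a - b) / (1 - a^* * b)) in ln ((1 + r) / (1 - r)).

(* X is a closed submanifold of P^N in the intended use, so a holomorphic map to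
   X is a holomorphic map to P^N with values in X. *)
Inductive disc_chain (X : set PP) : PP -> PP -> R -> Prop :=
| disc_chain_nil x : X x -> disc_chain X x x 0
| disc_chain_cons (f : C -> PP) (a b : C) y l :
    holomorphic_on unit_disc f -> (forall z, unit_disc z -> X (f z)) ->
    unit_disc a -> unit_disc b ->
    disc_chain X (f b) y l ->
    disc_chain X (f a) y (poincare_dist a b + l).

(* The infimum is +oo when x and y are not joined by a chain of discs. *)
Definition kobayashi_dist (X : set PP) (x y : PP) : \bar R :=
  ereal_inf [set l%:E | l in disc_chain X x y].

Definition kobayashi_hyperbolic (X : set PP) : Prop :=
  forall x y, X x -> X y -> x <> y -> (0 < kobayashi_dist X x y)%E.

End ProjectiveSpaces.

(* delta has the property given by the algebraic degeneracy theorem of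
   Diverio-Merker-Rousseau and Diverio-Trapani. Y is a closed subset of the
   restriction of the universal hypersurface over U: the trace on it of a closed
   subset Z of P^N x P^{N_d}. *)
Definition degeneracy_bound (R : realType) (N delta : nat) : Prop :=
  forall d : nat, (delta <= d)%N ->
  exists (U : set (PForm R N d)) (Y : set (PP R N * PForm R N d)),
    [/\ PFormopen U, U !=set0,
        (exists Z, PPxPForm_closed Z /\
           Y = Z `&` (@universal_hypersurface R N d `&` [set xt | U xt.2])) &
        forall t, U t ->
          codim_ge 2 [set x | Y (x, t)] (hypersurface t) /\
          dl (hypersurface t) `<=` [set x | Y (x, t)]].

(* Main.v *)
(* Let Y_i be the degeneracy set of H_i, of codimension two in H_i. A
   nonconstant entire curve in X lies in every Y_i, so dl(X) is contained in
   their intersection, and it is enough to move the equations so that this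
   intersection misses the linear space L on which the coordinates x_j with
   j >= 3c vanish: a closed set missing L has dimension at most N - 3c. The
   irreducible subsets of Y_i start chains of length three in P^N, so a
   dimension count by Hilbert functions gives a plane disjoint from Y_i. After a
   linear change of coordinates that contracts the three coordinates x_j with
   j / 3 = i (integer division) these are small on Y_i compared with the other
   ones, and then the intersection of all the Y_i misses L. By elimination this
   remains true for generic equations.

   If N <= 3c, then X contains no nonconstant entire curve (for N = 3c, by
   Liouville's theorem applied to the coordinates x_j / x_N, which are bounded on
   the finite set obtained), and Brody's theorem gives hyperbolicity: otherwise
   discs in X with arbitrarily large oscillation could be rescaled at well chosen
   points, and an ultralimit of them would be an entire curve. Cauchy's estimates
   come from Goursat's theorem for dyadic trapezoid sums, which replace line
   integrals. *)

Require Import Defs.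
From HB Require Import structures.
From mathcomp Require Import all_boot all_order all_algebra.
From mathcomp Require Import complex.
From mathcomp Require Import all_classical all_reals all_analysis.
From mathcomp Require Import -(notations) mpoly.
From mathcomp Require Import ring lra zify.

Set Implicit Arguments.
Unset Strict Implicit.
Unset Printing Implicit Defensive.

Import Order.TTheory GRing.Theory Num.Theory.
Import numFieldNormedType.Exports.

Local Open Scope ring_scope.
Local Open Scope classical_set_scope.

(** Codimension two in [H_i] leaves room for three steps up to P^N, so three coordinates at a time
    can be made small on [Y_i]. The intersection of the [Y_i] is then controlled by size, not by
    intersection theory: if each of the first [3c] coordinates is at most [e] times the sum of all
    the moduli and the others vanish, then for [e = 1/(2(N+1))] this sum is at most half of itself.
    One such tuple of equations is enough, since missing a linear space is an open condition on the
    equations.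

    Dimension being defined by chains, two inequalities on Hilbert functions suffice: each step of a
    chain raises the order of growth by one, and a closed cone missing the common zeros of [q]
    coordinates has growth of order below [q]. The second rests on the Nullstellensatz, which over
    an uncountable field is linear algebra.

    On the analytic side, an ultrafilter gives limits at all points of the plane at once; holomorphy
    of the limit then only requires a Taylor remainder that is uniform along the sequence. *)

Local Notation ev v p := (meval (fun j => v 0 j) p).
Local Notation XU i := (mpolyX _ (mnm1 i)).

(** * Nullstellensatz over an uncountable field *)

Section LinearDependence.
Variable K : fieldType.

Lemma left_kernel_nonzero (m b : nat) (A : 'M[K]_(m, b)) :
  (b < m)%N -> exists2 c : 'rV[K]_m, c != 0 & c *m A = 0.
Proof.
move=> bm; have : kermx A != 0.
  rewrite -mxrank_eq0 mxrank_ker -lt0n subn_gt0.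
  exact: leq_ltn_trans (rank_leq_col A) bm.
by case/rowV0Pn => c /sub_kermxP cA c0; exists c.
Qed.

Lemma mpoly_dependent (n D m : nat) (g : 'I_m -> mpoly n K) :
  (#|{: bmultinom n D}| < m)%N -> (forall i, (msize (g i) <= D)%N) ->
  exists2 c : 'rV[K]_m, c != 0 & \sum_i c 0 i *: g i = 0.
Proof.
move=> Dm gD.
pose A : 'M[K]_(m, #|{: bmultinom n D}|) :=
  \matrix_(i, j) mcoeff (bmnm (enum_val j)) (g i).
have [c c0 cA] := left_kernel_nonzero A Dm; exists c => //.
apply/mpolyP => mu; rewrite mcoeff0 raddf_sum /=.
have [muD|muD] := ltnP (mdeg mu) D; last first.
  apply: big1 => i _; rewrite mcoeffZ memN_msupp_eq0 ?mulr0 //.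
  by apply/mmeasure_mnm_ge/(leq_trans (gD i)).
have /matrixP/(_ 0 (enum_rank (BMultinom muD))) := cA.
rewrite !mxE => h; rewrite -[RHS]h; apply: eq_bigr => i _.
by rewrite mcoeffZ !mxE enum_rankK.
Qed.

End LinearDependence.

Section Nullstellensatz.
Variables (K : closedFieldType) (n : nat).
Hypothesis Kuncountable : ~ countable [set: K].
Implicit Types (I : set (mpoly n K)) (p q : mpoly n K).

Definition is_ideal I :=
  [/\ I 0, forall p q, I p -> I q -> I (p + q) & forall p q, I q -> I (p * q)].

(** The exponent [0] is included, so such an ideal is proper. Carrying [p] along yields the strong
    Nullstellensatz directly, without Rabinowitsch's extra variable. *)
Definition avoids_powers I p := forall k : nat, ~ I (p ^+ k).

Local Notation lin i a := (mpolyX K (mnm1 i) - mpolyC n a).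

Definition adjoin_linear I (i : 'I_n) (a : K) : set (mpoly n K) :=
  [set q | exists g, I (q - lin i a * g)].

Lemma ideal_adjoin_linear I i a : is_ideal I -> is_ideal (adjoin_linear I i a).
Proof.
move=> [I0 ID IM]; split.
- by exists 0; rewrite mulr0 subr0.
- move=> p q [g Ig] [h Ih]; exists (g + h).
  by rewrite (_ : _ - _ = (p - lin i a * g) + (q - lin i a * h)); [exact: ID|ring].
- move=> p q [g Ig]; exists (p * g).
  by rewrite (_ : _ - _ = p * (q - lin i a * g)); [exact: IM|ring].
Qed.

Lemma uncountable_fiber (T : Type) (f : K -> T) : countable [set: T] ->
  exists t, ~ finite_set [set a | f a = t].
Proof.
move=> cT; apply: contrapT => /forallNP fin; apply: Kuncountable.
rewrite (_ : setT = \bigcup_(t in [set: T]) [set a | f a = t]).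
  apply: bigcup_countable => // t _; apply: finite_set_countable.
  exact: contrapT (fin t).
by apply/seteqP; split => // a _; exists (f a).
Qed.

(** Linear factors are removed one at a time: [p ^+ kb] is a multiple of [lin i b] modulo [I], so
    multiplying by it restores the factor [lin i b] at the cost of a larger exponent of [p]. *)
Lemma ideal_split_linear I p i : is_ideal I ->
  (forall a, exists k, adjoin_linear I i a (p ^+ k)) ->
  forall (r : seq K) k, I (p ^+ k * \prod_(b <- r) lin i b) ->
  exists k', I (p ^+ k').
Proof.
move=> [I0 ID IM] hp; elim=> [|b r IH] k; first by rewrite big_nil mulr1; exists k.
rewrite big_cons => Ik; have [kb [g Ig]] := hp b.
apply: (IH (kb + k)%N); set P := \prod_(_ <- _) _ in Ik *.
rewrite exprD (_ : _ * P = (p ^+ k * P) * (p ^+ kb - lin i b * g)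
   + g * (p ^+ k * (lin i b * P))); last by ring.
by apply: ID; exact: IM.
Qed.

(* If every [a] failed, uncountably many of them would fail with the same
   exponent [k] and cofactors [g_a] of bounded degree; a linear relation
   between the [g_a] then puts [p ^ k * h(X_i)] in [I] for some nonzero
   univariate [h], which splits. *)
Lemma avoids_powers_adjoin_linear I p i : is_ideal I -> avoids_powers I p ->
  exists a, avoids_powers (adjoin_linear I i a) p.
Proof.
move=> Iid avI; apply: contrapT => /forallNP noa.
have hp a : exists k, adjoin_linear I i a (p ^+ k).
  by have /existsNP[k /contrapT] := noa a; exists k.
have /choice[kg kgP] : forall a, exists kg : nat * mpoly n K,
    I (p ^+ kg.1 - lin i a * kg.2).
  by move=> a; have [k [g ?]] := hp a; exists (k, g).
have [[k D] inf] := @uncountable_fiber _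
   (fun a => ((kg a).1, msize (kg a).2)) (countableP _).
pose m := #|{: bmultinom n D}|.+1.
have [B BkD mB] := infinite_set_fset m inf.
pose a (j : 'I_m) : K := nth 0 (finmap.enum_fset B) j.
have ltB (j : 'I_m) : (j < size (finmap.enum_fset B))%N by apply: leq_trans mB.
have ainj : injective a.
  by move=> j1 j2 /eqP; rewrite nth_uniq ?finmap.fset_uniq // => /eqP /val_inj.
have aP j : (kg (a j)).1 = k /\ msize (kg (a j)).2 = D.
  by have /(_ (mem_nth 0 (ltB j))) [] := BkD (a j).
have [||c c0 cg] := @mpoly_dependent K n D m (fun j => (kg (a j)).2).
- exact: ltnSn.
- by move=> j; rewrite (aP j).2.
(* Formally [g_a] is [p ^ k / (X_i - a)] modulo [I], so the relation between the cofactors says that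
   [p ^ k] kills the sum of the [c_j / (X_i - a_j)]. The numerator of this sum is [h], nonzero at
   [a_j] as soon as [c_j] is. *)
pose h : {poly K} := \sum_j c 0 j *: \prod_(l | l != j) ('X - (a l)%:P).
have h0 : h != 0.
  have /rV0Pn[j cj] := c0.
  apply/eqP => /(congr1 (horner^~ (a j))); rewrite horner0 horner_sum.
  rewrite (bigD1 j) //= [X in _ + X]big1 ?addr0 => [|l lj].
    rewrite hornerZ horner_prod => /eqP; rewrite mulf_eq0 (negPf cj) /=.
    apply/negP/prodf_neq0 => l lj.
    by rewrite hornerXsubC subr_eq0 (inj_eq ainj) eq_sym.
  rewrite hornerZ horner_prod (bigD1 j) 1?eq_sym //=.
  by rewrite hornerXsubC subrr mul0r mulr0.
pose ev (q : {poly K}) : mpoly n K := (map_poly (@mpolyC n K) q).[mpolyX K (mnm1 i)].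
have evM (q1 q2 : {poly K}) : ev (q1 * q2) = ev q1 * ev q2.
  by rewrite /ev rmorphM /= hornerM.
have evlin b : ev ('X - b%:P) = lin i b.
  by rewrite /ev rmorphB /= map_polyX map_polyC /= hornerXsubC.
have evprod (J : Type) (r : seq J) (P : pred J) (f : J -> K) :
    ev (\prod_(j <- r | P j) ('X - (f j)%:P)) = \prod_(j <- r | P j) lin i (f j).
  rewrite (big_morph ev evM (_ : ev 1 = 1)); last by rewrite /ev rmorph1 hornerC.
  by apply: eq_bigr => j _; rewrite evlin.
have evZ b (q : {poly K}) : ev (b *: q) = b *: ev q.
  by rewrite /ev -mul_polyC rmorphM /= map_polyC /= hornerM hornerC mul_mpolyC.
have [I0 ID IM] := Iid.
have Isum (J : finType) (f : J -> mpoly n K) : (forall j, I (f j)) -> I (\sum_j f j).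
  by move=> If; elim/big_ind: _.
have IZ b q : I q -> I (b *: q) by move=> Iq; rewrite -mul_mpolyC; exact: IM.
have Iev : I (p ^+ k * ev h).
  have -> : p ^+ k * ev h = \sum_j c 0 j *:
      ((\prod_(l | l != j) lin i (a l)) * (p ^+ k - lin i (a j) * (kg (a j)).2)).
    transitivity (\sum_j (c 0 j *: ((\prod_(l | l != j) lin i (a l)) * p ^+ k)
        - (\prod_l lin i (a l)) * (c 0 j *: (kg (a j)).2))); last first.
      apply: eq_bigr => j _; rewrite [X in _ - X * _](bigD1 j) //= -!mul_mpolyC; ring.
    rewrite sumrB -mulr_sumr cg mulr0 subr0.
    rewrite /h (big_morph ev (_ : {morph ev : x y / x + y}) (_ : ev 0 = 0)).
    - rewrite mulr_sumr; apply: eq_bigr => j _.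
      by rewrite evZ evprod -!mul_mpolyC; ring.
    - by move=> x y; rewrite /ev rmorphD hornerD.
    - by rewrite /ev rmorph0 horner0.
  apply: Isum => j; apply: IZ; apply: IM.
  by have := kgP (a j); rewrite (aP j).1.
have [r hr] := closed_field_poly_normal h.
have [k' Ik'] : exists k', I (p ^+ k').
  apply: (@ideal_split_linear I p i Iid hp r k).
  have : I ((lead_coef h)^-1 *: (p ^+ k * ev h)) by exact: IZ.
  rewrite hr evZ evprod lead_coefZ (_ : lead_coef (\prod_(_ <- _) _) = 1).
    rewrite mulr1 -scalerAr scalerA mulVf ?scale1r //.
    by rewrite lead_coef_eq0.
  by apply/monicP; apply: monic_prod_XsubC.
exact: avI Ik'.
Qed.

(** Adjoining some [X_i - a_i] for every variable gives an ideal [J] that still avoids the powers of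
    [p] and modulo which every polynomial equals its value at [a]. A nonzero value of some [q] in
    [I] would put [1 = p ^+ 0] in [J], and a zero value of [p] would put [p] in [J]. *)
Lemma nullstellensatz I p : is_ideal I -> avoids_powers I p ->
  exists2 v : 'I_n -> K, (forall q, I q -> meval v q = 0) & meval v p != 0.
Proof.
move=> Iid avI.
have [J [a [Jid avJ IJ Ja]]] : exists J (a : 'I_n -> K),
    [/\ is_ideal J, avoids_powers J p, I `<=` J & forall i, J (lin i (a i))].
  suff : forall s : seq 'I_n, exists J (a : 'I_n -> K), [/\ is_ideal J,
      avoids_powers J p, I `<=` J & forall i, i \in s -> J (lin i (a i))].
    case/(_ (enum 'I_n)) => J [a [? ? ? Ja]]; exists J, a; split=> // i.
    by apply: Ja; rewrite mem_enum.
  elim=> [|i s [J [a [Jid avJ IJ Ja]]]]; first by exists I, (fun=> 0); split.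
  have [b avb] := @avoids_powers_adjoin_linear J p i Jid avJ.
  have [J0 JD JM] := Jid.
  have sub : J `<=` adjoin_linear J i b.
    by move=> q Jq; exists 0; rewrite mulr0 subr0.
  have Jb : adjoin_linear J i b (lin i b).
    by exists 1; rewrite mulr1 subrr.
  exists (adjoin_linear J i b), (fun j => if j == i then b else a j); split=> //.
  - exact: ideal_adjoin_linear.
  - by move=> q /IJ /sub.
  - move=> j; rewrite inE; case: eqP => [->//|_ /= js].
    exact/sub/Ja.
have [J0 JD JM] := Jid.
have JZ b q : J q -> J (b *: q) by move=> Jq; rewrite -mul_mpolyC; exact: JM.
have Jev q : J (q - mpolyC n (meval a q)).
  elim/mpolyind: q => [|c m q _ _ Jq]; first by rewrite meval0 mpolyC0 subrr.
  rewrite mevalD mpolyCD mevalZ opprD addrACA; apply: (JD) => //.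
  rewrite mpolyCM mul_mpolyC -scalerBr; apply: (JZ).
  rewrite mevalX mpolyXE_id rmorph_prod /=.
  elim/big_rec2: _ => [|i y1 y2 _ Jy]; first by rewrite subrr.
  set x := mpolyX K (mnm1 i) ^+ _; set y := mpolyC n _.
  have Jxy : J (x - y).
    rewrite {}/x {}/y; elim: (m i) => [|k IH]; first by rewrite !expr0 mpolyC1 subrr.
    rewrite !exprS mpolyCM; move: (Ja i); set x := mpolyX _ _ in IH * => Jxi.
    set y := mpolyC n (a i) in Jxi *.
    rewrite (_ : _ - _ = x * (x ^+ k - mpolyC n (a i ^+ k)) +
      mpolyC n (a i ^+ k) * (x - y)); last by ring.
    by apply: (JD); apply: (JM).
  rewrite (_ : _ - _ = x * (y2 - y1) + y1 * (x - y)); last by ring.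
  by apply: (JD); exact: JM.
exists a => [q Iq|].
  apply/eqP; apply: contrapT => /negP qa0; apply: (avJ 0%N); rewrite expr0.
  have : J ((meval a q)^-1 *: (q + (-1) *: (q - mpolyC n (meval a q)))).
    by apply: (JZ); apply: (JD); [exact: IJ|exact: (JZ)].
  rewrite scaleN1r opprB addrC subrK -mul_mpolyC -mpolyCM mulVf //.
apply/eqP => pa0; apply: (avJ 1%N); rewrite expr1.
by have := Jev p; rewrite pa0 mpolyC0 subr0.
Qed.

Lemma mpoly_vanishing_eq0 p : (forall v, meval v p = 0) -> p = 0.
Proof.
move=> pv; apply: contrapT => /eqP p0.
have [||v _ /eqP] := @nullstellensatz [set 0] p; last by rewrite pv.
- split=> // [q1 q2 -> ->|q1 q2 ->]; first by rewrite addr0.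
  by rewrite mulr0.
- by move=> k /= /eqP; rewrite expf_eq0 (negPf p0) andbF.
Qed.

End Nullstellensatz.

(** * Zariski closed sets *)

Section PolynomialFunctions.
Variables (K : fieldType) (T I : Type) (coords : I -> T -> K).
Local Notation pf := (polynomial_function coords).

Lemma polynomial_function_const (a : K) : pf (fun=> a).
Proof.
exists 0%N, (fun k : 'I_0 => False_rect I (notF (ltn_ord k))), (mpolyC 0 a) => t.
by rewrite mevalC.
Qed.

Lemma polynomial_function_coord (i : I) : pf (coords i).
Proof.
exists 1%N, (fun=> i), (mpolyX K (mnm1 ord0)) => t.
by rewrite mevalXU.
Qed.

Lemma polynomial_function_widen (g h : T -> K) : pf g -> pf h ->
  exists n (s : 'I_n -> I) (p q : mpoly n K), forall t,
    g t = meval (fun k => coords (s k) t) p /\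
    h t = meval (fun k => coords (s k) t) q.
Proof.
move=> [n1 [s1 [p1 gE]]] [n2 [s2 [p2 hE]]].
exists (n1 + n2)%N, (fun k => match fintype.split k with inl j => s1 j | inr j => s2 j end).
exists (comp_mpoly [tuple mpolyX K (mnm1 (lshift n2 j)) | j < n1] p1),
  (comp_mpoly [tuple mpolyX K (mnm1 (rshift n1 j)) | j < n2] p2) => t.
rewrite gE hE !comp_mpoly_meval; split; apply: meval_eq => j.
- by rewrite tnth_mktuple mevalXU (unsplitK (inl j)).
- by rewrite tnth_mktuple mevalXU (unsplitK (inr j)).
Qed.

Lemma polynomial_functionD (g h : T -> K) : pf g -> pf h -> pf (fun t => g t + h t).
Proof.
move=> pg ph; have [n [s [p [q E]]]] := polynomial_function_widen pg ph.
by exists n, s, (p + q) => t; rewrite mevalD (E t).1 (E t).2.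
Qed.

Lemma polynomial_functionM (g h : T -> K) : pf g -> pf h -> pf (fun t => g t * h t).
Proof.
move=> pg ph; have [n [s [p [q E]]]] := polynomial_function_widen pg ph.
by exists n, s, (p * q) => t; rewrite mevalM (E t).1 (E t).2.
Qed.

Lemma polynomial_function_sum (J : Type) (r : seq J) (P : pred J) (g : J -> T -> K) :
  (forall j, P j -> pf (g j)) -> pf (fun t => \sum_(j <- r | P j) g j t).
Proof.
move=> pg; elim: r => [|j r IH].
  by under eq_fun do rewrite big_nil; exact: polynomial_function_const.
under eq_fun do rewrite big_cons; have [Pj|//] := boolP (P j).
exact: polynomial_functionD (pg _ Pj) IH.
Qed.

Lemma polynomial_function_prod (J : Type) (r : seq J) (P : pred J) (g : J -> T -> K) :
  (forall j, P j -> pf (g j)) -> pf (fun t => \prod_(j <- r | P j) g j t).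
Proof.
move=> pg; elim: r => [|j r IH].
  by under eq_fun do rewrite big_nil; exact: polynomial_function_const.
under eq_fun do rewrite big_cons; have [Pj|//] := boolP (P j).
exact: polynomial_functionM (pg _ Pj) IH.
Qed.

Lemma polynomial_functionX (g : T -> K) e : pf g -> pf (fun t => g t ^+ e).
Proof.
move=> pg; elim: e => [|e IH].
  by under eq_fun do rewrite expr0; exact: polynomial_function_const.
by under eq_fun do rewrite exprS; exact: polynomial_functionM.
Qed.

Lemma polynomial_function_meval (n : nat) (h : 'I_n -> T -> K) (p : mpoly n K) :
  (forall k, pf (h k)) -> pf (fun t => meval (fun k => h k t) p).
Proof.
move=> ph; under eq_fun do rewrite mevalE.
apply: polynomial_function_sum => m _; apply: polynomial_functionM.
  exact: polynomial_function_const.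
by apply: polynomial_function_prod => k _; exact: polynomial_functionX.
Qed.

End PolynomialFunctions.

Lemma polynomial_function_comp (K : fieldType) (T I T' I' : Type)
    (coords : I -> T -> K) (coords' : I' -> T' -> K) (psi : T -> T') (g : T' -> K) :
  (forall i, polynomial_function coords (coords' i \o psi)) ->
  polynomial_function coords' g -> polynomial_function coords (g \o psi).
Proof.
move=> pc [n [s [p gE]]].
rewrite (_ : g \o psi = fun t => meval (fun k => (coords' (s k) \o psi) t) p).
  exact: polynomial_function_meval.
by apply/funext => t /=; rewrite gE.
Qed.

Section ZariskiClosed.
Variables (K : fieldType) (P T I : Type) (rep : T -> P -> Prop) (coords : I -> T -> K).
Local Notation closed := (zariski_closed rep coords).
Local Notation zopen := (zariski_open rep coords).

Lemma zariski_closed0 : closed set0.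
Proof.
exists [set fun=> 1]; split=> [_ ->|t x _]; first exact: polynomial_function_const.
by split=> // /(_ _ erefl) /eqP; rewrite oner_eq0.
Qed.

Lemma zariski_closedU A B : closed A -> closed B -> closed (A `|` B).
Proof.
move=> [S [Sp SP]] [S' [Sp' SP']].
exists [set f | exists g h, [/\ S g, S' h & f = fun t => g t * h t]]; split.
  by move=> _ [g [h [/Sp pg /Sp' ph ->]]]; exact: polynomial_functionM.
move=> t x tx; split=> [[Ax|Bx]|gh].
- by move=> _ [g [h [Sg Sh ->]]]; rewrite (SP _ _ tx).1 // mul0r.
- by move=> _ [g [h [Sg Sh ->]]]; rewrite [h t](SP' _ _ tx).1 // mulr0.
- apply: contrapT => /not_orP[nA nB].
  have [g Sg g0] : exists2 g, S g & g t <> 0.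
    apply: contrapT => h; apply/nA/(SP _ _ tx) => g Sg.
    by apply: contrapT => g0; apply: h; exists g.
  have [h Sh h0] : exists2 h, S' h & h t <> 0.
    apply: contrapT => h; apply/nB/(SP' _ _ tx) => g' Sg'.
    by apply: contrapT => g'0; apply: h; exists g'.
  have /eqP : g t * h t = 0 by apply: (gh (fun t => g t * h t)); exists g, h.
  by rewrite mulf_eq0 => /orP[/eqP|/eqP].
Qed.

Lemma zariski_closed_bigcap (J : Type) (D : set J) (A : J -> set P) :
  (forall j, D j -> closed (A j)) -> closed (\bigcap_(j in D) A j).
Proof.
move=> cA.
have /choice[S SP] : forall j, exists S : set (T -> K), D j ->
    S `<=` polynomial_function coords /\
    forall t x, rep t x -> (A j x <-> forall g, S g -> g t = 0).
  move=> j; have [Dj|nDj] := pselect (D j); last by exists set0.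
  by have [S ?] := cA j Dj; exists S.
exists (\bigcup_(j in D) S j); split=> [g [j Dj] /(SP j Dj).1 //|t x tx].
split=> [Ax g [j Dj Sg]|h j Dj]; first exact: ((SP j Dj).2 _ _ tx).1 (Ax j Dj) _ Sg.
by apply/((SP j Dj).2 _ _ tx) => g Sg; apply: h; exists j.
Qed.

Lemma zariski_closedI A B : closed A -> closed B -> closed (A `&` B).
Proof.
move=> cA cB; rewrite (_ : _ `&` _ = \bigcap_(b in [set: bool]) if b then A else B).
  by apply: zariski_closed_bigcap => -[].
apply/seteqP; split=> [x [Ax Bx] [] //|x h]; split; first exact: (h true).
exact: (h false).
Qed.

Lemma zariski_closed_bigcup_ord (n : nat) (A : 'I_n -> set P) :
  (forall j, closed (A j)) -> closed (\bigcup_j A j).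
Proof.
move=> cA.
have h (s : seq 'I_n) : closed [set x | exists2 j, j \in s & A j x].
  elim: s => [|j s IH].
    rewrite (_ : [set _ | _] = set0); first exact: zariski_closed0.
    by apply/seteqP; split=> // x [].
  rewrite (_ : [set _ | _] = A j `|` [set x | exists2 j, j \in s & A j x]).
    exact: zariski_closedU.
  apply/seteqP; split=> x.
    by move=> [k /[!inE] /orP[/eqP->|kS] Ak]; [left|right; exists k].
  move=> [Ax|[k kS Ak]]; first by exists j => //; rewrite mem_head.
  by exists k => //; rewrite inE kS orbT.
rewrite (_ : \bigcup_j A j = [set x | exists2 j, j \in enum 'I_n & A j x]) //.
apply/seteqP; split=> x [j ? ?]; exists j => //.
by rewrite mem_enum.
Qed.

Lemma zariski_open_bigcap_ord (n : nat) (A : 'I_n -> set P) :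
  (forall j, zopen (A j)) -> zopen (\bigcap_j A j).
Proof.
by move=> oA; rewrite /zariski_open setC_bigcap; exact: zariski_closed_bigcup_ord.
Qed.

Lemma zariski_openI A B : zopen A -> zopen B -> zopen (A `&` B).
Proof. by move=> oA oB; rewrite /zariski_open setCI; exact: zariski_closedU. Qed.

End ZariskiClosed.

(** Continuity of a map that lifts to a polynomial map of homogeneous coordinates; it serves for
    slices, projections to a factor and linear changes of coordinates. *)
Lemma zariski_closed_preimage (K : fieldType) (P T I P' T' I' : Type)
    (rep : T -> P -> Prop) (coords : I -> T -> K)
    (rep' : T' -> P' -> Prop) (coords' : I' -> T' -> K)
    (phi : P -> P') (psi : T -> T') (A : set P') :
  (forall t x, rep t x -> rep' (psi t) (phi x)) ->
  (forall i, polynomial_function coords (coords' i \o psi)) ->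
  zariski_closed rep' coords' A -> zariski_closed rep coords (phi @^-1` A).
Proof.
move=> rr pc [S [Sp SP]]; exists [set g \o psi | g in S]; split.
  by move=> _ [g /Sp pg <-]; exact: polynomial_function_comp pg.
move=> t x /rr tx; split=> [/(SP _ _ tx) h _ [g Sg <-]|h]; first exact: h.
by apply/(SP _ _ tx) => g Sg; apply: (h (g \o psi)); exists g.
Qed.

Section Proj.
Variables (K : fieldType) (V : vectType K).
Implicit Types (x y : Defs.proj V) (v w : V).

Lemma proj_represents x : exists v, represents v x.
Proof.
have x1 := eqP (valP x); exists (vpick (val x)); split; last exact: memv_pick.
by rewrite vpick0 -dimv_eq0 x1.
Qed.

Lemma represents_line v x : represents v x -> val x = <[v]>%VS.
Proof.
move=> [v0 vx]; apply/eqP; rewrite eq_sym eqEdim -memvE vx.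
by rewrite (eqP (valP x)) dim_vline v0.
Qed.

Lemma line_proj v : v != 0 -> exists x, represents v x.
Proof.
move=> v0; have d1 : \dim <[v]> == 1%N by rewrite dim_vline v0.
by exists (exist _ <[v]>%VS d1); split; rewrite //= memv_line.
Qed.

Lemma represents_inj v x y : represents v x -> represents v y -> x = y.
Proof. by move=> /represents_line xv /represents_line yv; apply: val_inj; rewrite xv yv. Qed.

Lemma represents_scale v w x : represents v x -> represents w x ->
  exists2 a, a != 0 & w = a *: v.
Proof.
move=> /represents_line xE [w0]; rewrite xE => /vlineP[a wE]; exists a => //.
by apply: contraNneq w0 => a0; rewrite wE a0 scale0r.
Qed.

Lemma representsZ a v x : a != 0 -> represents v x -> represents (a *: v) x.
Proof. by move=> a0 [v0 vx]; split; [rewrite scaler_eq0 negb_or a0|rewrite memvZ]. Qed.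

End Proj.

Lemma proj_map (K : fieldType) (V V' : vectType K) (f : V -> V') :
  (forall a v, f (a *: v) = a *: f v) -> (forall v, v != 0 -> f v != 0) ->
  exists phi : Defs.proj V -> Defs.proj V', forall v x, represents v x -> represents (f v) (phi x).
Proof.
move=> fZ f0.
have /choice[phi phiP] : forall x : Defs.proj V, exists y : Defs.proj V',
    forall v, represents v x -> represents (f v) y.
  move=> x; have [v vx] := proj_represents x.
  have [y vy] := line_proj (f0 _ vx.1); exists y => w wx.
  by have [a a0 ->] := represents_scale vx wx; rewrite fZ; exact: representsZ.
by exists phi => v x vx; exact: phiP.
Qed.

(** * Growth of independent forms and dimension *)

Lemma meval_sum (K : comNzRingType) n (w : 'I_n -> K) (J : Type) (r : seq J)
    (P : pred J) (f : J -> mpoly n K) :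
  meval w (\sum_(j <- r | P j) f j) = \sum_(j <- r | P j) meval w (f j).
Proof. exact: raddf_sum. Qed.

Section Homogeneous.
Variables (K : comNzRingType) (n : nat).
Implicit Types (p q : mpoly n K) (v : 'rV[K]_n).

Lemma dhomog_mdeg d p m : p \is ishomog1 d mdeg -> m \in msupp p -> mdeg m = d.
Proof. by move=> /dhomogP; exact. Qed.

Lemma ev_dhomogZ d p a v : p \is ishomog1 d mdeg -> ev (a *: v) p = a ^+ d * ev v p.
Proof.
move=> hp; rewrite !mevalE mulr_sumr big_seq [RHS]big_seq.
apply: eq_bigr => m /(dhomog_mdeg hp) <-; rewrite mulrCA; congr (_ * _).
rewrite mdegE -prodrXr -big_split /=.
by apply: eq_bigr => i _; rewrite mxE exprMn.
Qed.

Lemma pihomogMl e d p q : p \is ishomog1 e mdeg ->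
  pihomog mdeg (e + d) (p * q) = p * pihomog mdeg d q.
Proof.
move=> hp; set k := maxn (msize q) d.+1.
have [qk dk] : (msize q <= k)%N /\ (d < k)%N.
  by rewrite leq_maxl leq_maxr.
rewrite {1}(pihomog_partitionE qk) mulr_sumr raddf_sum /= (bigD1 (Ordinal dk)) //=.
rewrite pihomog_dE ?big1 ?addr0 //; last exact/dhomogM/pihomogP.
move=> i; rewrite -val_eqE /= => id; apply: (@pihomog_ne0 _ _ _ (e + i)).
  by rewrite eqn_add2l.
exact/dhomogM/pihomogP.
Qed.

Lemma dhomog_monomial (m : multinom n) d : mdeg m = d ->
  mpolyX K m \is ishomog1 d mdeg.
Proof. by move=> md; rewrite dhomogX; apply/eqP. Qed.

Lemma dhomogXU i : (XU i : mpoly n K) \is ishomog1 1 mdeg.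
Proof. by apply: dhomog_monomial; rewrite mdeg1. Qed.

End Homogeneous.

Section Cones.
Variables (K : closedFieldType) (n : nat).
Hypothesis Kuncountable : ~ countable [set: K].
Implicit Types (p q f g : mpoly n K) (v : 'rV[K]_n) (X W : set 'rV[K]_n).

Definition vanishes X p := forall v, X v -> ev v p = 0.

Definition scalable_set X := forall a v, a != 0 -> X v -> X (a *: v).

Lemma vanishesD X p q : vanishes X p -> vanishes X q -> vanishes X (p + q).
Proof. by move=> Xp Xq v Xv; rewrite mevalD Xp // Xq // addr0. Qed.

Lemma vanishesM X p q : vanishes X q -> vanishes X (p * q).
Proof. by move=> Xq v Xv; rewrite mevalM Xq // mulr0. Qed.

(** On the line through [v], [p] restricts to a polynomial [Q] whose coefficients are the values at
    [v] of its homogeneous components, and [Q] vanishes away from [0]. If it were nonzero,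
    [Q * 'X - 1] would have a root, which is neither [0] nor a zero of [Q]. *)
Lemma vanishes_pihomog X p d : scalable_set X -> vanishes X p ->
  vanishes X (pihomog mdeg d p).
Proof.
move=> Xs Xp v Xv; set k := maxn (msize p) d.+1.
have [pk dk] : (msize p <= k)%N /\ (d < k)%N by rewrite leq_maxl leq_maxr.
pose Q := \poly_(e < k) ev v (pihomog mdeg e p).
have QE a : Q.[a] = ev (a *: v) p.
  rewrite horner_poly {2}(pihomog_partitionE pk) meval_sum.
  apply: eq_bigr => e _; rewrite mulrC; apply/esym/ev_dhomogZ.
  exact: pihomogP.
have Q0 : Q = 0.
  apply: contrapT => /eqP Q0.
  have /closed_rootP[a] : size (Q * 'X - 1) != 1%N.
    rewrite size_addl ?size_mulX // ?size_polyN ?size_polyC ?oner_eq0 //=.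
      by rewrite eqSS size_poly_eq0.
    by rewrite ltnS lt0n size_poly_eq0.
  rewrite rootE !hornerE QE; have [->|a0] := eqVneq a 0.
    by rewrite mulr0 add0r oppr_eq0 oner_eq0.
  by rewrite Xp ?mul0r ?add0r ?oppr_eq0 ?oner_eq0 //; exact: Xs.
by have := congr1 (fun q : {poly K} => q`_d) Q0; rewrite coef_poly dk coef0.
Qed.

Definition closed_cone X := [/\ forall v, X v -> v != 0, scalable_set X &
  exists S : set (mpoly n K), forall v, v != 0 ->
    (X v <-> forall p, S p -> ev v p = 0)].

Section Avoiding.
Variables (X : set 'rV[K]_n) (q : nat) (iota : 'I_q -> 'I_n).
Hypotheses (Xc : closed_cone X)
  (Xavoids : forall v, X v -> exists k, v 0 (iota k) != 0).

(** This is the ideal I(X) + (the coordinates [iota k]). By [Xavoids] it has no common zero besides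
    possibly the origin, so it contains a power of every variable and all monomials of large
    degree. *)
Definition in_linear_span p := exists h : 'I_q -> mpoly n K,
  vanishes X (p - \sum_k XU (iota k) * h k).

Lemma ideal_in_linear_span : is_ideal in_linear_span.
Proof.
split.
- exists (fun=> 0) => v _; rewrite big1 ?subr0 ?meval0 // => k _.
  by rewrite mulr0.
- move=> p p' [h hp] [h' hp']; exists (fun k => h k + h' k).
  under eq_bigr do rewrite mulrDr.
  by rewrite big_split /= opprD addrACA; exact: vanishesD.
- move=> p p' [h hp]; exists (fun k => p * h k).
  under eq_bigr do rewrite mulrCA.
  by rewrite -mulr_sumr -mulrBr; exact: vanishesM.
Qed.

Lemma power_in_linear_span i : exists k, in_linear_span (XU i ^+ k).
Proof.
apply: contrapT => /forallNP nok.
have [X0 Xs [S SP]] := Xc.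
have [w wI] := nullstellensatz Kuncountable ideal_in_linear_span nok.
rewrite mevalXU => wi.
pose v : 'rV_n := \row_j w j.
have evw p : ev v p = meval w p by apply: meval_eq => j; rewrite mxE.
have v0 : v != 0 by apply/rV0Pn; exists i; rewrite mxE.
have Xv : X v.
  apply/(SP _ v0) => p Sp; rewrite evw; apply: wI; exists (fun=> 0) => u Xu.
  rewrite big1 ?subr0 => [|k _]; last by rewrite mulr0.
  exact: ((SP u (X0 _ Xu)).1 Xu).
have [k] := Xavoids Xv; rewrite mxE -mevalXU wI ?eqxx //.
exists (fun j => (j == k)%:R) => u _.
rewrite (bigD1 k) //= eqxx mulr1 big1 ?addr0 ?subrr ?meval0 // => j /negPf ->.
by rewrite mulr0.
Qed.

Lemma monomial_in_linear_span : exists D, forall m, (D <= mdeg m)%N ->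
  in_linear_span (mpolyX K m).
Proof.
have /choice[k kP] := power_in_linear_span.
have [_ _ IM] := ideal_in_linear_span.
exists (\sum_i k i).+1 => m mD.
have [i ki] : exists i, (k i <= m i)%N.
  apply/not_existsP => h; move: mD; rewrite ltnNge => /negP; apply.
  rewrite mdegE; apply: leq_sum => i _; rewrite leqNgt; apply/negP => kmi.
  exact: (h i (ltnW kmi)).
rewrite mpolyXE_id (bigD1 i) //= -(subnK ki) exprD mulrAC.
exact: IM.
Qed.

(** Taking components of degree [(D + s).+1] makes the cofactors homogeneous. Iterated, this is
    Noether normalization: the coordinate ring of [X] is a finite module over the polynomials in the
    [q] chosen coordinates. *)
Lemma dhomog_linear_span : exists D, forall s f, f \is ishomog1 (D + s).+1 mdeg ->
  exists2 h : 'I_q -> mpoly n K, forall k, h k \is ishomog1 (D + s) mdeg &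
    vanishes X (f - \sum_k XU (iota k) * h k).
Proof.
have [D DP] := monomial_in_linear_span.
exists D => s f hf.
have [h hE] : in_linear_span f.
  have [I0 ID IM] := ideal_in_linear_span.
  rewrite [f]mpolyE big_seq; elim/big_ind: _ => // m mf.
  rewrite -mul_mpolyC; apply: (IM); apply: DP.
  by rewrite (dhomog_mdeg hf) //= -addnS leq_addr.
exists (fun k => pihomog mdeg (D + s) (h k)) => [k|]; first exact: pihomogP.
have [_ Xs _] := Xc.
have := vanishes_pihomog (D + s).+1 Xs hE.
rewrite raddfB /= pihomog_dE //.
rewrite (_ : pihomog _ _ (\sum_ _ _) =
  \sum_k XU (iota k) * pihomog mdeg (D + s) (h k)) // raddf_sum.
by apply: eq_bigr => k _; exact: (@pihomogMl _ _ 1 (D + s) _ _ (dhomogXU _ _)).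
Qed.

Definition spanned (L : seq (mpoly n K)) f :=
  exists c : 'I_(size L) -> K, vanishes X (f - \sum_i c i *: L`_i).

Lemma spanned_mem L f : f \in L -> spanned L f.
Proof.
move=> fL; have fL' : (index f L < size L)%N by rewrite index_mem.
exists (fun i => (i == Ordinal fL')%:R) => v _.
rewrite (bigD1 (Ordinal fL')) //= eqxx scale1r nth_index // big1 ?addr0.
  by rewrite subrr meval0.
by move=> i /negPf ->; rewrite scale0r.
Qed.

Lemma spanned_lin L (J : Type) (r : seq J) (a : J -> K) (g : J -> mpoly n K) f :
  (forall j, spanned L (g j)) -> vanishes X (f - \sum_(j <- r) a j *: g j) ->
  spanned L f.
Proof.
move=> /choice[c cP] fE; exists (fun i => \sum_(j <- r) a j * c j i) => v Xv.
rewrite mevalB; have := fE v Xv; rewrite mevalB => /eqP; rewrite subr_eq0 => /eqP ->.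
rewrite !meval_sum -[RHS](subrr (\sum_(j <- r) a j * ev v (g j))).
congr (_ - _); first by apply: eq_bigr => j _; rewrite mevalZ.
under eq_bigr do rewrite mevalZ mulr_suml.
rewrite exchange_big; apply: eq_bigr => j _ /=.
have := cP j v Xv; rewrite mevalB => /eqP; rewrite subr_eq0 => /eqP ->.
rewrite meval_sum mulr_sumr; apply: eq_bigr => i _ /=.
by rewrite mevalZ mulrA.
Qed.

Lemma spannedMl L L' f g : (forall h, h \in L -> spanned L' (g * h)) ->
  spanned L f -> spanned L' (g * f).
Proof.
move=> LL' [c cP].
apply: (@spanned_lin L' _ (index_enum 'I_(size L)) c (fun i => g * L`_i)).
  by move=> i; apply/LL'/mem_nth.
under eq_bigr do rewrite scalerAr.
by rewrite -mulr_sumr -mulrBr; exact: vanishesM.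
Qed.

End Avoiding.

Definition monomials (m d : nat) : seq (multinom m) :=
  [seq s2m t | t : d.-tuple 'I_m <- enum (basis m d)].

Definition coord_monomials (q : nat) (iota : 'I_q -> 'I_n) (D s : nat) : seq (mpoly n K) :=
  allpairs (fun (b : multinom q) (m : multinom n) =>
     (\prod_k XU (iota k) ^+ b k) * mpolyX K m) (monomials q s) (monomials n D).

(** The upper bound on the Hilbert function: beyond degree [D], each further degree is paid by one
    of the [q] coordinates, so for positive [q] the dimension is at most a constant times
    ['C(s + q - 1, q - 1)]. *)
Lemma spanned_coord_monomials X (q : nat) (iota : 'I_q -> 'I_n) : closed_cone X ->
  (forall v, X v -> exists k, v 0 (iota k) != 0) ->
  exists D, forall s f, f \is ishomog1 (D + s) mdeg ->
    spanned X (coord_monomials iota D s) f.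
Proof.
move=> Xc Xa; have [D DP] := dhomog_linear_span Xc Xa.
exists D; elim=> [|s IH] f; rewrite ?addn0 ?addnS => hf.
  have XfE : vanishes X (f - \sum_(m <- msupp f) mcoeff m f *: mpolyX K m).
    by move=> v _; rewrite -mpolyE subrr meval0.
  (* [spanned_lin] asks for every monomial, not only those of [f], to be spanned; those of another
     degree are replaced by [0]. *)
  have fE : f = \sum_(m <- msupp f) mcoeff m f *:
      (if mdeg m == D then mpolyX K m else 0).
    rewrite {1}[f]mpolyE big_seq [RHS]big_seq; apply: eq_bigr => m mf.
    by rewrite (dhomog_mdeg hf) // eqxx.
  apply: (@spanned_lin X _ _ (msupp f) (fun m => mcoeff m f)
    (fun m => if mdeg m == D then mpolyX K m else 0)) => [m|v _]; last first.
    by rewrite {1}fE subrr meval0.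
  case: eqP => [mD|_]; last first.
    exists (fun=> 0) => v _; rewrite big1 ?subr0 ?meval0 // => k _.
    by rewrite scale0r.
  apply: spanned_mem; apply/allpairsP; exists (mnm0, m); split.
  - by rewrite -basis_cover mdeg0.
  - by rewrite -basis_cover mD.
  - rewrite big1 ?mul1r // => k _.
    by rewrite mnm0E expr0.
have [h hh hE] := DP s f hf.
apply: (@spanned_lin X _ _ (index_enum 'I_q) (fun=> 1)
  (fun k => XU (iota k) * h k)) => [k|]; last first.
  by under eq_bigr do rewrite scale1r.
apply: (@spannedMl X (coord_monomials iota D s)); last exact: IH.
move=> _ /allpairsP[[b m] [/= + mD ->]].
rewrite -basis_cover => /eqP bs; apply: spanned_mem.
apply/allpairsP; exists (mnm_add b (mnm1 k), m); split => //=.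
  by rewrite -basis_cover mdegD mdeg1 bs addn1.
rewrite mulrA; congr (_ * _).
rewrite [in RHS](bigD1 k) //= [in LHS](bigD1 k) //= mnmDE mnm1E eqxx addn1 exprS.
rewrite mulrA; congr (_ * _); apply: eq_bigr => j jk.
by rewrite mnmDE mnm1E eq_sym (negPf jk) addn0.
Qed.

Definition independent_on X m (f : 'I_m -> mpoly n K) :=
  forall c : 'I_m -> K, vanishes X (\sum_i c i *: f i) -> forall i, c i = 0.

Definition has_independent X (D m : nat) := exists2 f : 'I_m -> mpoly n K,
  forall i, f i \is ishomog1 D mdeg & independent_on X f.

Lemma spanned_dependent X m L (f : 'I_m -> mpoly n K) :
  (forall i, spanned X L (f i)) -> independent_on X f -> (m <= size L)%N.
Proof.
move=> /choice[c cP] fi; rewrite leqNgt; apply/negP => Lm.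
have [u u0 uA] := left_kernel_nonzero (\matrix_(i, j) c i j) Lm.
case/eqP: u0; apply/rowP => i; rewrite mxE; apply: (fi (fun i => u 0 i)) => v Xv.
have E j : ev v (f j) = \sum_k c j k * ev v (L`_k).
  have /eqP := cP j v Xv; rewrite mevalB subr_eq0 => /eqP ->.
  by rewrite meval_sum; apply: eq_bigr => k _; rewrite mevalZ.
rewrite meval_sum; under eq_bigr do rewrite mevalZ E mulr_sumr.
rewrite exchange_big big1 // => k _ /=.
under eq_bigr do rewrite mulrA.
rewrite -mulr_suml; have /rowP/(_ k) := uA; rewrite !mxE => h.
by rewrite (_ : \sum_(_ < _) _ = 0) ?mul0r // -[RHS]h; apply: eq_bigr => j _; rewrite mxE.
Qed.

Lemma size_coord_monomials (q : nat) (iota : 'I_q.+1 -> 'I_n) D s :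
  size (coord_monomials iota D s) = ('C(s + q, q) * size (monomials n D))%N.
Proof. by rewrite size_allpairs size_basis -bin_sub ?leq_addr // addKn. Qed.

Lemma has_independent_le X D m m' : (m' <= m)%N ->
  has_independent X D m -> has_independent X D m'.
Proof.
move=> mm [f hf fi]; exists (fun i => f (widen_ord mm i)) => [i|c cE i]; first exact: hf.
pose c' (j : 'I_m) : K := if (insub (val j) : option 'I_m') is Some k then c k else 0.
have c'E (k : 'I_m') : c' (widen_ord mm k) = c k.
  by rewrite /c' /= insubT //= => km; congr c; apply: val_inj.
rewrite -c'E; apply: fi => v Xv; rewrite -[RHS](cE v Xv); congr (meval _ _).
rewrite (bigID (fun j : 'I_m => (j < m')%N)) /= [X in _ + X]big1 ?addr0.
  rewrite (big_ord_narrow mm) /=; apply: eq_bigr => k _.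
  by rewrite c'E.
by move=> j jm'; rewrite /c' insubF ?scale0r //; exact: negbTE.
Qed.

Lemma has_independent_sub X X' D m : X `<=` X' -> has_independent X D m ->
  has_independent X' D m.
Proof. by move=> XX [f hf fi]; exists f => // c h; apply: fi => v /XX; exact: h. Qed.

Lemma has_independent_nonempty X D m : (0 < m)%N -> has_independent X D m -> X !=set0.
Proof.
move=> m0 [f _ fi]; apply: contrapT => X0.
have h : vanishes X (\sum_i 1 *: f i) by move=> v Xv; case: X0; exists v.
by have /eqP := fi (fun=> 1) h (Ordinal m0); rewrite oner_eq0.
Qed.

Definition prime_cone X := forall d e p q, p \is ishomog1 d mdeg ->
  q \is ishomog1 e mdeg -> vanishes X (p * q) -> vanishes X p \/ vanishes X q.

Lemma vanishes_exp X d p k : prime_cone X -> X !=set0 -> p \is ishomog1 d mdeg ->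
  vanishes X (p ^+ k) -> vanishes X p.
Proof.
move=> Xp [v Xv] hp; elim: k => [|k IH]; rewrite ?expr0 ?exprS.
  by move=> /(_ v Xv); rewrite meval1 => /eqP; rewrite oner_eq0.
by move=> /(Xp _ _ _ _ hp (dhomogMn k hp)) [|/IH].
Qed.

(* Forms independent on [X] stay independent modulo the forms vanishing on [X];
   forms [g * w] with [g] vanishing on [X] contribute the rest. *)
Lemma has_independentD X W D e m1 m2 g : X `<=` W -> prime_cone W ->
  g \is ishomog1 e mdeg -> vanishes X g -> ~ vanishes W g ->
  has_independent X (e + D) m1 -> has_independent W D m2 ->
  has_independent W (e + D) (m1 + m2).
Proof.
move=> XW Wp hg Xg Wg [f hf fi] [f' hf' fi'].
pose F (i : 'I_(m1 + m2)) := match fintype.split i with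
  | inl j => f j | inr j => g * f' j end.
have Fl j : F (lshift m2 j) = f j by rewrite /F (unsplitK (inl j)).
have Fr j : F (rshift m1 j) = g * f' j by rewrite /F (unsplitK (inr j)).
have hc' (c : 'I_m2 -> K) : \sum_i c i *: f' i \is ishomog1 D mdeg.
  by apply: rpred_sum => i _; exact/rpredZ.
exists F => [i|c cE].
  by rewrite /F; case: fintype.split => j; [exact: hf|exact: dhomogM].
have cE' : vanishes W (\sum_i c (lshift m2 i) *: f i +
    g * \sum_i c (rshift m1 i) *: f' i).
  move=> v Wv; rewrite -[RHS](cE v Wv) big_split_ord /= mulr_sumr; congr (meval _ (_ + _)).
    by apply: eq_bigr => j _; rewrite Fl.
  by apply: eq_bigr => j _; rewrite Fr scalerAr.
have cl : forall i, c (lshift m2 i) = 0.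
  apply: fi => v Xv; have := cE' v (XW _ Xv).
  by rewrite mevalD mevalM Xg // mul0r addr0.
have cr : forall i, c (rshift m1 i) = 0.
  apply: fi'.
  have : vanishes W (g * \sum_i c (rshift m1 i) *: f' i).
    move=> v Wv; have := cE' v Wv; rewrite big1 ?add0r // => i _.
    by rewrite cl scale0r.
  by case/(Wp _ _ _ _ hg (hc' _)).
by move=> a; rewrite -[a]splitK; case: fintype.split => j /=.
Qed.

(** A lower bound on the Hilbert function, of the order expected in dimension [l]. Only degrees
    divisible by [E] occur, and the free factor [k] absorbs the degree of the auxiliary form of
    [growth_step]. *)
Definition growth X (l : nat) := exists2 E, (0 < E)%N &
  forall k s, (0 < k)%N -> has_independent X (k * E * s) 'C(s + l, l).

Lemma growth_nonempty X l : growth X l -> X !=set0.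
Proof.
move=> [E _ /(_ 1%N 0%N isT)]; rewrite add0n binn; exact: has_independent_nonempty.
Qed.

Lemma growth_sub X X' l : X `<=` X' -> growth X l -> growth X' l.
Proof.
by move=> XX [E E0 h]; exists E => // k s k0; apply: has_independent_sub XX _; exact: h.
Qed.

Lemma has_independent1 X d g : g \is ishomog1 d mdeg -> ~ vanishes X g ->
  has_independent X d 1.
Proof.
move=> hg Xg; exists (fun=> g) => // c cE i; apply: contrapT => /eqP ci.
apply: Xg => v Xv; have /eqP := cE v Xv.
rewrite big_ord1 mevalZ mulf_eq0 (_ : c ord0 = c i) ?(negPf ci); last first.
  by rewrite (ord1 i).
by move/eqP.
Qed.

Lemma growth0 X v : X v -> v != 0 -> growth X 0.
Proof.
move=> Xv /rV0Pn[i vi]; exists 1%N => // k s _; rewrite bin0.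
apply: (@has_independent1 _ _ (XU i ^+ (k * 1 * s))).
  by have := dhomogMn (k * 1 * s) (dhomogXU K i); rewrite mul1n.
move=> /(_ v Xv) /eqP; rewrite rmorphXn /= mevalXU.
by apply/negP; rewrite expf_neq0.
Qed.

(** Pascal's rule. When [s] increases by one, [X] contributes ['C(s.+1 + l, l)] independent forms,
    and the multiples by [g ^+ (k * E)] of the forms already found on [W] contribute
    ['C(s + l.+1, l.+1)]. *)
Lemma growth_step X W l : X `<=` W -> prime_cone W ->
  (exists e g, [/\ g \is ishomog1 e mdeg, vanishes X g & ~ vanishes W g]) ->
  growth X l -> growth W l.+1.
Proof.
move=> XW Wp [e [g [hg Xg Wg]]] gX; have [v Xv] := growth_nonempty gX.
have [E E0 h] := gX.
have W0 : W !=set0 by exists v; exact: XW.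
(* A form of degree [0] is constant: vanishing at [v], it would vanish on [W]. *)
have e0 : (0 < e)%N.
  rewrite lt0n; apply/eqP => e0; apply: Wg => w Ww.
  have := ev_dhomogZ 0 w hg; have := ev_dhomogZ 0 v hg.
  by rewrite e0 !expr0 !mul1r !scale0r (Xg v Xv) => -> /esym.
exists (E * e)%N => [|k s k0]; first by rewrite muln_gt0 E0.
have kE : (0 < k * E)%N by rewrite muln_gt0 k0.
have hgk : g ^+ (k * E) \is ishomog1 (k * (E * e)) mdeg.
  by rewrite (_ : (k * (E * e) = e * (k * E))%N) ?dhomogMn // mulnA mulnC.
have Wgk : ~ vanishes W (g ^+ (k * E)) by move=> /(vanishes_exp Wp W0 hg).
elim: s => [|s IH].
  rewrite muln0 add0n binn; apply: (@has_independent1 _ _ 1); first exact: dhomog1.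
  by case: W0 => w Ww /(_ w Ww) /eqP; rewrite meval1 oner_eq0.
rewrite addSn binS addnC mulnS -addSnnS.
apply: (has_independentD XW Wp hgk) => //.
  by move=> w Xw; rewrite rmorphXn /= Xg // expr0n; case: (k * E)%N kE.
  rewrite -mulnS (_ : (k * (E * e) * s.+1 = (k * e) * E * s.+1)%N); last first.
  by rewrite [(E * e)%N]mulnC !mulnA.
  by apply: h; rewrite muln_gt0 k0.
by rewrite addSnnS.
Qed.

(** Equivalently, the map from [X] to affine [q]-space with components [y] is dominant. *)
Definition algebraically_free X (q : nat) (y : 'I_q -> mpoly n K) :=
  forall P : mpoly q K, (forall v, X v -> meval (fun k => ev v (y k)) P = 0) -> P = 0.

(** The monomials of degree [k * s] in the [y] are independent on [X], because a linear relation
    between them is a polynomial relation between the [y]. *)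
Lemma growth_of_free_forms X (q : nat) (y : 'I_q.+1 -> mpoly n K) :
  (forall k, y k \is ishomog1 1 mdeg) -> algebraically_free X y -> growth X q.
Proof.
move=> hy yfree; exists 1%N => // k s k0; rewrite muln1.
apply: (@has_independent_le _ _ 'C(k * s + q, q)).
  by apply: leq_bin2l; rewrite leq_add2r leq_pmull.
rewrite -[X in has_independent _ _ X]bin_sub ?leq_addl // addnK -size_basis.
set L := map _ _.
pose f (i : 'I_(size L)) : mpoly n K := \prod_k y k ^+ (nth mnm0 L i k).
exists f => [i|c cE i].
  have : nth mnm0 L i \in L by exact: mem_nth.
  rewrite -basis_cover => /eqP <-; rewrite mdegE /f.
  elim/big_rec2: _ => [|j m p _ hp]; first exact: dhomog1.
  by apply: dhomogM => //; have := dhomogMn (nth mnm0 L i j) (hy j); rewrite mul1n.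
have P0 : \sum_i c i *: mpolyX K (nth mnm0 L i) = 0.
  apply: yfree => v Xv; rewrite -[RHS](cE v Xv) !meval_sum; apply: eq_bigr => j _.
  rewrite !mevalZ mevalX /f rmorph_prod; congr (_ * _).
  by apply: eq_bigr => k' _; rewrite rmorphXn.
have := congr1 (mcoeff (nth mnm0 L i)) P0; rewrite mcoeff0 raddf_sum /= (bigD1 i) //=.
rewrite mcoeffZ mcoeffX eqxx mulr1 big1 ?addr0 // => j ji.
by rewrite mcoeffZ mcoeffX nth_uniq ?uniq_basis // (inj_eq val_inj) (negPf ji) mulr0.
Qed.

(** In degree [E * s] there are at least [s ^ l / l!] independent forms, whereas
    [spanned_coord_monomials] allows at most a constant times [s ^ (q - 1)]. *)
Lemma growth_lt X Y (q : nat) (iota : 'I_q -> 'I_n) l : closed_cone Y ->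
  (forall v, Y v -> exists k, v 0 (iota k) != 0) -> X `<=` Y ->
  growth X l -> (l < q)%N.
Proof.
move=> Yc Ya XY /(growth_sub XY) gY.
case: q iota Ya => [|q] iota Ya.
  by have [v /Ya[[]]] := growth_nonempty gY.
rewrite ltnS leqNgt; apply/negP => ql.
have [D DP] := spanned_coord_monomials Yc Ya; have [E E0 h] := gY.
set M := size (monomials n D).
(* With [q] now standing for the former [q - 1], [B] collects the constants of [le1], [le2] and
   [le3], so that [s ^ l <= B * s ^ q], which fails for [l > q] once [s > B]. That [s] also exceeds
   [D] and [q] serves for [Es] and [le3]. *)
pose B := (l`! * M * E.+1 ^ q)%N.
pose s := (B + q + l + D).+1.
have Es : (D <= 1 * E * s)%N.
  rewrite mul1n; apply: (@leq_trans s); last exact: leq_pmull.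
  by rewrite /s leqW // leq_addl.
have [f hf fi] := h 1%N s isT.
have le1 : ('C(s + l, l) <= 'C(1 * E * s - D + q, q) * M)%N.
  rewrite -(size_coord_monomials iota); apply: (spanned_dependent _ fi) => i.
  by apply: DP; rewrite subnKC.
have le2 : (s ^ l <= l`! * 'C(s + l, l))%N.
  rewrite mulnC bin_ffact; elim: (l) => [|l' IH]; first by rewrite expn0 ffactn0.
  by rewrite expnS addnS ffactSS leq_mul // (leq_trans (leq_addr l' _)).
have expn_le a b e : (a <= b)%N -> (a ^ e <= b ^ e)%N.
  by move=> ab; elim: e => // e IH; rewrite !expnS leq_mul.
have le3 : ('C(1 * E * s - D + q, q) <= (E.+1 * s) ^ q)%N.
  apply: leq_trans (_ : (1 * E * s - D + q) ^_ q <= _)%N.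
    by rewrite -bin_ffact leq_pmulr ?fact_gt0.
  apply: (@leq_trans ((1 * E * s - D + q) ^ q)%N).
    elim: (q) (_ - _ + _)%N => [|q' IH] N; first by rewrite ffactn0.
    rewrite ffactnS expnS leq_mul //; apply: leq_trans (IH _) _.
    exact/expn_le/leq_pred.
  apply: expn_le; rewrite mul1n mulSn addnC leq_add ?leq_subr //.
  by rewrite /s leqW // -!addnA addnCA leq_addr.
have : (s ^ l <= B * s ^ q)%N.
  apply: leq_trans le2 _; rewrite /B -!mulnA leq_mul2l; apply/orP; right.
  apply: leq_trans le1 _; rewrite mulnC leq_mul2l; apply/orP; right.
  by rewrite -expnMn.
rewrite leqNgt => /negP; apply.
apply: (@leq_trans (s ^ q.+1)%N); last by rewrite leq_pexp2l.
rewrite expnS ltn_pmul2r ?expn_gt0 //.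
by rewrite /s ltnS -!addnA leq_addr.
Qed.

End Cones.

(** * The real-valued modulus of complex numbers *)

Section ComplexModulus.
Variable R : realType.
Local Notation C := R[i].
Implicit Types (z w : C).

Lemma complex_uncountable : ~ countable [set: C].
Proof.
move=> /countable_injP[f finj]; have cR : countable [set: R].
  apply/countable_injP; exists (f \o real_complex R) => x y _ _ fxy.
  by apply: complexI; apply: finj; rewrite ?in_setT.
have := countable_lebesgue_measure0 (sub_countable (subset_card_le (@subsetT _ `[0, 1]%classic)) cR).
rewrite lebesgue_measure_itv /= lte_fin ltr01 oppr0 adde0.
by move=> /eqP; rewrite eqe oner_eq0.
Qed.

Lemma cabsE z : `|z| = (cabs z)%:C%C.
Proof. by rewrite /cabs RRe_real // normr_real. Qed.

Lemma cabs_ge0 z : 0 <= cabs z.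
Proof. by rewrite -lecR -cabsE; exact: normr_ge0. Qed.

Lemma cabsM z w : cabs (z * w) = cabs z * cabs w.
Proof. by apply: complexI; rewrite -cabsE normrM !cabsE rmorphM. Qed.

Lemma cabsD z w : cabs (z + w) <= cabs z + cabs w.
Proof. by rewrite -lecR rmorphD /= -!cabsE ler_normD. Qed.

Lemma cabs0 : cabs (0 : C) = 0.
Proof. by apply: complexI; rewrite -cabsE normr0. Qed.

Lemma cabs1 : cabs (1 : C) = 1.
Proof. by apply: complexI; rewrite -cabsE normr1. Qed.

Lemma cabsN z : cabs (- z) = cabs z.
Proof. by apply: complexI; rewrite -!cabsE normrN. Qed.

Lemma cabs_eq0 z : (cabs z == 0) = (z == 0).
Proof. by rewrite -(inj_eq (@complexI R)) -cabsE normr_eq0. Qed.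

Lemma cabs_gt0 z : (0 < cabs z) = (z != 0).
Proof. by rewrite lt_def cabs_ge0 andbT cabs_eq0. Qed.

Lemma cabsX z k : cabs (z ^+ k) = cabs z ^+ k.
Proof. by elim: k => [|k IH]; rewrite ?expr0 ?cabs1 // !exprS cabsM IH. Qed.

Lemma cabsV z : cabs z^-1 = (cabs z)^-1.
Proof. by apply: complexI; rewrite -cabsE normfV cabsE fmorphV. Qed.

Lemma cabs_real (x : R) : cabs (x%:C)%C = `|x|.
Proof. by apply: complexI; rewrite -cabsE normc_def /= expr0n /= addr0 sqrtr_sqr. Qed.

Lemma cabs_sum (J : Type) (r : seq J) (P : pred J) (f : J -> C) :
  cabs (\sum_(j <- r | P j) f j) <= \sum_(j <- r | P j) cabs (f j).
Proof.
elim/big_rec2: _ => [|j x y _ h]; first by rewrite cabs0.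
by apply: le_trans (cabsD _ _) _; rewrite lerD2l.
Qed.

Lemma cabs_prod (J : Type) (r : seq J) (P : pred J) (f : J -> C) :
  cabs (\prod_(j <- r | P j) f j) = \prod_(j <- r | P j) cabs (f j).
Proof. by elim/big_rec2: _ => [|j x y _ <-]; rewrite ?cabs1 ?cabsM. Qed.

End ComplexModulus.

Lemma mpolyX_neq0 (K : nzRingType) n (m : multinom n) : mpolyX K m != 0.
Proof. by rewrite -msupp_eq0 msuppX. Qed.

(** * Cones over closed subsets of projective space *)

Section ProjectiveCones.
Variables (R : realType) (N : nat).
Local Notation C := R[i].
Local Notation PP := (PP R N).
Implicit Types (v : 'rV[C]_N.+1) (x : PP) (Y Z : set PP).
Let Cunc := @complex_uncountable R.

Definition cone Y : set 'rV[C]_N.+1 := [set v | exists2 x, Y x & represents v x].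

Lemma cone_represents Y v x : represents v x -> cone Y v <-> Y x.
Proof.
by move=> vx; split=> [[y Yy vy]|Yx]; [rewrite (represents_inj vx vy)|exists x].
Qed.

Lemma cone_sub Y Z : Y `<=` Z -> cone Y `<=` cone Z.
Proof. by move=> YZ v [x /YZ Zx vx]; exists x. Qed.

Lemma cone_nonzero Y v : cone Y v -> v != 0.
Proof. by case=> x _ []. Qed.

Lemma cone_scalable Y : scalable_set (cone Y).
Proof. by move=> a v a0 [x Yx vx]; exists x => //; exact: representsZ. Qed.

Lemma PPclosed_mpoly Y : PPclosed Y -> exists S : set (mpoly N.+1 C),
  forall v x, represents v x -> (Y x <-> forall p, S p -> ev v p = 0).
Proof.
move=> [S [Sp SY]].
exists [set p | S (fun v => ev v p)] => v x vx; split=> [/(SY _ _ vx) h p /h //|h].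
apply/(SY _ _ vx) => g Sg; have [m [s [p gE]]] := Sp g Sg.
have evE w : g w = ev w (comp_mpoly [tuple XU (s k) | k < m] p).
  rewrite gE comp_mpoly_meval; apply: meval_eq => k.
  by rewrite tnth_mktuple mevalXU.
by rewrite evE; apply: h => /=; rewrite -(funext evE).
Qed.

Lemma mpoly_PPclosed Y (S : set (mpoly N.+1 C)) :
  (forall v x, represents v x -> (Y x <-> forall p, S p -> ev v p = 0)) ->
  PPclosed Y.
Proof.
move=> SY; exists [set g | exists2 p, S p & g = fun v => ev v p]; split.
  by move=> _ [p _ ->]; exists N.+1, id, p.
move=> v x /SY Yx; split=> [/Yx h _ [p Sp ->]|h]; first exact: h.
by apply/Yx => p Sp; apply: (h (fun v => ev v p)); exists p.
Qed.

Lemma PPclosed_closed_cone Y : PPclosed Y -> closed_cone (cone Y).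
Proof.
move=> /PPclosed_mpoly[S SY]; split; [exact: cone_nonzero|exact: cone_scalable|].
exists S => v v0; have [x vx] := line_proj v0.
by split=> [/(cone_represents _ vx)/(SY _ _ vx)|/(SY _ _ vx)/(cone_represents _ vx)].
Qed.

(** All homogeneous components of a polynomial vanishing on the cone vanish there, and one of them
    is nonzero at [v]. *)
Lemma separating_form Z x v : PPclosed Z -> represents v x -> ~ Z x ->
  exists e g, [/\ g \is ishomog1 e mdeg, vanishes (cone Z) g & ev v g != 0].
Proof.
move=> /PPclosed_mpoly[S SZ] vx nZx.
have [p Sp pv] : exists2 p, S p & ev v p != 0.
  apply: contrapT => h; apply/nZx/(SZ _ _ vx) => p Sp.
  by apply: contrapT => /eqP pv; apply: h; exists p.
have [e pe] : exists e, ev v (pihomog mdeg e p) != 0.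
  apply: contrapT => /forallNP h; case/eqP: pv.
  rewrite (pihomog_partitionE (leqnn (msize p))) meval_sum big1 // => e _.
  by apply/eqP/negPn/negP; exact: h.
exists e, (pihomog mdeg e p); split=> //; first exact: pihomogP.
apply: vanishes_pihomog => [|w [y Zy wy]]; first exact: cone_scalable.
exact: (SZ _ _ wy).1.
Qed.

Definition zeros (p : mpoly N.+1 C) : set PP :=
  [set x | forall v, represents v x -> ev v p = 0].

Lemma zeros_closed d p : p \is ishomog1 d mdeg -> PPclosed (zeros p).
Proof.
move=> hp; apply: (@mpoly_PPclosed _ [set p]) => v x vx; split=> [h _ ->|h w wx].
  exact: h.
have [a a0 ->] := represents_scale vx wx.
by rewrite (ev_dhomogZ _ _ hp) h // mulr0.
Qed.

Lemma vanishes_zeros Y p : vanishes (cone Y) p <-> Y `<=` zeros p.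
Proof.
split=> [h x Yx v vx|h v [x Yx vx]]; first by apply: h; exists x.
exact: h vx.
Qed.

Lemma irreducible_prime_cone Z : irreducible_closed Z -> prime_cone (cone Z).
Proof.
move=> [_ _ Zi] d e p q hp hq pq; rewrite !vanishes_zeros.
apply: Zi; [exact: zeros_closed hp|exact: zeros_closed hq|].
move=> x Zx; have [v vx] := proj_represents x.
have /eqP : ev v (p * q) = 0 by apply: pq; exists x.
rewrite mevalM mulf_eq0 => /orP[] /eqP h; [left|right] => w wx;
  have [a a0 ->] := represents_scale vx wx.
- by rewrite (ev_dhomogZ _ _ hp) h mulr0.
- by rewrite (ev_dhomogZ _ _ hq) h mulr0.
Qed.

Lemma growth_irreducible Z Z' l : PPclosed Z -> irreducible_closed Z' -> Z `<` Z' ->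
  growth (cone Z) l -> growth (cone Z') l.+1.
Proof.
move=> Zc Z'i [ZZ' Z'Z]; have [x Z'x nZx] : exists2 x, Z' x & ~ Z x.
  by apply: contrapT => h; apply: Z'Z => x Z'x; apply: contrapT => ?; apply: h; exists x.
have [v vx] := proj_represents x; have [e [g [hg gZ gv]]] := separating_form Zc vx nZx.
apply: growth_step; [exact: cone_sub|exact: irreducible_prime_cone|].
exists e, g; split=> // h; case/eqP: gv; apply: h.
by exists x.
Qed.

Lemma growth_chain n W l : irreducible_chain n W -> growth (cone (W 0%N)) l ->
  growth (cone (W n)) (l + n).
Proof.
move=> [Wi Ws] g0; suff h k : (k <= n)%N -> growth (cone (W k)) (l + k) by exact: h.
elim: k => [|k IH] kn; first by rewrite addn0.
rewrite addnS; apply: growth_irreducible (IH (ltnW kn)).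
- by case: (Wi k (ltnW kn)).
- exact: Wi.
- exact: Ws.
Qed.

Lemma growth_chain0 n W : irreducible_chain n W -> growth (cone (W n)) n.
Proof.
move=> Wc; apply: (@growth_chain _ _ 0%N) => //.
have [_ [x W0x] _] := Wc.1 0%N (leq0n n); have [v vx] := proj_represents x.
by apply: (@growth0 _ _ _ v); [exists x|exact: vx.1].
Qed.

(** The chain gives growth of order [n] on its top member, and missing the common zeros of [q]
    coordinates only leaves room for orders below [q]. *)
Lemma chain_avoiding_lt Y q (iota : 'I_q -> 'I_N.+1) n W : PPclosed Y ->
  (forall v, cone Y v -> exists k, v 0 (iota k) != 0) ->
  irreducible_chain n W -> W n `<=` Y -> (n < q)%N.
Proof.
move=> /PPclosed_closed_cone Yc Ya Wc WY.
exact: growth_lt Cunc _ _ _ _ _ Yc Ya (cone_sub WY) (growth_chain0 Wc).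
Qed.

Lemma growth_cone_le Y l : growth (cone Y) l -> (l <= N)%N.
Proof.
move=> gY; rewrite -ltnS.
have cT : closed_cone (cone setT).
  apply: PPclosed_closed_cone; exists set0; split=> // v x _; split=> //.
apply: (growth_lt Cunc (iota := id)) cT _ (cone_sub (@subsetT _ Y)) gY.
by move=> v [x _ [/rV0Pn[k vk] _]]; exists k.
Qed.

Lemma mpoly_nonzero_point (n : nat) (p : mpoly n C) : p != 0 ->
  exists w, meval w p != 0.
Proof.
move=> p0; apply: contrapT => /forallNP h; case/eqP: p0.
by apply: (mpoly_vanishing_eq0 Cunc) => w; apply/eqP/negPn/negP; exact: h.
Qed.

Lemma vanishes_cone_setT (p : mpoly N.+1 C) : vanishes (cone setT) p -> p = 0.
Proof.
move=> h; apply: contrapT => /eqP p0.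
(* The extra factor ensures that the point found is a nonzero vector. *)
have pX0 : p * XU ord0 != 0.
  by rewrite mulf_neq0 // mpolyX_neq0.
have [w] := mpoly_nonzero_point pX0.
rewrite mevalM mevalXU mulf_eq0 negb_or => /andP[pw w0].
have v0 : \row_j w j != 0 by apply/rV0Pn; exists ord0; rewrite mxE.
have [x vx] := line_proj v0.
case/eqP: pw; rewrite -(h (\row_j w j)); last by exists x.
by apply: meval_eq => j; rewrite mxE.
Qed.

Lemma prime_cone_setT : prime_cone (cone setT).
Proof.
move=> d e p q _ _ /vanishes_cone_setT/eqP; rewrite mulf_eq0.
by case/orP=> /eqP->; [left|right] => v _; rewrite meval0.
Qed.

End ProjectiveCones.

(** * Linear spaces missing a closed set *)

Section CoordinateSubspaces.
Variables (R : realType) (N : nat).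
Local Notation C := R[i].
Local Notation PP := (PP R N).
Implicit Types (v w : 'rV[C]_N.+1) (x : PP) (Y Z W : set PP).
Let Cunc := @complex_uncountable R.

Section FreeForms.
Variables (q : nat) (y : 'I_q.+1 -> mpoly N.+1 C).
Hypothesis hy : forall k, y k \is ishomog1 1 mdeg.
Local Notation yv v := (fun k => ev v (y k)).

(** This serves as a descending chain condition. By the Nullstellensatz for the union of the ideals
    of the members, a relation on the intersection, multiplied by [y ord0] to exclude the origin,
    has a power vanishing on one member, which is then not free. *)
Lemma algebraically_free_bigcap (F : set (set PP)) : F !=set0 ->
  (forall Z, F Z -> PPclosed Z /\ algebraically_free (cone Z) y) ->
  (forall Z Z', F Z -> F Z' -> Z `<=` Z' \/ Z' `<=` Z) ->
  algebraically_free (cone (\bigcap_(Z in F) Z)) y.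
Proof.
move=> [Z0 FZ0] FP Ftot P PE; apply: contrapT => /eqP P0.
pose p := comp_mpoly [tuple y k | k < q.+1] (P * XU ord0).
have evp v : ev v p = meval (yv v) P * ev v (y ord0).
  rewrite comp_mpoly_meval (meval_eq (v2 := yv v)) ?mevalM ?mevalXU // => k.
  by rewrite tnth_mktuple.
pose I := [set f | exists2 Z, F Z & vanishes (cone Z) f].
have Iid : is_ideal I.
  split=> [|f g [Z FZ fZ] [Z' FZ' gZ']|f g [Z FZ gZ]].
  - by exists Z0 => // v _; rewrite meval0.
  - have [ZZ|ZZ] := Ftot _ _ FZ FZ'.
      by exists Z => //; apply: vanishesD => // v /(cone_sub ZZ); exact: gZ'.
    by exists Z' => //; apply: vanishesD => // v /(cone_sub ZZ); exact: fZ.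
  - by exists Z => //; exact: vanishesM.
have [k [Z FZ pk]] : exists k, I (p ^+ k).
  apply: contrapT => /forallNP nok.
  have [w wI wp] := nullstellensatz Cunc Iid nok.
  pose v : 'rV[C]_N.+1 := \row_j w j.
  have evw f : ev v f = meval w f by apply: meval_eq => j; rewrite mxE.
  move: wp; rewrite -evw evp mulf_eq0 negb_or => /andP[Pv yv0].
  have v0 : v != 0.
    apply: contraNneq yv0 => v0; have := ev_dhomogZ 0 v (hy ord0).
    by rewrite scale0r expr1 mul0r v0 => ->.
  have [x vx] := line_proj v0.
  case/eqP: Pv; apply: PE; exists x => // Z FZ.
  have [/PPclosed_mpoly[S SZ] _] := FP _ FZ.
  apply/(SZ _ _ vx) => f Sf; rewrite evw; apply: wI; exists Z => // u [z Zz uz].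
  exact: (SZ _ _ uz).1.
have : P * XU ord0 = 0.
  apply: (FP _ FZ).2 => v Zv; rewrite mevalM mevalXU -evp.
  have /eqP := pk v Zv; rewrite rmorphXn /= expf_eq0 => /andP[_ /eqP //].
by move/eqP; rewrite mulf_eq0 (negPf P0) (negPf (mpolyX_neq0 _ _)).
Qed.

(** A minimal closed subset on which the [y] stay free is irreducible: if two closed sets cover it
    and carry nontrivial relations [P] and [Q], then [P * Q] is a nontrivial relation on the
    whole. *)
Lemma exists_irreducible_free W : PPclosed W -> algebraically_free (cone W) y ->
  exists Z, [/\ irreducible_closed Z, Z `<=` W & algebraically_free (cone Z) y].
Proof.
move=> Wc Wf.
pose good Z := PPclosed Z /\ algebraically_free (cone Z) y.
(* Zorn's lemma yields maximal sets, hence the passage to complements: a maximal [A] leaves a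
   minimal difference with [W]. *)
have [F FP Ftot|A [[Ac Af] Amax]] := @Zorn_bigcup _ [set A | good (W `\` A)].
  have [->|/set0P[A0 FA0]] := eqVneq F set0.
    by rewrite bigcup_set0 /= setD0.
  have E : W `\` \bigcup_(X in F) X = \bigcap_(Z in [set W `\` A | A in F]) Z.
    apply/seteqP; split=> [x [Wx nx] _ [A FA <-]|x h].
      by split=> // Ax; apply: nx; exists A.
    split; first by have [] := h _ (ex_intro2 _ _ A0 FA0 erefl).
    by move=> [A FA Ax]; have [] := h _ (ex_intro2 _ _ A FA erefl).
  rewrite /= E; split.
    by apply: zariski_closed_bigcap => _ [A /FP[? _] <-].
  apply: algebraically_free_bigcap.
  - by exists (W `\` A0), A0.
  - by move=> _ [A /FP ? <-].
  - move=> _ _ [A FA <-] [B FB <-].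
    by have [AB|BA] := Ftot _ _ FA FB; [right|left]; exact: setDS.
set Z := W `\` A in Ac Af.
have Zmin Z' : Z' `<=` Z -> good Z' -> Z `<=` Z'.
  move=> Z'Z gZ'; apply: contrapT => nZ.
  apply: (Amax (A `|` (W `\` Z'))); last first.
    rewrite /= (_ : W `\` _ = Z') //; apply/seteqP; split=> [x [Wx nx]|x Z'x].
      by apply: contrapT => nZ'; apply: nx; right.
    by have [Wx nAx] := Z'Z _ Z'x; split=> // -[|[]].
  split; first exact: subsetUl.
  move=> h; apply: nZ => x [Wx nAx]; apply: contrapT => nZ'x; apply: nAx.
  by apply: h; right.
exists Z; split=> //; last by move=> x [].
split=> //.
  apply: contrapT => Z0; have : (1 : mpoly q.+1 C) = 0.
    by apply: Af => v [x Zx _]; case: Z0; exists x.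
  by move/eqP; rewrite oner_eq0.
move=> A' B' A'c B'c ZAB.
have [|nA] := pselect (algebraically_free (cone (Z `&` A')) y).
  move=> fA; left; apply: subset_trans (Zmin (Z `&` A') _ _) _.
  - exact: subIsetl.
  - by split=> //; exact: zariski_closedI.
  - exact: subIsetr.
have [|nB] := pselect (algebraically_free (cone (Z `&` B')) y).
  move=> fB; right; apply: subset_trans (Zmin (Z `&` B') _ _) _.
  - exact: subIsetl.
  - by split=> //; exact: zariski_closedI.
  - exact: subIsetr.
have {nA}[P PE /eqP P0] : exists2 P, (forall v, cone (Z `&` A') v -> meval (yv v) P = 0) & P <> 0.
  apply: contrapT => h; apply: nA => P PE; apply: contrapT => ?.
  by apply: h; exists P.
have {nB}[Q QE /eqP Q0] : exists2 P, (forall v, cone (Z `&` B') v -> meval (yv v) P = 0) & P <> 0.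
  apply: contrapT => h; apply: nB => P' PE'; apply: contrapT => ?.
  by apply: h; exists P'.
have /eqP : P * Q = 0.
  apply: Af => v [x Zx vx]; rewrite mevalM.
  have [A'x|B'x] := ZAB _ Zx; first by rewrite PE ?mul0r //; exists x.
  by rewrite [X in _ * X]QE ?mulr0 //; exists x.
by rewrite mulf_eq0 (negPf P0) (negPf Q0).
Qed.

End FreeForms.

(** Two steps come from the chain inside the hypersurface, and the third from its equation, which
    vanishes on the top of the chain but not on P^N. *)
Lemma codim_ge_growth Z W d (t : PForm R N d) l : codim_ge 2 W (hypersurface t) ->
  irreducible_closed Z -> Z `<=` W -> growth (cone Z) l -> (l + 3 <= N)%N.
Proof.
move=> cod Zi ZW gZ; have [V [Vc V0 VH]] := cod Z Zi ZW.
rewrite addnS; apply: (@growth_cone_le R N setT).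
apply: (@growth_step _ _ (cone (V 2%N))).
- exact: cone_sub.
- exact: prime_cone_setT.
- have [F Ft] := proj_represents t.
  exists d, (mpoly_of_dhomog F); split=> [|v [x Vx vx]|/vanishes_cone_setT F0].
  + exact: dhomog_is_dhomog.
  + exact: (VH _ Vx) F v Ft vx.
  + by case: Ft => /eqP + _; apply; exact: val_inj.
- by apply: growth_chain => //; rewrite V0.
Qed.

Definition mxform (A : 'M[C]_N.+1) (j : 'I_N.+1) : mpoly N.+1 C :=
  \sum_i A i j *: XU i.

Lemma ev_mxform A j v : ev v (mxform A j) = (v *m A) 0 j.
Proof.
rewrite meval_sum mxE; apply: eq_bigr => i _.
by rewrite mevalZ mevalXU mulrC.
Qed.

Lemma dhomog_mxform A j : mxform A j \is ishomog1 1 mdeg.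
Proof. by apply: rpred_sum => i _; apply/rpredZ/dhomogXU. Qed.

(** By induction on [B]. Once [W] misses the space where the coordinates outside [B'] vanish,
    multiples of the coordinate [b0] are subtracted from those outside [B]. If this never works, all
    ratios to the coordinate [b0] occur on [W], so the coordinates outside [B'] are algebraically
    free there. An irreducible part of [W] then has growth [N - b] with [b <= 2], against
    codimension three. *)
Lemma avoid_coordinate_subspace W d (t : PForm R N d) (B : {set 'I_N.+1}) :
  PPclosed W -> codim_ge 2 W (hypersurface t) -> (#|B| <= 3)%N ->
  exists2 A, A \in unitmx &
    forall v, cone W v -> exists2 j, j \notin B & (v *m A) 0 j != 0.
Proof.
move=> Wc cod; move: {2}#|B| (erefl #|B|) => b; elim: b B => [|b IH] B Bb B3.
  exists 1%:M; first exact: unitmx1.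
  move=> v /cone_nonzero /rV0Pn[j vj]; exists j; last by rewrite mulmx1.
  by rewrite (cards0_eq Bb) inE.
have [b0 b0B] : exists b0, b0 \in B by apply/card_gt0P; rewrite Bb.
pose B' := B :\ b0.
have B'b : #|B'| = b by apply/eqP; rewrite -eqSS -Bb (cardsD1 b0 B) b0B.
have [|A Au Aavoid] := IH B' B'b; first by rewrite B'b; apply: leq_trans B3; rewrite Bb.
apply: contrapT => noA.
have bN : (b <= N)%N by rewrite -ltnS -Bb; have := max_card (mem B); rewrite card_ord.
have qB : #|~: B'| = (N - b).+1.
  have := cardsC B'; rewrite card_ord B'b => /eqP.
  by rewrite -subSn // => /eqP bE; rewrite -[LHS](addKn b) bE.
pose iota (k : 'I_(N - b).+1) : 'I_N.+1 := enum_val (cast_ord (esym qB) k).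
have iotaN k : iota k \notin B' by have := enum_valP (cast_ord (esym qB) k); rewrite inE.
have iotaS j : j \notin B' -> exists k, iota k = j.
  move=> jB'; have jC : j \in ~: B' by rewrite inE.
  by exists (cast_ord qB (enum_rank_in jC j)); rewrite /iota cast_ordK enum_rankK_in.
have free : algebraically_free (cone W) (fun k => mxform A (iota k)).
  move=> P PE; apply: contrapT => /eqP P0.
  have [k0 k0b] : exists k, iota k = b0 by apply: iotaS; rewrite !inE eqxx.
  have [u] := mpoly_nonzero_point (mulf_neq0 P0 (mpolyX_neq0 _ (mnm1 k0))).
  rewrite mevalM mevalXU mulf_eq0 negb_or => /andP[Pu u0].
  have /choice[kk kkP] : forall j, exists k, j \notin B' -> iota k = j.
    move=> j; have [jB|jB] := boolP (j \in B'); first by exists ord0.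
    by have [k <-] := iotaS j jB; exists k.
  (* [c] prescribes the ratios of a point [u] at which the supposed relation [P] is nonzero, with
     [u k0] nonzero too. As [e *m c] has square zero, [1%:M - e *m c] is invertible. *)
  pose c : 'rV[C]_N.+1 := \row_j if j \in B then 0 else u (kk j) / u k0.
  pose e : 'cV[C]_N.+1 := \col_j (j == b0)%:R.
  have ce : c *m e = 0.
    apply/rowP => k; rewrite !mxE (bigD1 b0) //= big1 ?addr0.
      by rewrite !mxE b0B mul0r.
    by move=> j /negPf jb; rewrite !mxE jb mulr0.
  have ec2 : (e *m c) *m (e *m c) = 0 by rewrite mulmxA -(mulmxA e) ce mulmx0 mul0mx.
  have Fu : (1%:M - e *m c) \in unitmx.
    have [] // := @mulmx1_unit _ _ (1%:M - e *m c) (1%:M + e *m c) _.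
    by rewrite mulmxDr mulmx1 mulmxBl mul1mx ec2 subr0 subrK.
  apply: noA; exists (A *m (1%:M - e *m c)); first by rewrite unitmx_mul Au.
  move=> v Wv; apply: contrapT => nj.
  have we : v *m A *m e = ((v *m A) 0 b0)%:M.
    apply/rowP => k; rewrite !mxE ord1 eqxx mulr1n (bigD1 b0) //= big1 ?addr0.
      by rewrite !mxE eqxx mulr1.
    by move=> j /negPf jb; rewrite !mxE jb mulr0.
  have vj j : j \notin B -> (v *m A) 0 j = (v *m A) 0 b0 * (u (kk j) / u k0).
    move=> jB; have : (v *m (A *m (1%:M - e *m c))) 0 j = 0.
      by apply/eqP/negPn/negP => h; apply: nj; exists j.
    rewrite mulmxA mulmxBr mulmx1 mulmxA we mul_scalar_mx.
    move: (v *m A) => w; rewrite !mxE (negPf jB).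
    by move/eqP; rewrite subr_eq0 => /eqP.
  have vb0 : (v *m A) 0 b0 != 0.
    have [j jB' vjn0] := Aavoid v Wv; have [jb|jb] := eqVneq j b0; first by rewrite -jb.
    have /vj E : j \notin B by move: jB'; rewrite !inE jb.
    by apply: contraNneq vjn0 => vb0; rewrite E vb0 mul0r.
  (* Rescaled by [a], the vector found on [W] has exactly the coordinates [u] outside [B'], so [P]
     vanishes at [u]. *)
  pose a := u k0 / (v *m A) 0 b0.
  have a0 : a != 0 by rewrite mulf_neq0 ?invr_eq0.
  case/eqP: Pu; rewrite -(PE (a *: v)); last exact: cone_scalable.
  apply: meval_eq => k; rewrite ev_mxform -scalemxAl mxE.
  have [kb|kb] := eqVneq (iota k) b0.
    rewrite kb /a divfK //; congr u; move: kb; rewrite -k0b.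
    by move=> /enum_val_inj /cast_ord_inj.
  have kB : iota k \notin B by move: (iotaN k); rewrite !inE kb.
  rewrite (vj _ kB) /a.
  have -> : kk (iota k) = k by apply: (@cast_ord_inj _ _ (esym qB)); apply/enum_val_inj/(kkP _ (iotaN k)).
  by field; rewrite u0.
have [Z [Zi ZW Zf]] := exists_irreducible_free (fun k => dhomog_mxform A (iota k)) Wc free.
have := codim_ge_growth cod Zi ZW (growth_of_free_forms (fun k => dhomog_mxform A (iota k)) Zf).
rewrite leqNgt => /negP; apply; rewrite addnBAC //.
by rewrite ltn_subRL addnC ltn_add2l; apply: leq_trans B3; rewrite Bb.
Qed.

End CoordinateSubspaces.

(** * Contraction and elimination *)

Section Bounds.
Variables (R : realType) (n : nat).
Local Notation C := R[i].
Implicit Types (v w : 'rV[C]_n).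

Lemma cabs_dhomog_le (p : mpoly n C) d : p \is ishomog1 d mdeg ->
  exists2 c, 0 <= c & forall v r, (forall i, cabs (v 0 i) <= r) -> cabs (ev v p) <= c * r ^+ d.
Proof.
move=> hp; exists (\sum_(m <- msupp p) cabs (mcoeff m p)).
  by apply: sumr_ge0 => m _; exact: cabs_ge0.
move=> v r vr; rewrite mevalE; apply: le_trans (cabs_sum _ _ _) _.
rewrite mulr_suml big_seq [leRHS]big_seq; apply: ler_sum => m mp.
rewrite cabsM ler_wpM2l ?cabs_ge0 // cabs_prod -(dhomog_mdeg hp mp) mdegE -prodrXr.
apply: ler_prod => i _; rewrite cabsX exprn_ge0 ?cabs_ge0 //=.
by rewrite lerXn2r ?nnegrE ?cabs_ge0 // (le_trans (cabs_ge0 (v 0 i))).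
Qed.

(** On [X], [x_i ^+ D.+1] is a combination of the chosen coordinates with cofactors of degree [D].
    For a coordinate of largest modulus [r], the cofactors are at most a constant times [r ^+ D],
    and one factor [r] remains after division. *)
Lemma closed_cone_bounded (X : set 'rV[C]_n) q (iota : 'I_q -> 'I_n) :
  closed_cone X -> (forall v, X v -> exists k, v 0 (iota k) != 0) ->
  exists2 M, 0 < M & forall v i, X v ->
    cabs (v 0 i) <= M * \sum_k cabs (v 0 (iota k)).
Proof.
move=> Xc Xa; have [D DP] := dhomog_linear_span (@complex_uncountable R) Xc Xa.
have /choice[h hP] : forall i, exists h : 'I_q -> mpoly n C,
    (forall k, h k \is ishomog1 D mdeg) /\
    vanishes X (XU i ^+ D.+1 - \sum_k XU (iota k) * h k).
  move=> i; have [|h hh hE] := DP 0%N (XU i ^+ D.+1).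
    by have := dhomogMn D.+1 (dhomogXU C i); rewrite mul1n addn0.
  by exists h; rewrite addn0 in hh.
have /choice[c cP] : forall ik : 'I_n * 'I_q, exists c, 0 <= c /\
    forall v r, (forall i, cabs (v 0 i) <= r) -> cabs (ev v (h ik.1 ik.2)) <= c * r ^+ D.
  by move=> [j k]; have [c c0 cc] := cabs_dhomog_le ((hP j).1 k); exists c.
exists (1 + \sum_ik c ik).
  by rewrite ltr_pwDl // sumr_ge0 // => ik _; exact: (cP ik).1.
move=> v i Xv.
have [j0 _ jmax] := Order.TotalTheory.arg_maxP (fun j => cabs (v 0 j)) (isT : predT i).
set r := cabs (v 0 j0) in jmax.
have {}jmax j : cabs (v 0 j) <= r by exact: jmax.
have r0 : 0 < r.
  have [v0 _ _] := Xc; have /rV0Pn[j vj] := v0 _ Xv.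
  by apply: lt_le_trans (jmax j); rewrite cabs_gt0.
apply: le_trans (jmax i) _.
rewrite -(ler_pM2r (exprn_gt0 D r0)) -exprS.
have -> : r ^+ D.+1 = cabs (\sum_k v 0 (iota k) * ev v (h j0 k)).
  have /eqP := (hP j0).2 v Xv; rewrite mevalB subr_eq0 rmorphXn /= mevalXU meval_sum.
  by move=> /eqP E; rewrite /r -cabsX E; congr cabs; apply: eq_bigr => k _; rewrite mevalM mevalXU.
apply: le_trans (cabs_sum _ _ _) _.
rewrite mulrAC mulr_sumr; apply: ler_sum => k _; rewrite cabsM mulrC.
rewrite ler_wpM2r ?cabs_ge0 //; apply: le_trans ((cP (j0, k)).2 _ _ jmax) _.
rewrite ler_wpM2r ?exprn_ge0 ?(ltW r0) //.
rewrite (bigD1 (j0, k)) //= addrCA lerDl addr_ge0 //.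
by apply: sumr_ge0 => ik _; exact: (cP ik).1.
Qed.

Lemma closed_cone_preimage (X : set 'rV[C]_n) (A : 'M[C]_n) : A \in unitmx ->
  closed_cone X -> closed_cone [set v | X (v *m A)].
Proof.
move=> Au [X0 Xs [S SX]]; split=> [v /X0|a v a0 Xv|].
- by apply: contraNneq => ->; rewrite mul0mx.
- by rewrite /= -scalemxAl; exact: Xs.
pose comp (p : mpoly n C) := comp_mpoly [tuple \sum_i A i j *: XU i | j < n] p.
have compE v p : ev v (comp p) = ev (v *m A) p.
  rewrite comp_mpoly_meval; apply: meval_eq => j.
  rewrite tnth_mktuple meval_sum mxE; apply: eq_bigr => i _.
  by rewrite mevalZ mevalXU mulrC.
exists [set comp p | p in S] => v v0.
have vA0 : v *m A != 0.
  by apply: contraNneq v0 => vA; rewrite -(mulmxK Au v) vA mul0mx.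
split=> [/(SX _ vA0) h _ [p Sp <-]|h]; first by rewrite compE; exact: h.
by apply/(SX _ vA0) => p Sp; rewrite -compE; apply: h; exists p.
Qed.

End Bounds.

Section BlockPosition.
Variables (R : realType) (N : nat).
Local Notation C := R[i].

(* A linear change of coordinates taking a plane that [W] misses to the
   coordinates in [B], followed by a contraction of these coordinates. *)
Lemma contract_coordinates (W : set (PP R N)) d (t : PForm R N d) (B : {set 'I_N.+1})
    (e : R) : 0 < e ->
  PPclosed W -> codim_ge 2 W (hypersurface t) -> (#|B| <= 3)%N ->
  exists2 A : 'M[C]_N.+1, A \in unitmx &
    forall v j, cone W (v *m A) -> j \in B ->
      cabs (v 0 j) <= e * \sum_k cabs (v 0 k).
Proof.
move=> e0 Wc cod B3.
have [A Au Aa] := avoid_coordinate_subspace Wc cod B3.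
have Xc := @closed_cone_preimage R _ (cone W) (invmx A) (etrans (unitmx_inv A) Au)
  (PPclosed_closed_cone Wc).
have [|M M0 MP] := @closed_cone_bounded R _ _ _ (fun k : 'I_#|~: B| => enum_val k) Xc.
  move=> v /= Wv; have [j jB] := Aa _ Wv; rewrite mulmxKV // => vj.
  have jC : j \in ~: B by rewrite inE.
  by exists (enum_rank_in jC j); rewrite enum_rankK_in.
(* Stretching the coordinates in [B] by [s] turns the bound by [M] into a bound by [e]; the
   coordinates outside [B], which provide the bound, are unchanged. *)
pose s := M / e.
have s0 : 0 < s by rewrite divr_gt0.
pose D : 'M[C]_N.+1 := diag_mx (\row_j if j \in B then s%:C%C else 1).
have Du : D \in unitmx.
  rewrite unitmxE det_diag unitfE; apply/prodf_neq0 => j _; rewrite mxE.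
  by case: ifP; rewrite ?oner_eq0 // -cabs_eq0 cabs_real normr_eq0 gt_eqF.
exists (D *m invmx A); first by rewrite unitmx_mul Du unitmx_inv.
move=> v j Wv jB; have := MP (v *m D) j; rewrite /= -mulmxA => /(_ Wv).
have vD k : (v *m D) 0 k = v 0 k * (if k \in B then s%:C%C else 1).
  by rewrite mul_mx_diag !mxE.
rewrite vD jB cabsM cabs_real (gtr0_norm s0) /s mulrA ler_pdivrMr // mulrC -mulrA.
rewrite ler_pM2l // mulrC => h; apply: le_trans h _.
rewrite ler_pM2l //.
under eq_bigr => k _.
  have := enum_valP k; rewrite inE => /negPf kB; rewrite vD kB mulr1; over.
rewrite /= -(big_enum_val (A := [in ~: B]) (fun k => cabs (v 0 k))) /=.
rewrite [leRHS](bigID (mem (~: B))) /= lerDl; apply: sumr_ge0 => k _; exact: cabs_ge0.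
Qed.

End BlockPosition.

Section Elimination.
Variables (R : realType) (n : nat) (T I : Type) (coords : I -> T -> R[i]).
Local Notation C := R[i].
Local Notation pf := (polynomial_function coords).
Implicit Types (v : 'rV[C]_n).

Definition polynomial_family (G : T -> mpoly n C) :=
  forall m, pf (fun t => mcoeff m (G t)).

Lemma polynomial_family_const p : polynomial_family (fun=> p).
Proof. by move=> m; exact: polynomial_function_const. Qed.

Lemma polynomial_family_scalar (g : T -> C) : pf g ->
  polynomial_family (fun t => mpolyC n (g t)).
Proof.
move=> pg m; under eq_fun do rewrite mcoeffC.
by apply: polynomial_functionM => //; exact: polynomial_function_const.
Qed.

Lemma polynomial_familyD G G' : polynomial_family G -> polynomial_family G' ->
  polynomial_family (fun t => G t + G' t).
Proof.
by move=> pG pG' m; under eq_fun do rewrite mcoeffD; exact: polynomial_functionD.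
Qed.

Lemma polynomial_familyM G G' : polynomial_family G -> polynomial_family G' ->
  polynomial_family (fun t => G t * G' t).
Proof.
move=> pG pG' m; under eq_fun do rewrite mcoeffM.
by apply: polynomial_function_sum => k _; exact: polynomial_functionM.
Qed.

Lemma polynomial_family_sum (J : Type) (r : seq J) (G : J -> T -> mpoly n C) :
  (forall j, polynomial_family (G j)) ->
  polynomial_family (fun t => \sum_(j <- r) G j t).
Proof.
move=> pG; elim: r => [|j r IH].
  by under eq_fun do rewrite big_nil; exact: polynomial_family_const.
by under eq_fun do rewrite big_cons; exact: polynomial_familyD.
Qed.

Lemma polynomial_family_prod (J : Type) (r : seq J) (G : J -> T -> mpoly n C) :
  (forall j, polynomial_family (G j)) ->
  polynomial_family (fun t => \prod_(j <- r) G j t).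
Proof.
move=> pG; elim: r => [|j r IH].
  by under eq_fun do rewrite big_nil; exact: polynomial_family_const.
by under eq_fun do rewrite big_cons; exact: polynomial_familyM.
Qed.

Lemma polynomial_family_pihomog G e : polynomial_family G ->
  polynomial_family (fun t => pihomog mdeg e (G t)).
Proof.
move=> pG m; rewrite (_ : (fun t => _) =
  fun t => (if mdeg m == e then 1 else 0) * mcoeff m (G t)).
  by apply: polynomial_functionM => //; exact: polynomial_function_const.
apply/funext => t; have := pihomogP mdeg e (G t); set k := maxn (msize (G t)) e.+1.
have [Gk ek] : (msize (G t) <= k)%N /\ (e < k)%N by rewrite leq_maxl leq_maxr.
case: eqP => [me _|/eqP me hP]; last by rewrite mul0r (dhomog_nemf_coeff hP).
rewrite mul1r {2}(pihomog_partitionE Gk) (bigD1 (Ordinal ek)) //= mcoeffD.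
rewrite [X in _ = _ + X](_ : _ = 0) ?addr0 // raddf_sum /=.
apply: big1 => i; rewrite -val_eqE /= => ie.
apply: (dhomog_nemf_coeff (pihomogP mdeg i (G t))).
by apply: contraNneq ie => <-; apply/eqP; exact: me.
Qed.

(* [members] is a set of pairs (degree, family of forms of that degree). If the
   forms have no common zero at [t1] then they generate all the forms of some
   degree [K] there, which is the nonvanishing of a determinant. *)
Lemma empty_zeros_open (members : set (nat * (T -> mpoly n C))) (t1 : T) :
  (forall G, members G -> polynomial_family G.2 /\
     forall t, G.2 t \is ishomog1 G.1 mdeg) ->
  (forall v, v != 0 -> exists2 G, members G & ev v (G.2 t1) != 0) ->
  exists D, [/\ pf D, D t1 != 0 & forall t, D t != 0 ->
    forall v, v != 0 -> exists2 G, members G & ev v (G.2 t) != 0].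
Proof.
move=> mP empty1.
pose comb (r : seq (mpoly n C * (nat * (T -> mpoly n C)))) t :=
  \sum_(qG <- r) qG.1 * qG.2.2 t.
pose I1 := [set p | exists2 r, (forall qG, List.In qG r -> members qG.2) & p = comb r t1].
have I1id : is_ideal I1.
  split.
  - by exists [::] => //; rewrite /comb big_nil.
  - move=> _ _ [r rm ->] [s sm ->]; exists (r ++ s); last by rewrite /comb big_cat.
    by move=> qG /List.in_app_iff[/rm|/sm].
  - move=> p _ [r rm ->]; exists [seq (p * qG.1, qG.2) | qG <- r].
      by move=> qG /List.in_map_iff[qG' [<- /rm]].
    rewrite /comb big_map mulr_sumr; apply: eq_bigr => qG _ /=.
    by rewrite mulrA.
have /choice[k kP] : forall i, exists k, I1 (XU i ^+ k).
  move=> i; apply: contrapT => /forallNP nok.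
  have [w wI] := nullstellensatz (@complex_uncountable R) I1id nok.
  rewrite mevalXU => wi.
  have v0 : \row_j w j != 0 by apply/rV0Pn; exists i; rewrite mxE.
  have [G mG] := empty1 _ v0; rewrite (meval_eq (v2 := w)) => [|j]; last by rewrite mxE.
  rewrite wI ?eqxx //; exists [:: (1, G)]; first by move=> qG /= [<-|//].
  by rewrite /comb big_seq1 mul1r.
pose K := (\sum_i k i).+1.
have I1K m : mdeg m = K -> I1 (mpolyX C m).
  move=> mK; have [_ _ IM] := I1id.
  have [i ki] : exists i, (k i <= m i)%N.
    apply/not_existsP => h; suff : (K <= \sum_i k i)%N by rewrite ltnn.
    rewrite -mK mdegE; apply: leq_sum => i _; rewrite leqNgt; apply/negP => kmi.
    exact: (h i (ltnW kmi)).
  by rewrite mpolyXE_id (bigD1 i) //= -(subnK ki) exprD mulrAC; exact: IM.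
have /choice[r rP] : forall m : multinom n, exists r, mdeg m = K ->
    (forall qG, List.In qG r -> members qG.2) /\ mpolyX C m = comb r t1.
  move=> m; have [mK|nmK] := pselect (mdeg m = K); last by exists [::].
  by have [r ? ?] := I1K m mK; exists r.
(* The cofactors found at [t1] are kept for all [t], reduced to the component that gives total
   degree [K]; members of degree above [K] drop out. *)
pose hcomb m t := \sum_(qG <- r m)
  (if (qG.2.1 <= K)%N then pihomog mdeg (K - qG.2.1) qG.1 * qG.2.2 t else 0).
have hcomb_pihomog m t : mdeg m = K -> hcomb m t = pihomog mdeg K (comb (r m) t).
  move=> mK; rewrite /hcomb /comb raddf_sum /=.
  have := (rP m mK).1; elim: (r m) => [|qG s IH] sm; first by rewrite !big_nil.
  rewrite !big_cons; congr (_ + _); last by apply: IH => qG' h; apply: sm; right.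
  have [_ hG] := mP _ (sm qG (or_introl erefl)).
  case: leqP => eK.
    by rewrite -{2}(subnK eK) addnC [in RHS]mulrC pihomogMl // mulrC.
  rewrite (pihomog_partitionE (leqnn (msize qG.1))) mulr_suml raddf_sum /= big1 // => j _.
  apply: (@pihomog_ne0 _ _ _ (j + qG.2.1)%N); last exact/dhomogM/hG/pihomogP.
  by rewrite gtn_eqF // (leq_trans eK) // leq_addl.
pose L := monomials n K.
have LK (a : 'I_(size L)) : mdeg (nth mnm0 L a) = K.
  by apply/eqP; rewrite basis_cover mem_nth.
(* The combinations written in the basis of monomials of degree [K]. The matrix is the identity at
   [t1]; where it is invertible, a common zero of the members kills all monomials of degree [K], in
   particular the [K]-th powers of the variables. *)
pose A t : 'M[C]_(size L) := \matrix_(a, b) mcoeff (nth mnm0 L b) (hcomb (nth mnm0 L a) t).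
have hcomb_pf m m' : mdeg m = K -> pf (fun t => mcoeff m' (hcomb m t)).
  move=> mK; rewrite /hcomb; have := (rP m mK).1; elim: (r m) => [|qG q IH] qm.
    by under eq_fun do rewrite big_nil mcoeff0; exact: polynomial_function_const.
  under eq_fun do rewrite big_cons mcoeffD; apply: polynomial_functionD; last first.
    by apply: IH => qG' h; apply: qm; right.
  case: (boolP (qG.2.1 <= K)%N) => _; last by under eq_fun do rewrite mcoeff0; exact: polynomial_function_const.
  apply: polynomial_familyM; first exact: polynomial_family_const.
  exact: (mP _ (qm qG (or_introl erefl))).1.
exists (fun t => \det (A t)); split.
- apply: polynomial_function_sum => s _; apply: polynomial_functionM.
    exact: polynomial_function_const.
  apply: polynomial_function_prod => a _; under eq_fun do rewrite mxE.
  exact: hcomb_pf (LK a).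
- rewrite (_ : A t1 = 1%:M) ?det1 ?oner_eq0 //; apply/matrixP => a b; rewrite !mxE.
  rewrite hcomb_pihomog // -(rP _ (LK a)).2 (pihomog_dE (dhomog_monomial _ (LK a))) mcoeffX.
  by rewrite nth_uniq ?uniq_basis // (inj_eq val_inj).
move=> t Dt v v0; apply: contrapT => nG.
have evG G : members G -> ev v (G.2 t) = 0.
  by move=> mG; apply/eqP/negPn/negP => h; apply: nG; exists G.
pose u : 'cV[C]_(size L) := \col_a ev v (mpolyX C (nth mnm0 L a)).
have Au : A t *m u = 0.
  apply/colP => a; rewrite !mxE.
  have -> : \sum_b A t a b * u b 0 = ev v (hcomb (nth mnm0 L a) t).
    have hK : hcomb (nth mnm0 L a) t \is ishomog1 K mdeg.
      by rewrite hcomb_pihomog //; exact: pihomogP.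
    rewrite (_ : hcomb _ t = \sum_b A t a b *: mpolyX C (nth mnm0 L b)).
      by rewrite meval_sum; apply: eq_bigr => b _; rewrite mevalZ [u b 0]mxE.
    apply/mpolyP => m; rewrite [RHS]raddf_sum /=; have [mK|mK] := eqVneq (mdeg m) K.
      have mL : (index m L < size L)%N by rewrite index_mem -basis_cover mK.
      rewrite [RHS](bigD1 (Ordinal mL)) //= [X in _ = _ + X]big1 ?addr0 => [|b bm].
        by rewrite mcoeffZ mcoeffX nth_index ?eqxx ?mulr1 ?mxE ?nth_index // -basis_cover mK.
      rewrite mcoeffZ mcoeffX; case: eqP => [bE|_]; last by rewrite mulr0.
      case/eqP: bm; apply: val_inj => /=; rewrite -bE index_uniq ?uniq_basis //.
    rewrite (dhomog_nemf_coeff hK mK) [RHS]big1 // => b _.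
    rewrite mcoeffZ mcoeffX; case: eqP => [bE|_]; last by rewrite mulr0.
    by case/eqP: mK; rewrite -bE.
  rewrite /hcomb meval_sum; have := (rP _ (LK a)).1.
  elim: (r _) => [|qG q IH] qm; first by rewrite big_nil.
  rewrite big_cons IH ?addr0 => [|qG' h]; last by apply: qm; right.
  by case: ifP => _; rewrite ?meval0 // mevalM (evG qG.2) ?mulr0 //; apply: qm; left.
have u0 : u = 0.
  have Aunit : A t \in unitmx by rewrite unitmxE unitfE.
  by rewrite -(mulKmx Aunit u) Au mulmx0.
have /rV0Pn[i vi] := v0.
have mK : mdeg (mnm_muln (mnm1 i) K) = K by rewrite mdegMn mdeg1 mul1n.
have mL : (index (mnm_muln (mnm1 i) K) L < size L)%N by rewrite index_mem -basis_cover mK.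
have /colP/(_ (Ordinal mL)) := u0; rewrite !mxE /= nth_index -?basis_cover ?mK //.
rewrite -mpolyXn rmorphXn /= mevalXU => /eqP.
by rewrite expf_eq0 (negPf vi) andbF.
Qed.

End Elimination.

(** * Generic degeneracy *)

Section FormFamilies.
Variables (R : realType) (N : nat).
Local Notation C := R[i].
Local Notation PP := (Defs.PP R N).
Local Notation PForm := (Defs.PForm R N).
Local Notation form := (Defs.form R N).
Implicit Types (v : 'rV[C]_N.+1) (x : PP).

(** Equations in both groups of variables are read as polynomials in [x] whose coefficients depend
    polynomially on [F], then split into components homogeneous in [x], the input of
    [empty_zeros_open]. *)
Lemma closed_form_families d (Z : set (PP * PForm d)) : PPxPForm_closed Z ->
  exists GG : set (form d -> mpoly N.+1 C),
    (forall G, GG G -> polynomial_family (@form_coeff R N d) G) /\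
    forall v x F t, represents v x -> represents F t ->
      (Z (x, t) <-> forall G, GG G -> forall e, ev v (pihomog mdeg e (G F)) = 0).
Proof.
move=> [S [Sp SZ]].
have /choice[G GP] : forall g : 'rV[C]_N.+1 * form d -> C, exists G : form d -> mpoly N.+1 C,
    S g -> polynomial_family (@form_coeff R N d) G /\ forall v F, g (v, F) = ev v (G F).
  move=> g; have [Sg|nSg] := pselect (S g); last by exists (fun=> 0).
  have [m [s [p gE]]] := Sp g Sg.
  pose h k (F : form d) : mpoly N.+1 C :=
    match s k with inl j => XU j | inr mu => mpolyC N.+1 (form_coeff mu F) end.
  have ph k : polynomial_family (@form_coeff R N d) (h k).
    rewrite /h; case: (s k) => [j|mu]; first exact: polynomial_family_const.
    by apply: polynomial_family_scalar; exact: polynomial_function_coord.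
  exists (fun F => \sum_(m <- msupp p) mpolyC N.+1 (mcoeff m p) * \prod_k h k F ^+ m k).
  move=> _; split.
    apply: polynomial_family_sum => mu; apply: polynomial_familyM.
      exact: polynomial_family_const.
    apply: polynomial_family_prod => k; elim: (mu k) => [|e IH].
      by under eq_fun do rewrite expr0; exact: polynomial_family_const.
    by under eq_fun do rewrite exprS; exact: polynomial_familyM.
  move=> v F; rewrite gE mevalE meval_sum; apply: eq_bigr => mu _.
  rewrite mevalM mevalC rmorph_prod; congr (_ * _); apply: eq_bigr => k _ /=.
  rewrite rmorphXn /=; congr (_ ^+ _); rewrite /h.
  by case: (s k) => [j|mu']; rewrite ?mevalXU ?mevalC.
exists [set G g | g in S]; split=> [_ [g Sg <-]|v x F t vx Ft]; first exact: (GP g Sg).1.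
have ZE a : a != 0 -> Z (x, t) <-> forall g, S g -> ev (a *: v) (G g F) = 0.
  move=> a0; rewrite (SZ (a *: v, F) (x, t)); last by split=> //=; exact: representsZ.
  by split=> h g Sg; have := h g Sg; rewrite (GP g Sg).2.
split=> [Zxt _ [g Sg <-] e|h].
  have Xs : scalable_set [set w | exists2 a, a != 0 & w = a *: v].
    by move=> a w a0 [b b0 ->]; exists (a * b); rewrite ?mulf_neq0 // scalerA.
  apply: (vanishes_pihomog e Xs _ (v := v)); last by exists 1; rewrite ?oner_eq0 ?scale1r.
  by move=> w [a a0 ->]; exact: (ZE a a0).1.
apply/(ZE 1 (oner_neq0 _)) => g Sg; rewrite scale1r.
rewrite (pihomog_partitionE (leqnn (msize (G g F)))) meval_sum big1 // => e _.
by apply: h; exists g.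
Qed.

Lemma monomials_expansion d (p : mpoly N.+1 C) : p \is ishomog1 d mdeg ->
  p = \sum_(m <- monomials N.+1 d) mcoeff m p *: mpolyX C m.
Proof.
move=> hp; apply/mpolyP => m; rewrite [RHS]raddf_sum /=.
have [md|md] := eqVneq (mdeg m) d.
  rewrite (bigD1_seq m) ?uniq_basis //=; last by rewrite -basis_cover md.
  rewrite mcoeffZ mcoeffX eqxx mulr1 [X in _ = _ + X]big1 ?addr0 // => m' m'm.
  by rewrite mcoeffZ mcoeffX (negPf m'm) mulr0.
rewrite (dhomog_nemf_coeff hp md) [RHS]big1_seq // => m' /andP[_].
rewrite -basis_cover => /eqP m'd; rewrite mcoeffZ mcoeffX.
case: eqP => [m'm|_]; last by rewrite mulr0.
by move: md; rewrite -m'm m'd eqxx.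
Qed.

Lemma universal_hypersurface_closed d : PPxPForm_closed (@universal_hypersurface R N d).
Proof.
exists [set (fun vF : 'rV[C]_N.+1 * form d => form_eval vF.2 vF.1)]; split.
  move=> _ ->; rewrite (_ : (fun vF => _) = fun vF : 'rV[C]_N.+1 * form d =>
      \sum_(m <- monomials N.+1 d) form_coeff m vF.2 * \prod_j vF.1 0 j ^+ m j); last first.
    apply/funext => vF; rewrite /form_eval.
    rewrite {1}(monomials_expansion (dhomog_is_dhomog vF.2)) meval_sum.
    by apply: eq_bigr => m _; rewrite mevalZ mevalX.
  apply: polynomial_function_sum => m _.
  apply: polynomial_functionM.
    exact: (polynomial_function_coord _ (inr m)).
  apply: polynomial_function_prod => j _; apply: polynomial_functionX.
  exact: (polynomial_function_coord _ (inl j)).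
move=> [v F] [x t] /= [vx Ft]; split=> [h _ -> /=|h F' v' Ft' vx']; first exact: h.
have [a a0 ->] := represents_scale Ft Ft'; have [b b0 ->] := represents_scale vx vx'.
rewrite /form_eval (ev_dhomogZ _ _ (dhomog_is_dhomog _)).
have h0 : ev v (val F) = 0 := h _ erefl.
by rewrite (_ : \val (a *: F) = a *: \val F) // mevalZ h0 !mulr0.
Qed.

Lemma slice_closed d (Z : set (PP * PForm d)) (t : PForm d) : PPxPForm_closed Z ->
  PPclosed [set x | Z (x, t)].
Proof.
have [F Ft] := proj_represents t.
apply: (@zariski_closed_preimage _ _ _ _ _ _ _ _ _ _ _ (fun x => (x, t)) (fun v => (v, F))).
  by move=> v x vx.
case=> [j|m]; first exact: (polynomial_function_coord _ j).
exact: (polynomial_function_const _ (form_coeff m F)).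
Qed.

Lemma emptiness_open c (d : 'I_c -> nat) (Z : forall i, set (PP * PForm (d i)))
    (J : pred 'I_N.+1) (t1 : forall i, PForm (d i)) :
  let avoids (t : forall i, PForm (d i)) := forall x v, represents v x ->
    (forall j, J j -> v 0 j = 0) -> ~ forall i, Z i (x, t i) in
  (forall i, PPxPForm_closed (Z i)) -> avoids t1 ->
  exists O : set (forall i, PForm (d i)),
    [/\ PForms_open O, O t1 & forall t, O t -> avoids t].
Proof.
move=> avoids Zc av1.
pose T := forall i, form (d i).
pose coords (k : 'I_c * multinom N.+1) (F : T) := form_coeff k.2 (F k.1).
pose GG i := sval (cid (closed_form_families (Zc i))).
have GGP i := svalP (cid (closed_form_families (Zc i))).
rewrite -/(GG _) in GGP.
pose members : set (nat * (T -> mpoly N.+1 C)) :=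
  [set eG | (exists2 j, J j & eG = (1%N, fun=> XU j)) \/
     exists i G e, GG i G /\ eG = (e, fun F => pihomog mdeg e (G (F i)))].
have mP eG : members eG -> polynomial_family coords eG.2 /\
    forall F, eG.2 F \is ishomog1 eG.1 mdeg.
  case=> [[j _ ->]|[i [G [e [GiG ->]]]]] /=; split.
  - exact: polynomial_family_const.
  - by move=> _; exact: dhomogXU.
  - apply: polynomial_family_pihomog => m.
    apply: (polynomial_function_comp (psi := fun F : T => F i)
      (coords' := @form_coeff R N (d i)) _ ((GGP i).1 G GiG m)) => mu.
    exact: (polynomial_function_coord coords (i, mu)).
  - by move=> F; exact: pihomogP.
have avE (t : forall i, PForm (d i)) (F : T) : (forall i, represents (F i) (t i)) ->
    avoids t <-> forall v, v != 0 -> exists2 eG, members eG & ev v (eG.2 F) != 0.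
  move=> Ft; split=> [av v v0|h x v vx vJ Zxt].
    apply: contrapT => nm; have [x vx] := line_proj v0.
    have m0 eG : members eG -> ev v (eG.2 F) = 0.
      by move=> meG; apply/eqP/negPn/negP => h; apply: nm; exists eG.
    apply: (av x v vx) => [j Jj|i].
      by have := m0 (1%N, fun=> XU j); rewrite /= mevalXU; apply; left; exists j.
    apply/((GGP i).2 _ _ _ _ vx (Ft i)) => G GiG e.
    by apply: (m0 (e, fun F => pihomog mdeg e (G (F i)))); right; exists i, G, e.
  have [eG meG /eqP] := h v vx.1; apply.
  case: meG => [[j Jj ->]|[i [G [e [GiG ->]]]]] /=; first by rewrite mevalXU vJ.
  exact: ((GGP i).2 _ _ _ _ vx (Ft i)).1.
pose F1 i := sval (cid (proj_represents (t1 i))).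
have F1P i : represents (F1 i) (t1 i) := svalP (cid (proj_represents (t1 i))).
have [D [Dpf D1 DP]] := empty_zeros_open mP ((avE t1 F1 F1P).1 av1).
(* The determinant need not be multihomogeneous in the forms. So [O] asks it to be nonzero for some
   representatives, and the complement is cut out by all the functions [D \o scale l]. *)
exists [set t | exists2 F, (forall i, represents (F i) (t i)) & D F != 0]; split.
- pose scale (l : 'I_c -> C) (F : T) : T := fun i => l i *: F i.
  exists [set D \o scale l | l in [set l | forall i, l i != 0]]; split.
    move=> _ [l _ <-]; apply: polynomial_function_comp Dpf => -[i m].
    rewrite (_ : _ \o _ = fun F => l i * coords (i, m) F).
      apply: polynomial_functionM; first exact: polynomial_function_const.
      exact: polynomial_function_coord.
    by apply/funext => F; exact: (mcoeffZ (l i) (val (F i)) m).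
  move=> F t Ft; split=> [nO _ [l l0 <-] /=|h [F' F't /eqP DF']].
    apply: contrapT => /eqP Dl; apply: nO; exists (scale l F) => // i.
    exact: representsZ.
  have /choice[l lP] : forall i, exists l, l != 0 /\ F' i = l *: F i.
    by move=> i; have [l ? ?] := represents_scale (Ft i) (F't i); exists l.
  apply: DF'; rewrite (_ : F' = scale l F).
    by apply: (h (D \o scale l)); exists l => // i; exact: (lP i).1.
  by apply: functional_extensionality_dep => i; exact: (lP i).2.
- by exists F1.
- by move=> t [F Ft DF]; apply/(avE t F Ft); exact: DP.
Qed.

End FormFamilies.

(** * Linear changes of coordinates on forms, points and curves *)

Section LinearChange.
Variables (R : realType) (N : nat).
Local Notation C := R[i].
Local Notation PP := (Defs.PP R N).
Local Notation PForm := (Defs.PForm R N).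
Local Notation form := (Defs.form R N).
Implicit Types (v : 'rV[C]_N.+1) (x : PP) (A : 'M[C]_N.+1).

Definition subst_linear A (p : mpoly N.+1 C) : mpoly N.+1 C :=
  comp_mpoly [tuple mxform A j | j < N.+1] p.

Lemma ev_subst_linear A p v : ev v (subst_linear A p) = ev (v *m A) p.
Proof.
rewrite comp_mpoly_meval; apply: meval_eq => j.
by rewrite tnth_mktuple ev_mxform.
Qed.

Lemma dhomog_subst_linear A p d : p \is ishomog1 d mdeg ->
  subst_linear A p \is ishomog1 d mdeg.
Proof.
move=> hp; rewrite /subst_linear comp_mpolyE big_seq.
apply: rpred_sum => m mp; apply: rpredZ; rewrite -(dhomog_mdeg hp mp) mdegE.
elim/big_rec2: _ => [|j e p' _ hp']; first exact: dhomog1.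
apply: dhomogM => //; rewrite tnth_mktuple.
by have := dhomogMn (m j) (dhomog_mxform A j); rewrite mul1n.
Qed.

Definition form_subst d A (F : form d) : form d :=
  DHomog (dhomog_subst_linear A (dhomog_is_dhomog F)).

Lemma form_eval_subst d A (F : form d) v :
  form_eval (form_subst A F) v = form_eval F (v *m A).
Proof. exact: ev_subst_linear. Qed.

Lemma form_eval_inj d (F G : form d) : (forall v, form_eval F v = form_eval G v) -> F = G.
Proof.
move=> FG; apply: val_inj; apply/eqP; rewrite -subr_eq0; apply/eqP.
apply: (mpoly_vanishing_eq0 (@complex_uncountable R)) => w.
have E p : meval w p = ev (\row_j w j) p by apply: meval_eq => j; rewrite mxE.
by rewrite mevalB !E; apply/eqP; rewrite subr_eq0; apply/eqP/FG.
Qed.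

Lemma form_subst_comp d A B (F : form d) :
  form_subst A (form_subst B F) = form_subst (A *m B) F.
Proof. by apply: form_eval_inj => v; rewrite !form_eval_subst mulmxA. Qed.

Lemma form_subst1 d (F : form d) : form_subst 1%:M F = F.
Proof. by apply: form_eval_inj => v; rewrite form_eval_subst mulmx1. Qed.

Lemma form_substZ d A a (F : form d) : form_subst A (a *: F) = a *: form_subst A F.
Proof. by apply: val_inj; exact: comp_mpolyZ. Qed.

Lemma form_subst_neq0 d A (F : form d) : A \in unitmx -> F != 0 -> form_subst A F != 0.
Proof.
move=> Au; apply: contraNneq => F0.
rewrite -(form_subst1 F) -(mulVmx Au) -form_subst_comp F0.
by apply/eqP/val_inj; exact: comp_mpoly0.
Qed.

Lemma form_coeff_subst d A (m : multinom N.+1) :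
  polynomial_function (@form_coeff R N d) (fun F => form_coeff m (form_subst A F)).
Proof.
rewrite (_ : (fun F => _) = fun F : form d => \sum_(m' <- monomials N.+1 d)
    form_coeff m' F * mcoeff m (subst_linear A (mpolyX C m'))).
  apply: polynomial_function_sum => m' _; apply: polynomial_functionM.
    exact: polynomial_function_coord.
  exact: polynomial_function_const.
apply/funext => F; rewrite /form_coeff /= /subst_linear.
rewrite {1}(monomials_expansion (dhomog_is_dhomog F)).
rewrite (big_morph _ (comp_mpolyD _) (comp_mpoly0 _)) [LHS]raddf_sum /=.
by apply: eq_bigr => m' _; rewrite comp_mpolyZ mcoeffZ.
Qed.

Lemma PForm_subst d A : A \in unitmx -> exists tau : PForm d -> PForm d,
  forall F t, represents F t -> represents (form_subst A F) (tau t).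
Proof.
move=> Au; apply: proj_map; first exact: form_substZ.
by move=> F; exact: form_subst_neq0.
Qed.

Lemma PP_mulmx A : A \in unitmx -> exists phi : PP -> PP,
  forall v x, represents v x -> represents (v *m A) (phi x).
Proof.
move=> Au; apply: proj_map => [a v|v v0]; first by rewrite scalemxAl.
by apply: contraNneq v0 => vA; rewrite -(mulmxK Au v) vA mul0mx.
Qed.

Lemma entire_curve_map (phi : PP -> PP) A (X Y : set PP) f : A \in unitmx ->
  (forall v x, represents v x -> represents (v *m A) (phi x)) ->
  (forall x, X x -> Y (phi x)) ->
  entire_curve X f -> nonconstant f -> entire_curve Y (phi \o f) /\ nonconstant (phi \o f).
Proof.
move=> Au phiP XY [fhol fX] [z [w fzw]]; split; last first.
  exists z, w => /= e; apply: fzw.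
  have [v vz] := proj_represents (f z); have [u uw] := proj_represents (f w).
  have := phiP _ _ uw; rewrite -e => h.
  have [a a0 /(canRL (mulmxK Au))] := represents_scale (phiP _ _ vz) h.
  rewrite -scalemxAl mulmxK // => uE.
  by apply: (@represents_inj _ _ u) => //; rewrite uE; exact: representsZ.
split=> [z0 _|z']; last exact: XY.
have [F Fn] := fhol z0 Logic.I.
exists (fun j z => \sum_k F k z * A k j); apply: filterS Fn => z' [Fd Fz]; split.
  move=> j; rewrite (_ : (fun z => _) = \sum_k (fun z => F k z * A k j)).
    apply: derivable_sum => k.
    rewrite (_ : (fun z => _) = F k * cst (A k j)) //.
    by apply: derivableM => //; exact: derivable_cst.
  by apply/funext => y; rewrite fct_sumE.
rewrite (_ : \row_j _ = (\row_k F k z') *m A); first exact: phiP.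
by apply/rowP => j; rewrite !mxE; apply: eq_bigr => k _; rewrite mxE.
Qed.

End LinearChange.

Section GenericPosition.
Variables (R : realType) (N delta : nat).
Hypothesis hdelta : degeneracy_bound R N delta.
Local Notation C := R[i].
Local Notation PP := (Defs.PP R N).
Local Notation PForm := (Defs.PForm R N).

(** The contraction is chosen for the degeneracy set of a single [t0], but the linear change is
    applied to the whole family, so that the statement on curves persists over an open set
    containing the transform [t1] of [t0]. *)
Lemma contracted_degeneracy d (B : {set 'I_N.+1}) (e : R) : (delta <= d)%N ->
  (#|B| <= 3)%N -> 0 < e ->
  exists (U : set (PForm d)) (Z : set (PP * PForm d)) (t1 : PForm d),
    [/\ PFormopen U, U t1, PPxPForm_closed Z,
        forall x v j, represents v x -> Z (x, t1) -> j \in B ->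
          cabs (v 0 j) <= e * \sum_k cabs (v 0 k) &
        forall t f, U t -> entire_curve (hypersurface t) f -> nonconstant f ->
          forall z, Z (f z, t)].
Proof.
move=> hd B3 e0; have [U [Y [Uo [t0 Ut0] [Z [Zc YE]] UY]]] := hdelta hd.
(* [Y] is closed only over [U]; [Zh] is closed in the whole product and agrees with [Y] over [U]. *)
pose Zh := Z `&` @universal_hypersurface R N d.
have Zhc : PPxPForm_closed Zh.
  by apply: zariski_closedI => //; exact: universal_hypersurface_closed.
have ZhY x t : U t -> Zh (x, t) <-> Y (x, t).
  by move=> Ut; rewrite YE; split=> [[]|[? []]].
have [cod _] := UY t0 Ut0.
have WE : [set x | Y (x, t0)] = [set x | Zh (x, t0)].
  by apply/seteqP; split=> x /(ZhY x t0 Ut0).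
have Wc : PPclosed [set x | Y (x, t0)] by rewrite WE; exact: slice_closed.
have [A Au Ab] := contract_coordinates e0 Wc cod B3.
have Aiu : invmx A \in unitmx by rewrite unitmx_inv.
have [phi phiP] := PP_mulmx Au.
have [tau tauP] := PForm_subst d Aiu.
have [tau' tau'P] := PForm_subst d Au.
have tauK t : tau (tau' t) = t.
  have [F Ft] := proj_represents t.
  apply: (@represents_inj _ _ F) => //.
  have := tauP _ _ (tau'P _ _ Ft).
  by rewrite form_subst_comp mulVmx // form_subst1.
have hyp t x : hypersurface t x -> hypersurface (tau t) (phi x).
  move=> tx F' v' F't v'x; have [F Ft] := proj_represents t.
  have [v vx] := proj_represents x.
  have [a a0 ->] := represents_scale (tauP _ _ Ft) F't.
  have [b b0 ->] := represents_scale (phiP _ _ vx) v'x.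
  rewrite -form_substZ scalemxAl form_eval_subst mulmxK //.
  exact: (tx (a *: F) (b *: v) (representsZ a0 Ft) (representsZ b0 vx)).
exists (tau @^-1` U), [set xt | Zh (phi xt.1, tau xt.2)], (tau' t0); split.
- rewrite /PFormopen /zariski_open preimage_setC.
  by apply: zariski_closed_preimage Uo; [exact: tauP|move=> m; exact: form_coeff_subst].
- by rewrite /= tauK.
- apply: (@zariski_closed_preimage _ _ _ _ _ _ _ _ _ _ _
    (fun xt => (phi xt.1, tau xt.2))
    (fun vF => (vF.1 *m A, form_subst (invmx A) vF.2))) Zhc.
    by move=> [v F] [x t] /= [vx Ft]; split; [exact: phiP|exact: tauP].
  case=> [j|m].
    rewrite (_ : _ \o _ = fun vF : 'rV[C]_N.+1 * Defs.form R N d => \sum_k vF.1 0 k * A k j).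
      apply: polynomial_function_sum => k _; apply: polynomial_functionM.
        exact: (polynomial_function_coord _ (inl k)).
      exact: polynomial_function_const.
    by apply/funext => vF /=; rewrite mxE.
  rewrite (_ : _ \o _ =
    (fun F => form_coeff m (form_subst (invmx A) F)) \o snd) //.
  apply: (polynomial_function_comp _ (@form_coeff_subst R N d (invmx A) m)).
  by move=> m'; exact: (polynomial_function_coord _ (inr m')).
- move=> x v j vx; rewrite /= tauK => /(ZhY _ _ Ut0) Yx jB.
  by apply: Ab => //; exists (phi x) => //; exact: phiP.
- move=> t f Ut fe fn z; apply/(ZhY _ _ Ut) => /=.
  have [fe' fn'] := entire_curve_map Au phiP (hyp t) fe fn.
  apply: ((UY (tau t) Ut).2 _) => B' [_ B'f]; apply: B'f.
  by exists (phi \o f) => //; exists z.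
Qed.

(* The coordinates [x_j] are cut into the blocks [j / 3 = i], one for each of
   the [c] degeneracy sets: for a suitable choice of the equations the [i]-th
   set lies so close to the subspace where the [i]-th block vanishes that their
   intersection misses the subspace [x_j = 0 (3 c <= j)]. *)
Lemma generic_degeneracy c (d : 'I_c -> nat) : (forall i, (delta <= d i)%N) ->
  exists U : set (forall i : 'I_c, PForm (d i)),
    [/\ PForms_open U, U !=set0 &
      forall t, U t -> exists Y : set PP,
        [/\ PPclosed Y,
            forall v, cone Y v -> exists2 j : 'I_N.+1, (3 * c <= j)%N & v 0 j != 0 &
            forall f, entire_curve (intersection t) f -> nonconstant f ->
              forall z, Y (f z)]].
Proof.
move=> hd; pose B (i : 'I_c) : {set 'I_N.+1} := [set j : 'I_N.+1 | (j %/ 3)%N == i]%SET.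
have B3 i : (#|B i| <= 3)%N.
  rewrite -[leqRHS](card_ord 3).
  apply: (@leq_card_in _ _ (fun j : 'I_N.+1 => inord (j %% 3) : 'I_3)).
  move=> j k; rewrite !inE => /eqP ji /eqP ki /(congr1 val).
  rewrite /= !inordK ?ltn_pmod // => jk; apply: val_inj => /=.
  by rewrite (divn_eq j 3) (divn_eq k 3) ji ki jk.
(* Bounding each of the [N.+1] coordinates by [e * s], where [s] is the sum of their moduli, gives
   [s <= s / 2]. *)
pose e : R := (2 * N.+1%:R)^-1.
have e0 : 0 < e by rewrite invr_gt0 mulr_gt0.
pose data i := contracted_degeneracy (hd i) (B3 i) e0.
pose U i := sval (cid (data i)).
pose data2 i := cid (svalP (cid (data i))).
pose Z i := sval (data2 i).
pose t1 i := sval (cid (svalP (data2 i))).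
have UZ i := svalP (cid (svalP (data2 i))).
rewrite -/(U _) -/(Z _) -/(t1 _) in UZ.
have [|x v vx vJ Zx|O [Oo Ot1 Oav]] := @emptiness_open R N c d Z
    (fun j => (3 * c <= j)%N) t1.
- by move=> i; case: (UZ i).
- have /rV0Pn[k vk] := vx.1.
  pose s := \sum_k cabs (v 0 k).
  have s0 : 0 < s.
    rewrite /s (bigD1 k) //= ltr_pwDl ?cabs_gt0 //.
    by apply: sumr_ge0 => l _; exact: cabs_ge0.
  have vs l : cabs (v 0 l) <= e * s.
    have [lc|lc] := leqP (3 * c) l; first by rewrite vJ // cabs0 mulr_ge0 ?ltW.
    have lc' : (l %/ 3 < c)%N by rewrite ltn_divLR // mulnC.
    have [_ _ _ + _] := UZ (Ordinal lc'); apply; first exact: vx.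
      exact: Zx.
    by rewrite inE.
  have : s <= \sum_(l < N.+1) e * s by apply: ler_sum => l _; exact: vs.
  rewrite sumr_const card_ord -mulr_natl mulrA /e invfM mulrCA divff ?mulr1 ?pnatr_eq0 //.
  by lra.
exists (O `&` \bigcap_i [set t | U i (t i)]); split.
- apply: zariski_openI => //; apply: zariski_open_bigcap_ord => i.
  have [Uo _ _ _ _] := UZ i.
  rewrite /zariski_open (preimage_setC (fun t : forall i, PForm (d i) => t i)).
  apply: (@zariski_closed_preimage _ _ _ _ _ _ _ _ _ _ _ _ (fun F => F i)) Uo.
    by move=> F t; exact.
  by move=> m; exact: (polynomial_function_coord _ (i, m)).
- by exists t1; split=> // i _; case: (UZ i).
move=> t [Ot Ut]; exists (\bigcap_i [set x | Z i (x, t i)]); split.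
- apply: zariski_closed_bigcap => i _; apply: slice_closed.
  by case: (UZ i).
- move=> v [x Zx vx]; apply: contrapT => nj; apply: (Oav t Ot x v vx).
    move=> j jc; apply/eqP/negPn/negP => vj; apply: nj.
    by exists j.
  by move=> i; exact: Zx.
- move=> f [fh fX] fn z i _; have [_ _ _ _ h] := UZ i.
  apply: h => //; first exact: Ut.
  by split=> // w; exact: fX.
Qed.

End GenericPosition.

(** * Complex differentiability and ultralimits *)

Section ComplexDifferentiability.
Variable R : realType.
Local Notation C := R[i].
Implicit Types (f g : C -> C) (z w D : C).

(** A form with real moduli, suited to explicit estimates; [derivable_complex_differentiable] ties
    it to the derivability in [holomorphic_on]. *)
Definition complex_derivative f z D := forall e : R, 0 < e ->
  exists2 d, 0 < d & forall w, cabs (w - z) < d ->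
    cabs (f w - f z - D * (w - z)) <= e * cabs (w - z).

Definition complex_differentiable f z := exists D, complex_derivative f z D.

Lemma nbhs_cabs (P : C -> Prop) z : nbhs (z : C^o) P <->
  exists2 d : R, 0 < d & forall w, cabs (w - z) < d -> P w.
Proof.
split=> [/nbhs_ballP[e /= e0 eP]|[d d0 dP]].
  have eE : e = (complex.Re e)%:C%C by rewrite RRe_real // gtr0_real.
  exists (complex.Re e); first by rewrite -ltcR -eE.
  by move=> w wz; apply: eP; rewrite /ball /= distrC cabsE eE ltcR.
apply/nbhs_ballP; exists d%:C%C; first by rewrite /= ltcR.
by move=> w; rewrite /ball /= distrC cabsE ltcR; exact: dP.
Qed.

Lemma derivable_complex_differentiable f z :
  derivable (f : C^o -> C^o) z 1 <-> complex_differentiable f z.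
Proof.
split=> [/cvg_ex[/= D]|[D fD]].
  move=> /cvgrPdist_le h; exists D => e e0.
  have /h : 0 < e%:C%C by rewrite ltcR.
  rewrite near_withinE => /nbhs_cabs[d d0 dP]; exists d => // w wz.
  have [->|wz0] := eqVneq w z; first by rewrite !subrr mulr0 subr0 cabs0 mulr0.
  have wz0' : w - z != 0 by rewrite subr_eq0.
  have := dP (w - z); rewrite subr0 => /(_ wz wz0').
  rewrite /= [(w - z) *: 1]mulr1 subrK cabsE lecR => {}dP.
  have -> : f w - f z - D * (w - z) = - ((w - z) * (D - (w - z)^-1 * (f w - f z))).
    by field; rewrite subr_eq0.
  by rewrite cabsN cabsM mulrC ler_wpM2r // cabs_ge0.
apply/cvg_ex; exists D; apply/cvgrPdist_le => e e0.
have eE : e = (complex.Re e)%:C%C by rewrite RRe_real // gtr0_real.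
have e0' : 0 < complex.Re e by rewrite -ltcR -eE.
have [d d0 dP] := fD _ e0'; rewrite near_withinE; apply/nbhs_cabs; exists d => // h.
rewrite subr0 => hd h0; rewrite /= [h *: 1]mulr1 cabsE eE lecR.
have := dP (h + z); rewrite addrK => /(_ hd).
have -> : D - h^-1 *: (f (h + z) - f z) = - (h^-1 * (f (h + z) - f z - D * h)).
  by rewrite /GRing.scale /=; field.
by rewrite cabsN cabsM cabsV [_^-1 * _]mulrC ler_pdivrMr ?cabs_gt0.
Qed.

Lemma complex_derivative_bounded f z D : complex_derivative f z D ->
  exists2 d, 0 < d & forall w, cabs (w - z) < d ->
    cabs (f w - f z) <= (1 + cabs D) * cabs (w - z).
Proof.
move=> fD; have [d d0 dP] := fD 1 ltr01; exists d => // w wz.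
have -> : f w - f z = (f w - f z - D * (w - z)) + D * (w - z) by rewrite subrK.
apply: le_trans (cabsD _ _) _; rewrite mulrDl cabsM lerD2r mul1r.
by rewrite -[leRHS]mul1r; exact: dP.
Qed.

Lemma complex_differentiableD f g z : complex_differentiable f z ->
  complex_differentiable g z -> complex_differentiable (fun w => f w + g w) z.
Proof.
by rewrite -!derivable_complex_differentiable => ? ?; exact: derivableD.
Qed.

Lemma complex_differentiableN f z : complex_differentiable f z ->
  complex_differentiable (fun w => - f w) z.
Proof.
by rewrite -!derivable_complex_differentiable => ?; exact: derivableN.
Qed.

Lemma complex_differentiableM f g z : complex_differentiable f z ->
  complex_differentiable g z -> complex_differentiable (fun w => f w * g w) z.
Proof.
rewrite -!derivable_complex_differentiable => df dg.
exact: (@derivableM C C^o f g z 1 df dg).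
Qed.

Lemma complex_differentiableV f z : f z != 0 -> complex_differentiable f z ->
  complex_differentiable (fun w => (f w)^-1) z.
Proof.
rewrite -!derivable_complex_differentiable => fz df.
exact: (@derivableV C C^o f z 1 fz df).
Qed.

Lemma complex_differentiable_const a z : complex_differentiable (fun=> a) z.
Proof. by apply/derivable_complex_differentiable; exact: derivable_cst. Qed.

Lemma complex_differentiable_id z : complex_differentiable id z.
Proof. by apply/derivable_complex_differentiable; exact: derivable_id. Qed.

Lemma complex_differentiable_comp f g z : complex_differentiable f z ->
  complex_differentiable g (f z) -> complex_differentiable (g \o f) z.
Proof.
move=> [D fD] [E gE]; exists (E * D) => e e0.
have [d1 d10 d1P] := complex_derivative_bounded fD.
pose B := 1 + cabs D.
have B0 : 0 < B by rewrite ltr_pwDl // cabs_ge0.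
have e1 : 0 < e / (2 * B) by rewrite divr_gt0 // mulr_gt0.
have e2 : 0 < e / (2 * (1 + cabs E)).
  by rewrite divr_gt0 // mulr_gt0 // ltr_pwDl // cabs_ge0.
have [d2 d20 d2P] := gE _ e1; have [d3 d30 d3P] := fD _ e2.
exists (Num.min d1 (Num.min (d2 / B) d3)) => [|w].
  by rewrite !lt_min d10 d30 divr_gt0.
rewrite !lt_min => /and3P[w1 w2 w3] /=.
have fw := d1P _ w1.
have fw2 : cabs (f w - f z) < d2.
  by apply: le_lt_trans fw _; rewrite mulrC -ltr_pdivlMr.
have -> : g (f w) - g (f z) - E * D * (w - z) =
  (g (f w) - g (f z) - E * (f w - f z)) + E * (f w - f z - D * (w - z)) by ring.
apply: le_trans (cabsD _ _) _; rewrite (splitr e) mulrDl; apply: lerD.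
  apply: le_trans (d2P _ fw2) _; apply: le_trans (ler_wpM2l (ltW e1) fw) _.
  rewrite -/B le_eqVlt; apply/orP; left; apply/eqP; field.
  by rewrite gt_eqF.
rewrite cabsM; apply: le_trans (ler_wpM2l (cabs_ge0 _) (d3P _ w3)) _.
have E0 : 0 < 1 + cabs E by rewrite ltr_pwDl // cabs_ge0.
have -> : cabs E * (e / (2 * (1 + cabs E)) * cabs (w - z)) =
  e / 2 * cabs (w - z) * (cabs E / (1 + cabs E)) by field; rewrite gt_eqF.
rewrite ler_piMr ?mulr_ge0 ?cabs_ge0 ?invr_ge0 ?(ltW e0) //.
by rewrite ler_pdivrMr // mul1r lerDr.
Qed.

End ComplexDifferentiability.

(** * Limits along a free ultrafilter *)

Section Ultralimits.
Variable R : realType.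
Local Notation C := R[i].

Definition free_ultrafilter (U : set_system nat) :=
  [/\ ProperFilter U, forall A, U A \/ U (~` A) & forall n, U [set k | (n <= k)%N]].

Lemma exists_free_ultrafilter : exists U, free_ultrafilter U.
Proof.
have [U [UU sub]] := @ultraFilterLemma nat \oo _.
exists U; split; first exact: ultra_proper.
- by move=> A; exact: in_ultra_setVsetC.
- by move=> n; apply: sub; exists n.
Qed.

Variable U : set_system nat.
Hypothesis Ufree : free_ultrafilter U.
Let UF : ProperFilter U. Proof. by case: Ufree. Qed.
Local Existing Instance UF.

Definition ulim (u : nat -> C) (l : C) :=
  forall e : R, 0 < e -> U [set n | cabs (u n - l) < e].

Lemma ultra_exists (A : set nat) : U A -> exists n, A n.
Proof. exact: filter_ex. Qed.

(** The limit is the supremum of the numbers that are below [u n] for almost all [n]. *)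
Lemma real_ultralimit (u : nat -> R) M : U [set n | `|u n| <= M] ->
  exists l, forall e, 0 < e -> U [set n | `|u n - l| < e].
Proof.
move=> uM; pose S := [set x | U [set n | x <= u n]].
have SM : S (- M).
  by apply: filterS uM => n /=; rewrite ler_norml => /andP[].
have Sub : ubound S M.
  move=> x Sx; have [n [/= xu]] := ultra_exists (filterI Sx uM).
  by rewrite ler_norml => /andP[_]; exact: le_trans.
have Ssup : has_sup S by split; [exists (- M)|exists M].
exists (sup S) => e e0.
have [x Sx xe] : exists2 x, S x & sup S - e < x by exact: sup_adherent.
have nS : ~ S (sup S + e / 2).
  move=> /(ub_le_sup Ssup.2); apply/negP; rewrite -ltNge ltrDl divr_gt0 //.
have [_ Uult _] := Ufree.
have [//|nU] := Uult [set n | sup S + e / 2 <= u n].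
apply: filterS (filterI Sx nU) => n [/= xu /negP]; rewrite -ltNge => ue.
rewrite ltr_norml; apply/andP; split.
  by rewrite ltrBrDl; apply: lt_le_trans xu; rewrite addrC in xe *; move: xe; rewrite addrC.
by rewrite ltrBlDl; apply: lt_trans ue _; rewrite ltrD2l ltr_pdivrMr // ltr_pMr // ltr1n.
Qed.

Lemma cabs_i : cabs ('i%C : C) = 1.
Proof. by rewrite /cabs normc_def /= expr0n expr1n add0r sqrtr1. Qed.

Lemma Re_le_cabs (z : C) : `|complex.Re z| <= cabs z.
Proof. by rewrite -lecR -cabsE; exact: normc_ge_Re. Qed.

Lemma Im_le_cabs (z : C) : `|complex.Im z| <= cabs z.
Proof.
rewrite -normrN -ReiNIm; apply: le_trans (Re_le_cabs _) _.
by rewrite cabsM cabs_i mulr1.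
Qed.

Lemma cabs_le_ReIm (z : C) : cabs z <= `|complex.Re z| + `|complex.Im z|.
Proof.
rewrite {1}(complexE z); apply: le_trans (cabsD _ _) _.
by rewrite cabsM !cabs_real cabs_i mul1r.
Qed.

Lemma complex_ultralimit (u : nat -> C) M : U [set n | cabs (u n) <= M] ->
  exists l, ulim u l.
Proof.
move=> uM.
have [|x xP] := @real_ultralimit (fun n => complex.Re (u n)) M.
  by apply: filterS uM => n /=; exact: le_trans (Re_le_cabs _).
have [|y yP] := @real_ultralimit (fun n => complex.Im (u n)) M.
  by apply: filterS uM => n /=; exact: le_trans (Im_le_cabs _).
exists (x +i* y)%C => e e0; have e2 : 0 < e / 2 by rewrite divr_gt0.
apply: filterS (filterI (xP _ e2) (yP _ e2)) => n [/= ux uy].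
apply: le_lt_trans (cabs_le_ReIm _) _; rewrite (splitr e).
move: ux uy; case: (u n) => a b /= ux uy; exact: ltrD.
Qed.

Lemma ulim_unique u l l' : ulim u l -> ulim u l' -> l = l'.
Proof.
move=> ul ul'; apply/eqP; rewrite -subr_eq0 -cabs_eq0 eq_le cabs_ge0 andbT.
apply/ler_addgt0Pr => e e0; rewrite add0r; have e2 : 0 < e / 2 by rewrite divr_gt0.
have [n [/= h h']] := ultra_exists (filterI (ul _ e2) (ul' _ e2)).
have -> : l - l' = (u n - l') - (u n - l) by ring.
apply: le_trans (cabsD _ _) _; rewrite cabsN (splitr e).
by apply: lerD; exact: ltW.
Qed.

Lemma ulim_le u l M : ulim u l -> U [set n | cabs (u n) <= M] -> cabs l <= M.
Proof.
move=> ul uM; apply/ler_addgt0Pr => e e0.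
have [n [/= h h']] := ultra_exists (filterI (ul _ e0) uM).
have -> : l = u n - (u n - l) by ring.
by apply: le_trans (cabsD _ _) _; rewrite cabsN lerD // ltW.
Qed.

Lemma ulim_ge u l M : ulim u l -> U [set n | M <= cabs (u n)] -> M <= cabs l.
Proof.
move=> ul uM; apply/ler_addgt0Pr => e e0.
have [n [/= h h']] := ultra_exists (filterI (ul _ e0) uM).
apply: le_trans h' _; have -> : u n = l + (u n - l) by ring.
by apply: le_trans (cabsD _ _) _; rewrite lerD2l ltW.
Qed.

Lemma ulimD u v l m : ulim u l -> ulim v m -> ulim (fun n => u n + v n) (l + m).
Proof.
move=> ul vm e e0; have e2 : 0 < e / 2 by rewrite divr_gt0.
apply: filterS (filterI (ul _ e2) (vm _ e2)) => n [/= h h'].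
rewrite opprD addrACA; apply: le_lt_trans (cabsD _ _) _; rewrite (splitr e).
exact: ltrD.
Qed.

Lemma ulim_const a : ulim (fun=> a) a.
Proof. by move=> e e0; apply: filterE => n /=; rewrite subrr cabs0. Qed.

Lemma ulimM u v l m : ulim u l -> ulim v m -> ulim (fun n => u n * v n) (l * m).
Proof.
move=> ul vm e e0.
pose B := 1 + cabs l + cabs m.
have B0 : 0 < B by rewrite /B -addrA ltr_pwDl // addr_ge0 ?cabs_ge0.
have eB : 0 < Num.min 1 (e / (2 * B)) by rewrite lt_min ltr01 divr_gt0 // mulr_gt0.
apply: filterS (filterI (ul _ eB) (vm _ eB)) => n [/=].
rewrite !lt_min => /andP[h1 h2] /andP[h1' h2'].
have -> : u n * v n - l * m = (u n - l) * (v n - m) + (l * (v n - m) + m * (u n - l)) by ring.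
apply: le_lt_trans (cabsD _ _) _; rewrite cabsM.
have := cabsD (l * (v n - m)) (m * (u n - l)); rewrite !cabsM => h.
have l0 := cabs_ge0 l; have m0 := cabs_ge0 m.
have x0 := cabs_ge0 (u n - l); have y0 := cabs_ge0 (v n - m).
set x := cabs (u n - l) in h h1 h2 x0 *; set y := cabs (v n - m) in h h1' h2' y0 *.
set d := e / (2 * B) in h2 h2'.
have dB : d * B = e / 2 by rewrite /d; field; rewrite gt_eqF.
apply: le_lt_trans (lerD (ler_piMl y0 (ltW h1)) h) _.
apply: le_lt_trans (_ : d * B < e); last first.
  by rewrite dB ltr_pdivrMr // ltr_pMr // ltr1n.
have := ler_wpM2l l0 (ltW h2'); have := ler_wpM2l m0 (ltW h2).
rewrite /B; nra.
Qed.

Lemma ulimZ a u l : ulim u l -> ulim (fun n => a * u n) (a * l).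
Proof. by move=> ul; apply: ulimM => //; exact: ulim_const. Qed.

Lemma ulimB u v l m : ulim u l -> ulim v m -> ulim (fun n => u n - v n) (l - m).
Proof.
move=> ul /(ulimZ (-1)); rewrite mulN1r => vm.
by under [X in ulim X]eq_fun do rewrite -mulN1r; exact: ulimD.
Qed.

Lemma ulimV u l : l != 0 -> ulim u l -> ulim (fun n => (u n)^-1) l^-1.
Proof.
move=> l0 ul e e0; have cl : 0 < cabs l by rewrite cabs_gt0.
pose d := Num.min (cabs l / 2) (e * cabs l ^+ 2 / 2).
have d0 : 0 < d by rewrite lt_min !divr_gt0 // mulr_gt0 // exprn_gt0.
apply: filterS (ul _ d0) => n /=; rewrite lt_min => /andP[h1 h2].
have ln : cabs l / 2 < cabs (u n).
  have := cabsD (u n) (l - u n); rewrite addrC subrK -opprB cabsN => h.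
  by lra.
have un0 : u n != 0 by rewrite -cabs_gt0; apply: lt_trans ln; rewrite divr_gt0.
have -> : (u n)^-1 - l^-1 = - (u n - l) / (u n * l) by field; rewrite un0 l0.
rewrite cabsM cabsN cabsV cabsM ltr_pdivrMr; last by rewrite mulr_gt0 ?cabs_gt0.
apply: lt_le_trans h2 _; rewrite -mulrA ler_pM2l // expr2 mulrAC.
by rewrite ler_pM2r // ltW.
Qed.

Lemma ulim_sum (J : Type) (r : seq J) (u : J -> nat -> C) (l : J -> C) :
  (forall j, ulim (u j) (l j)) ->
  ulim (fun n => \sum_(j <- r) u j n) (\sum_(j <- r) l j).
Proof.
move=> ul; elim: r => [|j r IH].
  by under [X in ulim X]eq_fun do rewrite big_nil; rewrite big_nil; exact: ulim_const.
by under [X in ulim X]eq_fun do rewrite big_cons; rewrite big_cons; exact: ulimD.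
Qed.

Lemma ulim_prod (J : Type) (r : seq J) (u : J -> nat -> C) (l : J -> C) :
  (forall j, ulim (u j) (l j)) ->
  ulim (fun n => \prod_(j <- r) u j n) (\prod_(j <- r) l j).
Proof.
move=> ul; elim: r => [|j r IH].
  by under [X in ulim X]eq_fun do rewrite big_nil; rewrite big_nil; exact: ulim_const.
by under [X in ulim X]eq_fun do rewrite big_cons; rewrite big_cons; exact: ulimM.
Qed.

Lemma ulimX u l k : ulim u l -> ulim (fun n => u n ^+ k) (l ^+ k).
Proof.
move=> ul; elim: k => [|k IH].
  by under [X in ulim X]eq_fun do rewrite expr0; rewrite expr0; exact: ulim_const.
by under [X in ulim X]eq_fun do rewrite exprS; rewrite exprS; exact: ulimM.
Qed.

End Ultralimits.

(** * Goursat and Cauchy estimates *)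

Section TrapezoidSums.
Variable R : realType.
Local Notation C := R[i].
Implicit Types (f g : C -> C) (z w a b c D : C) (P : C -> Prop).

Definition midpoint a b : C := (a + b) / 2.

(* The trapezoid rule for the integral of [g dz] along the segment [a, b] cut
   into 2 ^ m equal pieces. *)
Fixpoint trapezoid g m a b : C :=
  if m is m'.+1 then trapezoid g m' a (midpoint a b) + trapezoid g m' (midpoint a b) b
  else (g a + g b) / 2 * (b - a).

Definition triangle_sum g m a b c :=
  trapezoid g m a b + trapezoid g m b c + trapezoid g m c a.

Lemma midpointC a b : midpoint a b = midpoint b a.
Proof. by rewrite /midpoint addrC. Qed.

Lemma trapezoidC g m a b : trapezoid g m b a = - trapezoid g m a b.
Proof.
elim: m a b => [|m IH] a b /=; first by ring.
by rewrite (midpointC b a) IH [trapezoid g m _ a]IH; ring.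
Qed.

Lemma trapezoid_lincomb f g k m a b :
  trapezoid (fun z => f z + k * g z) m a b = trapezoid f m a b + k * trapezoid g m a b.
Proof. by elim: m a b => [|m IH] a b /=; rewrite ?IH; ring. Qed.

(** The trapezoid rule is exact on affine functions, so their sums around a triangle vanish;
    [goursat] is thereby reduced to the remainder of the first-order expansion. *)
Lemma trapezoid_affine al be m a b :
  trapezoid (fun z => al + be * z) m a b = (al + be * midpoint a b) * (b - a).
Proof. by elim: m a b => [|m IH] a b /=; rewrite ?IH /midpoint; field. Qed.

(** Convexity as far as dyadic points are concerned, the only ones that enter the sums. *)
Definition midpoint_closed P := forall a b, P a -> P b -> P (midpoint a b).

Lemma cabs2 : cabs (2 : C) = 2.
Proof. by have := cabs_real (2 : R); rewrite rmorph_nat => ->; rewrite ger0_norm. Qed.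

Lemma cabs_half z : cabs (z / 2) = cabs z / 2.
Proof. by rewrite cabsM cabsV cabs2. Qed.

Lemma trapezoid_bound g P M m a b : midpoint_closed P -> P a -> P b ->
  (forall z, P z -> cabs (g z) <= M) ->
  cabs (trapezoid g m a b) <= M * cabs (b - a).
Proof.
move=> Pm Pa Pb gM; elim: m a b Pa Pb => [|m IH] a b Pa Pb /=.
  rewrite cabsM cabs_half ler_wpM2r ?cabs_ge0 //.
  have := cabsD (g a) (g b); have := gM _ Pa; have := gM _ Pb; lra.
apply: le_trans (cabsD _ _) _; have Pab := Pm _ _ Pa Pb.
apply: le_trans (lerD (IH _ _ Pa Pab) (IH _ _ Pab Pb)) _.
have -> : midpoint a b - a = (b - a) / 2 by rewrite /midpoint; field.
have -> : b - midpoint a b = (b - a) / 2 by rewrite /midpoint; field.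
by rewrite cabs_half; lra.
Qed.

(** An exact identity at each depth: halving an edge lowers the depth by one, and the inner edges
    cancel. *)
Lemma triangle_sum_subdivide g m a b c :
  let ab := midpoint a b in let bc := midpoint b c in let ca := midpoint c a in
  triangle_sum g m.+1 a b c = triangle_sum g m a ab ca + triangle_sum g m b bc ab +
    triangle_sum g m c ca bc + triangle_sum g m ab bc ca.
Proof.
move=> ab bc ca; rewrite /triangle_sum /= -/ab -/bc -/ca.
rewrite (trapezoidC g m ca ab) (trapezoidC g m ab bc) (trapezoidC g m bc ca).
ring.
Qed.

(** It bounds an integral through its approximations, without discussing their convergence. *)
Definition eventually_le (u : nat -> C) (x : R) :=
  exists m0, forall m, (m0 <= m)%N -> cabs (u m) <= x.

Lemma eventually_leD u v x y : eventually_le u x -> eventually_le v y ->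
  eventually_le (fun m => u m + v m) (x + y).
Proof.
move=> [m0 h] [m1 h']; exists (maxn m0 m1) => m; rewrite geq_max => /andP[/h ? /h' ?].
by apply: le_trans (cabsD _ _) _; exact: lerD.
Qed.

Lemma eventually_le_succ u x : eventually_le (fun m => u m.+1) x -> eventually_le u x.
Proof. by move=> [m0 h]; exists m0.+1 => -[//|m]; exact: h. Qed.

Lemma eventually_le_ext u v x : u =1 v -> eventually_le u x -> eventually_le v x.
Proof. by move=> uv [m0 h]; exists m0 => m; rewrite -uv; exact: h. Qed.

Definition perimeter (t : C * C * C) :=
  let: (a, b, c) := t in cabs (b - a) + cabs (c - b) + cabs (a - c).

Definition tsum g m (t : C * C * C) := let: (a, b, c) := t in triangle_sum g m a b c.

Definition vertices_in P (t : C * C * C) := let: (a, b, c) := t in [/\ P a, P b & P c].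

(** If all four half-size triangles had sums eventually below [e / 4], the whole would be below [e].
    The bound on the displacement of the first vertex makes the nested vertices converge in
    [goursat]. *)
Lemma subtriangle g P t e : midpoint_closed P -> vertices_in P t ->
  ~ eventually_le (tsum g ^~ t) e ->
  exists t', [/\ ~ eventually_le (tsum g ^~ t') (e / 4), vertices_in P t',
    perimeter t' = perimeter t / 2 & cabs (t'.1.1 - t.1.1) <= perimeter t].
Proof.
case: t => [[a b] c] Pm [Pa Pb Pc] nle.
pose ab := midpoint a b; pose bc := midpoint b c; pose ca := midpoint c a.
have E1 : ab - a = (b - a) / 2 by rewrite /ab /midpoint; field.
have E2 : b - ab = (b - a) / 2 by rewrite /ab /midpoint; field.
have E3 : bc - b = (c - b) / 2 by rewrite /bc /midpoint; field.
have E4 : c - bc = (c - b) / 2 by rewrite /bc /midpoint; field.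
have E5 : ca - c = (a - c) / 2 by rewrite /ca /midpoint; field.
have E6 : a - ca = (a - c) / 2 by rewrite /ca /midpoint; field.
have E7 : bc - ab = - ((a - c) / 2) by rewrite /ab /bc /midpoint; field.
have E8 : ca - bc = - ((b - a) / 2) by rewrite /ca /bc /midpoint; field.
have E9 : ab - ca = - ((c - b) / 2) by rewrite /ca /ab /midpoint; field.
have N8 : bc - ca = (b - a) / 2 by rewrite -opprB E8 opprK.
have N9 : ca - ab = (c - b) / 2 by rewrite -opprB E9 opprK.
have N7 : ab - bc = (a - c) / 2 by rewrite -opprB E7 opprK.
have c1 := cabs_ge0 (b - a); have c2 := cabs_ge0 (c - b); have c3 := cabs_ge0 (a - c).
apply: contrapT => nt; apply: nle; apply: eventually_le_succ.
have small t' : vertices_in P t' -> perimeter t' = perimeter (a, b, c) / 2 ->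
    cabs (t'.1.1 - a) <= perimeter (a, b, c) -> eventually_le (tsum g ^~ t') (e / 4).
  by move=> *; apply: contrapT => n; apply: nt; exists t'.
have Pab := Pm _ _ Pa Pb; have Pbc := Pm _ _ Pb Pc; have Pca := Pm _ _ Pc Pa.
have s1 : eventually_le (tsum g ^~ (a, ab, ca)) (e / 4).
  apply: small; rewrite /= ?subrr ?cabs0; first by split.
    by rewrite E1 N9 E6 !cabs_half; lra.
  lra.
have s2 : eventually_le (tsum g ^~ (b, bc, ab)) (e / 4).
  apply: small; rewrite /=; first by split.
    by rewrite E3 N7 E2 !cabs_half; lra.
  lra.
have s3 : eventually_le (tsum g ^~ (c, ca, bc)) (e / 4).
  apply: small; rewrite /=; first by split.
    by rewrite E5 N8 E4 !cabs_half; lra.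
  rewrite -(cabsN (c - a)) opprB; lra.
have s4 : eventually_le (tsum g ^~ (ab, bc, ca)) (e / 4).
  apply: small; rewrite /=; first by split.
    by rewrite E7 E8 E9 !cabsN !cabs_half; lra.
  rewrite E1 cabs_half; lra.
have := eventually_leD (eventually_leD (eventually_leD s1 s2) s3) s4.
rewrite (_ : _ + _ + _ + _ = e); last by field.
by apply: eventually_le_ext => m /=; rewrite triangle_sum_subdivide.
Qed.

Definition limit_closed P := forall z, (forall e : R, 0 < e -> exists2 w, P w & cabs (w - z) < e) -> P z.

Lemma half_pow_small (x e : R) : 0 < e -> exists k, x / 2 ^+ k < e.
Proof.
move=> e0; exists (Num.truncn (x / e)).+1.
rewrite ltr_pdivrMr ?exprn_gt0 // mulrC -ltr_pdivrMr //.
apply: lt_le_trans (truncnS_gt (x / e)) _; rewrite -natrX ler_nat.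
by rewrite ltnW // ltn_expl.
Qed.

Lemma goursat g P a b c e : midpoint_closed P -> limit_closed P -> 0 < e ->
  P a -> P b -> P c -> (forall z, P z -> complex_differentiable g z) ->
  eventually_le (fun m => triangle_sum g m a b c) e.
Proof.
move=> Pm Pl e0 Pa Pb Pc gd; apply: contrapT => nle.
pose good (te : (C * C * C) * R) := vertices_in P te.1 /\ ~ eventually_le (tsum g ^~ te.1) te.2.
have /choice[next nextP] : forall te, exists t', good te ->
    [/\ ~ eventually_le (tsum g ^~ t') (te.2 / 4), vertices_in P t',
    perimeter t' = perimeter te.1 / 2 & cabs (t'.1.1 - te.1.1.1) <= perimeter te.1].
  move=> [t x]; have [[Vt nt]|ng] := pselect (good (t, x)); last by exists t.
  by have [t' ?] := subtriangle Pm Vt nt; exists t'.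
pose s := fix s k := if k is k'.+1 then (next (s k'), (s k').2 / 4) else ((a, b, c), e).
have sgood k : good (s k).
  elim: k => [|k IH]; first by split.
  by have [? ? _ _] := nextP _ IH; split.
pose p := perimeter (a, b, c).
have p0 : 0 <= p by rewrite /p /= !addr_ge0 ?cabs_ge0.
have se k : (s k).2 = e / 4 ^+ k.
  elim: k => [|k IH]; first by rewrite expr0 divr1.
  by rewrite /= IH exprS invfM mulrCA mulrC mulrA.
have sp k : perimeter (s k).1 = p / 2 ^+ k.
  elim: k => [|k IH]; first by rewrite expr0 divr1.
  have [_ _ -> _] := nextP _ (sgood k).
  by rewrite IH exprS invfM mulrCA mulrC mulrA.
pose v k := (s k).1.1.1.
have vS k : cabs (v k.+1 - v k) <= p / 2 ^+ k.
  by have [_ _ _] := nextP _ (sgood k); rewrite sp.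
have vD k j : cabs (v (k + j)%N - v k) <= 2 * p / 2 ^+ k * (1 - (2 ^+ j)^-1).
  elim: j => [|j IH]; first by rewrite addn0 subrr cabs0 expr0 invr1 subrr mulr0.
  rewrite addnS -(subrK (v (k + j)%N) (v _.+1)) -addrA.
  apply: le_trans (cabsD _ _) _; apply: le_trans (lerD (vS _) IH) _.
  rewrite exprD exprS; set x := 2 ^+ k; set y := 2 ^+ j.
  have x0 : x != 0 by rewrite expf_neq0.
  have y0 : y != 0 by rewrite expf_neq0.
  rewrite le_eqVlt; apply/orP; left; apply/eqP; field.
  by rewrite x0 y0.
have vD' k j : (k <= j)%N -> cabs (v j - v k) <= 2 * p / 2 ^+ k.
  move=> kj; rewrite -(subnKC kj); apply: le_trans (vD _ _) _.
  by rewrite ler_piMr ?divr_ge0 ?mulr_ge0 ?exprn_ge0.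
have [U Ufree] := exists_free_ultrafilter.
have [UF _ Utail] := Ufree.
have [|z vz] := @complex_ultralimit R U Ufree v (cabs (v 0%N) + 2 * p).
  apply: filterS (Utail 0%N) => j _ /=.
  rewrite -(subrK (v 0%N) (v j)) addrC; apply: le_trans (cabsD _ _) _.
  by rewrite lerD2l; have := vD' 0%N j isT; rewrite expr0 divr1.
have zv k : cabs (v k - z) <= 2 * p / 2 ^+ k.
  rewrite -cabsN opprB; apply: (ulim_le Ufree (u := fun j => v j - v k)).
    by have := ulimB Ufree vz (ulim_const Ufree (v k)).
  by apply: filterS (Utail k) => j; exact: vD'.
have Pz : P z.
  apply: Pl => x x0; have [k kx] := half_pow_small (2 * p) x0.
  exists (v k); last exact: le_lt_trans (zv k) kx.
  by have [] := sgood k; rewrite /v; case: (s k) => [[[a' b'] c'] x'] /= [].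
have [D gD] := gd z Pz.
(* The final estimate is [x * (3 * p ^+ 2) / 4 ^+ k], to be at most [e / 4 ^+ k]; the [1] covers a
   degenerate triangle with [p = 0]. *)
pose x := e / (3 * p ^+ 2 + 1).
have q0 : 0 < 3 * p ^+ 2 + 1 by rewrite ltr_wpDl // mulr_ge0 // sqr_ge0.
have x0 : 0 < x by rewrite divr_gt0.
have [d d0 dP] := gD x x0.
have [k kd] := half_pow_small (3 * p) d0.
have [Vk] := sgood k; apply; exists 0%N => m _; rewrite se.
(* A disc containing the [k]-th triangle: its first vertex is within [2 * p / 2 ^+ k] of [z], and
   the other two within the perimeter [p / 2 ^+ k] of that vertex. *)
pose Q w := cabs (w - z) <= 3 * p / 2 ^+ k.
have Qm : midpoint_closed Q.
  move=> a' b'; rewrite /Q => h h'.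
  have -> : midpoint a' b' - z = (a' - z) / 2 + (b' - z) / 2 by rewrite /midpoint; field.
  by apply: le_trans (cabsD _ _) _; rewrite !cabs_half; lra.
pose r w := g w + (-1) * (g z - D * z + D * w).
have rQ w : Q w -> cabs (r w) <= x * (3 * p / 2 ^+ k).
  move=> Qw; have -> : r w = g w - g z - D * (w - z) by rewrite /r; ring.
  apply: le_trans (dP _ (le_lt_trans Qw kd)) _.
  by rewrite ler_wpM2l // ltW.
have gE w : g w = r w + 1 * (g z - D * z + D * w) by rewrite /r; ring.
have := sp k; have := zv k; rewrite /v; move: (s k) Vk => [[[a' b'] c'] _] /= _.
have pk0 : 0 <= p / 2 ^+ k by rewrite divr_ge0 // exprn_ge0.
move=> az per; have p1 := cabs_ge0 (b' - a'); have p2 := cabs_ge0 (c' - b').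
have p3 := cabs_ge0 (a' - c').
have Qa : Q a' by apply: le_trans az _; lra.
have Qb : Q b'.
  have -> : b' = (b' - a') + a' by rewrite subrK.
  rewrite /Q -addrA; apply: le_trans (cabsD _ _) _; lra.
have Qc : Q c'.
  have -> : c' = - (a' - c') + a' by ring.
  rewrite /Q -addrA; apply: le_trans (cabsD _ _) _; rewrite cabsN; lra.
rewrite (_ : triangle_sum g m a' b' c' = triangle_sum r m a' b' c'); last first.
  have E u w : trapezoid g m u w = trapezoid r m u w +
      (g z - D * z + D * midpoint u w) * (w - u).
    rewrite {1}(funext gE) (trapezoid_lincomb r (fun w => g z - D * z + D * w)).
    by rewrite trapezoid_affine mul1r.
  by rewrite /triangle_sum !E /midpoint; field.
rewrite /triangle_sum; apply: le_trans (cabsD _ _) _.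
apply: le_trans (lerD (cabsD _ _) (lexx _)) _.
apply: le_trans (lerD (lerD (trapezoid_bound _ Qm Qa Qb rQ) (trapezoid_bound _ Qm Qb Qc rQ))
   (trapezoid_bound _ Qm Qc Qa rQ)) _.
rewrite -!mulrDr per.
have -> : x * (3 * p / 2 ^+ k) * (p / 2 ^+ k) = x * (3 * p ^+ 2) / 4 ^+ k.
  have -> : 4 ^+ k = 2 ^+ k * 2 ^+ k :> R by rewrite -exprMn -natrM.
  by field; rewrite expf_neq0.
rewrite ler_pM2r ?invr_gt0 ?exprn_gt0 // /x mulrAC ler_pdivrMr //.
by rewrite ler_pM2l // lerDl.
Qed.

End TrapezoidSums.

(** * Cauchy's estimate on a square *)

Section CauchyEstimate.
Variable R : realType.
Local Notation C := R[i].
Implicit Types (f g h : C -> C) (z w a b c D : C) (P : C -> Prop).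

Lemma ReD z w : complex.Re (z + w) = complex.Re z + complex.Re w.
Proof. by case: z w => [? ?] [? ?]. Qed.

Lemma ImD z w : complex.Im (z + w) = complex.Im z + complex.Im w.
Proof. by case: z w => [? ?] [? ?]. Qed.

Lemma Re_realM (x : R) z : complex.Re (x%:C%C * z) = x * complex.Re z.
Proof. by case: z => a b /=; rewrite mul0r subr0. Qed.

Lemma limit_closed_halfplane mu a (s : R) P : limit_closed P ->
  limit_closed (fun z => P z /\ s <= complex.Re (mu * (z - a))).
Proof.
move=> Pl z h; split.
  by apply: Pl => e e0; have [w [Pw _] wz] := h e e0; exists w.
rewrite leNgt; apply/negP => zs.
pose e := (s - complex.Re (mu * (z - a))) / (cabs mu + 1).
have m1 : 0 < cabs mu + 1 by rewrite ltr_wpDl // cabs_ge0.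
have e0 : 0 < e by rewrite divr_gt0 // subr_gt0.
have [w [_ ws] wz] := h e e0.
have : complex.Re (mu * (w - a)) = complex.Re (mu * (z - a)) + complex.Re (mu * (w - z)).
  by rewrite -ReD -mulrDr; congr (complex.Re (_ * _)); ring.
have := le_trans (ler_norm _) (Re_le_cabs (mu * (w - z))); rewrite cabsM => h1 h2.
have h3 : (cabs mu + 1) * cabs (w - z) < s - complex.Re (mu * (z - a)).
  by rewrite mulrC -ltr_pdivlMr.
have := cabs_ge0 (w - z); lra.
Qed.

Lemma midpoint_closed_halfplane mu a (s : R) P : midpoint_closed P ->
  midpoint_closed (fun z => P z /\ s <= complex.Re (mu * (z - a))).
Proof.
move=> Pm z w [Pz zs] [Pw ws]; split; first exact: Pm.
have -> : mu * (midpoint z w - a) = ((1/2 : R)%:C)%C * (mu * (z - a) + mu * (w - a)).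
  by rewrite rmorphM fmorphV rmorph1 rmorph_nat /midpoint; field.
rewrite Re_realM ReD; lra.
Qed.

(** A bounded singularity at the vertex [a] is removable. After a subdivision, three of the
    triangles lie in the half-plane at height at least [s / 2] above [a], where [goursat] applies;
    the corner triangle is halved again and again, its sums being at most [M] times its
    perimeter. *)
Lemma goursat_vertex g P mu M a b c (s e : R) :
  midpoint_closed P -> limit_closed P -> P a -> P b -> P c -> 0 < s ->
  s <= complex.Re (mu * (b - a)) -> s <= complex.Re (mu * (c - a)) ->
  (forall z, P z -> z != a -> complex_differentiable g z) ->
  (forall z, P z -> cabs (g z) <= M) -> 0 < e ->
  eventually_le (fun m => triangle_sum g m a b c) e.
Proof.
move=> Pm Pl Pa Pb Pc s0 bs cs gd gM e0.
have M0 : 0 <= M by apply: le_trans (gM a Pa); exact: cabs_ge0.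
suff h k : eventually_le (fun m => triangle_sum g m a b c)
    (e / 2 + M * perimeter (a, b, c) / 2 ^+ k).
  have e2 : 0 < e / 2 by rewrite divr_gt0.
  have [k ke] := half_pow_small (M * perimeter (a, b, c)) e2.
  have [m0 hm] := h k; exists m0 => m /hm /le_trans; apply; lra.
have : 0 < e / 2 by rewrite divr_gt0.
move: (e / 2) => {e0}e e0.
elim: k b c s e s0 e0 Pb Pc bs cs => [|k IH] b c s {}e s0 e0 Pb Pc bs cs.
  exists 0%N => m _; rewrite expr0 divr1 /triangle_sum.
  apply: le_trans (cabsD _ _) _; apply: le_trans (lerD (cabsD _ _) (lexx _)) _.
  apply: le_trans (lerD (lerD (trapezoid_bound _ Pm Pa Pb gM) (trapezoid_bound _ Pm Pb Pc gM))
    (trapezoid_bound _ Pm Pc Pa gM)) _.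
  by rewrite -!mulrDr lerDr ltW.
apply: eventually_le_succ.
set ab := midpoint a b; set bc := midpoint b c; set ca := midpoint c a.
have Pab : P ab by exact: Pm.
have Pca : P ca by exact: Pm.
have Pbc : P bc by exact: Pm.
have abE : mu * (ab - a) = ((1/2 : R)%:C)%C * (mu * (b - a)).
  by rewrite rmorphM fmorphV rmorph1 rmorph_nat /ab /midpoint; field.
have caE : mu * (ca - a) = ((1/2 : R)%:C)%C * (mu * (c - a)).
  by rewrite rmorphM fmorphV rmorph1 rmorph_nat /ca /midpoint; field.
have bcE : mu * (bc - a) = ((1/2 : R)%:C)%C * (mu * (b - a) + mu * (c - a)).
  by rewrite rmorphM fmorphV rmorph1 rmorph_nat /bc /midpoint; field.
have abs : s / 2 <= complex.Re (mu * (ab - a)) by rewrite abE Re_realM; lra.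
have cas : s / 2 <= complex.Re (mu * (ca - a)) by rewrite caE Re_realM; lra.
have bcs : s / 2 <= complex.Re (mu * (bc - a)) by rewrite bcE Re_realM ReD; lra.
have s2 : 0 < s / 2 by rewrite divr_gt0.
pose P' z := P z /\ s / 2 <= complex.Re (mu * (z - a)).
have P'd z : P' z -> complex_differentiable g z.
  move=> [Pz zs]; apply: gd => //; apply: contraTneq zs => ->.
  by rewrite subrr mulr0 -ltNge.
have P'm : midpoint_closed P' by exact: midpoint_closed_halfplane.
have P'l : limit_closed P' by exact: limit_closed_halfplane.
have e4 : 0 < e / 4 by rewrite divr_gt0.
have P'b : P' b by split=> //; lra.
have P'c : P' c by split=> //; lra.
have t1 := IH ab ca (s / 2) (e / 4) s2 e4 Pab Pca abs cas.
have t2 := goursat P'm P'l e4 P'b (conj Pbc bcs) (conj Pab abs) P'd.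
have t3 := goursat P'm P'l e4 P'c (conj Pca cas) (conj Pbc bcs) P'd.
have t4 := goursat P'm P'l e4 (conj Pab abs) (conj Pbc bcs) (conj Pca cas) P'd.
have := eventually_leD (eventually_leD (eventually_leD t1 t2) t3) t4.
rewrite (_ : _ + _ + _ + _ = e + M * perimeter (a, b, c) / 2 ^+ k.+1).
  by apply: eventually_le_ext => m; rewrite triangle_sum_subdivide.
rewrite /= (_ : ab - a = (b - a) / 2); last by rewrite /ab /midpoint; field.
rewrite (_ : ca - ab = (c - b) / 2); last by rewrite /ca /ab /midpoint; field.
rewrite (_ : a - ca = (a - c) / 2); last by rewrite /ca /midpoint; field.
by rewrite !cabs_half exprS; field; rewrite expf_neq0.
Qed.

Lemma midpoint_closed_disc (r : R) : midpoint_closed (fun z : C => cabs z <= r).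
Proof.
move=> a b ar br; have -> : midpoint a b = a / 2 + b / 2 by rewrite /midpoint; field.
by apply: le_trans (cabsD _ _) _; rewrite !cabs_half; lra.
Qed.

Lemma limit_closed_disc (r : R) : limit_closed (fun z : C => cabs z <= r).
Proof.
move=> z h; apply/ler_addgt0Pr => e e0; have [w wr wz] := h e e0.
have -> : z = w - (w - z) by ring.
by apply: le_trans (cabsD _ _) _; rewrite cabsN lerD // ltW.
Qed.

(** Invariance of [dz / z] under scaling, which makes the four sides of the square contribute
    equally. *)
Lemma trapezoid_inv_scale m a b c : c != 0 ->
  trapezoid (fun z => z^-1) m (c * a) (c * b) = trapezoid (fun z => z^-1) m a b.
Proof.
move=> c0; elim: m a b => [|m IH] a b /=.
  rewrite !invfM; move: a^-1 b^-1 => x y; by field.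
by rewrite (_ : midpoint (c * a) (c * b) = c * midpoint a b) ?IH // /midpoint; ring.
Qed.

(** At the point of parameter [u] of the segment from [1] to [i], the imaginary part of [dz / z] is
    [du / |z|^2], and [|z| <= 1]. The resulting bound [1] stands in for the exact value pi/2. *)
Lemma Im_trapezoid_inv m (s t : R) : 0 <= s -> s <= t -> t <= 1 ->
  t - s <= complex.Im (trapezoid (fun z => z^-1) m ((1 - s) +i* s)%C ((1 - t) +i* t)%C).
Proof.
elim: m s t => [|m IH] s t s0 st t1 /=.
  have q (u : R) : 0 <= u -> u <= 1 -> 0 < (1 - u) ^+ 2 + u ^+ 2 <= 1.
    by move=> ? ?; apply/andP; split; nra.
  have t0 : 0 <= t by lra.
  have s1 : s <= 1 by lra.
  have [/andP[qs qs1] /andP[qt qt1]] := (q s s0 s1, q t t0 t1).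
  set x := (1 - s) ^+ 2 + s ^+ 2 in qs qs1 *; set y := (1 - t) ^+ 2 + t ^+ 2 in qt qt1 *.
  have x1 : 1 <= x^-1 by rewrite invf_ge1.
  have y1 : 1 <= y^-1 by rewrite invf_ge1.
  (* The real part of the complex number [2^-1], as computation unfolds it. *)
  have -> : (1 + 1) / ((1 + 1) ^+ 2 + (0 + 0) ^+ 2) = 2^-1 :> R by field.
  move: x^-1 y^-1 x1 y1 => X Y X1 Y1; rewrite addr0 mul0r oppr0.
  have h : 0 <= (t - s) * ((X + Y) / 2 - 1) by apply: mulr_ge0; lra.
  by lra.
have -> : midpoint ((1 - s) +i* s)%C ((1 - t) +i* t)%C =
    ((1 - (s + t) / 2) +i* ((s + t) / 2))%C.
  rewrite /midpoint (_ : (2^-1 : C) = ((2^-1 : R)%:C)%C) ?fmorphV ?rmorph_nat //=.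
  by congr (_ +i* _)%C; field.
have := IH s ((s + t) / 2); have := IH ((s + t) / 2) t; rewrite ImD.
have h0 : 0 <= (s + t) / 2 by lra.
have h1 : s <= (s + t) / 2 by lra.
have h2 : (s + t) / 2 <= t by lra.
have h3 : (s + t) / 2 <= 1 by lra.
by move=> /(_ h0 h2 t1) ? /(_ s0 h1 h3) ?; lra.
Qed.

(* One edge [p, q] of the square, whose normal direction is given by [mu]. *)
Definition square_edge mu p q (r : R) := [/\ cabs p <= r, cabs q <= r, cabs mu <= 2,
  complex.Re (mu * p) = r & complex.Re (mu * q) = r].

Section Square.
(* Cauchy's formula for the square with vertices r, ir, -r, -ir: the trapezoid
   sums of (h z - h w) / (z - w) tend to 0, and those of 1 / z stay away from 0. *)
Variables (h : C -> C) (r M : R).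
Hypotheses (rpos : 0 < r) (hd : forall z, cabs z <= r -> complex_differentiable h z)
  (hM : forall z, cabs z <= r -> cabs (h z) <= M).

(** The difference quotient is singular only at the vertex [w], above which the edge has height at
    least [r / 2] in the direction [mu]. It is bounded by [1 + cabs D] near [w] and by [2 * M / d]
    elsewhere. *)
Lemma edge_triangle mu p q w (e : R) : square_edge mu p q r -> cabs w <= r / 4 -> 0 < e ->
  eventually_le (fun m => triangle_sum (fun z => (h z - h w) / (z - w)) m w p q) e.
Proof.
have r0 := rpos.
move=> [pr qr mu2 mup muq] wr e0.
have wr' : cabs w <= r by lra.
have [D hD] := hd wr'.
have [d d0 dP] := complex_derivative_bounded hD.
have M0 : 0 <= M by apply: le_trans (hM wr'); exact: cabs_ge0.
have D0 := cabs_ge0 D.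
have Rew x : complex.Re (mu * (x - w)) = complex.Re (mu * x) - complex.Re (mu * w).
  by rewrite mulrBr; case: (mu * x) => ? ?; case: (mu * w).
have muw : complex.Re (mu * w) <= r / 2.
  apply: le_trans (ler_norm _) (le_trans (Re_le_cabs _) _); rewrite cabsM.
  have := ler_pM (cabs_ge0 _) (cabs_ge0 _) mu2 wr; lra.
apply: (@goursat_vertex _ (fun z => cabs z <= r) mu (1 + cabs D + 2 * M / d) _ _ _ (r / 2)).
- exact: midpoint_closed_disc.
- exact: limit_closed_disc.
- by [].
- by [].
- by [].
- by rewrite divr_gt0.
- by rewrite Rew mup; lra.
- by rewrite Rew muq; lra.
- move=> z zr zw; apply: complex_differentiableM.
    apply: complex_differentiableD; first exact: hd.
    exact: complex_differentiable_const.
  apply: complex_differentiableV; first by rewrite subr_eq0.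
  apply: complex_differentiableD; first exact: complex_differentiable_id.
  exact: complex_differentiable_const.
- move=> z zr; have dM : 0 <= 2 * M / d by rewrite divr_ge0 ?mulr_ge0 // ltW.
  rewrite cabsM cabsV; have [zd|zd] := ltP (cabs (z - w)) d.
    have [->|zw] := eqVneq z w; first by rewrite !subrr cabs0 mul0r; lra.
    rewrite ler_pdivrMr ?cabs_gt0 ?subr_eq0 //; apply: le_trans (dP _ zd) _.
    by rewrite ler_wpM2r ?cabs_ge0 //; lra.
  have zw : 0 < cabs (z - w) by exact: lt_le_trans zd.
  rewrite ler_pdivrMr //.
  have := cabsD (h z) (- h w); rewrite cabsN => hh.
  have := hM zr; have := hM wr' => h1 h2.
  apply: le_trans (_ : 2 * M / d * cabs (z - w) <= _).
    rewrite mulrAC ler_pdivlMr //; nra.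
  by rewrite ler_wpM2r ?cabs_ge0 //; lra.
- exact: e0.
Qed.

(** The kernels differ by [w / (z * (z - w))]. On an edge [z] has modulus at least [r / 2] and
    [z - w] at least [r / 4], and the edge has length at most [2 * r], whence the constant
    [8 * 2 = 16]. *)
Lemma edge_kernel_bound (f : C -> C) (B : R) mu p q w m :
  (forall z, cabs z <= r -> cabs (f z) <= B) ->
  square_edge mu p q r -> cabs w <= r / 4 ->
  cabs (trapezoid (fun z => f z / (z - w)) m p q - trapezoid (fun z => f z / z) m p q)
    <= 16 * B * cabs w / r.
Proof.
have r0 := rpos.
move=> fB [pr qr mu2 mup muq] wr.
have B0 : 0 <= B by apply: le_trans (fB p pr); exact: cabs_ge0.
rewrite -[_ - _]addrC -mulN1r addrC -trapezoid_lincomb.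
pose P z := cabs z <= r /\ complex.Re (mu * z) = r.
have Pm : midpoint_closed P.
  move=> a b [ar Ra] [br Rb]; split; first exact: midpoint_closed_disc.
  have -> : mu * midpoint a b = ((1/2 : R)%:C)%C * (mu * a + mu * b).
    by rewrite rmorphM fmorphV rmorph1 rmorph_nat /midpoint; field.
  by rewrite Re_realM ReD Ra Rb; field.
have w0 := cabs_ge0 w.
have := trapezoid_bound (g := fun z => f z / (z - w) + -1 * (f z / z)) (P := P)
  (M := 8 * B * cabs w / r ^+ 2) m Pm (conj pr mup) (conj qr muq).
have pq : cabs (q - p) <= 2 * r by have := cabsD q (- p); rewrite cabsN; lra.
move=> hb; apply: le_trans (hb _) _ => {hb}.
  move=> z [zr Rz].
  have zr2 : r / 2 <= cabs z.
    have : r <= cabs mu * cabs z by rewrite -cabsM -{1}Rz; apply: le_trans (ler_norm _) (Re_le_cabs _).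
    have := ler_wpM2r (cabs_ge0 z) mu2; lra.
  have zw4 : r / 4 <= cabs (z - w).
    have := cabsD (z - w) w; rewrite subrK; lra.
  have z0 : z != 0 by rewrite -cabs_gt0; lra.
  have zw0 : z - w != 0 by rewrite -cabs_gt0; lra.
  have -> : f z / (z - w) + -1 * (f z / z) = f z * w / (z * (z - w)) by field; rewrite z0 zw0.
  rewrite cabsM cabsV !cabsM ler_pdivrMr; last by rewrite mulr_gt0 ?cabs_gt0.
  have fz := fB z zr.
  have h1 : r ^+ 2 / 8 <= cabs z * cabs (z - w).
    have := ler_pM _ _ zr2 zw4; rewrite expr2; have rr : 0 <= r / 2 by lra.
    have rr' : 0 <= r / 4 by lra.
    by move=> /(_ rr rr'); lra.
  have h2 : 0 <= 8 * B * cabs w / r ^+ 2 by rewrite !mulr_ge0 // invr_ge0 sqr_ge0.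
  apply: le_trans (ler_wpM2r w0 fz) _; apply: le_trans (ler_wpM2l h2 h1).
  by rewrite le_eqVlt; apply/orP; left; apply/eqP; field; rewrite gt_eqF.
have h2 : 0 <= 8 * B * cabs w / r ^+ 2 by rewrite !mulr_ge0 // invr_ge0 sqr_ge0.
apply: le_trans (ler_wpM2l h2 pq) _.
by rewrite le_eqVlt; apply/orP; left; apply/eqP; field; rewrite gt_eqF.
Qed.

Let p0 : C := r%:C%C.
Let p1 : C := (r%:C * 'i)%C.
Let quad f m := trapezoid f m p0 p1 + trapezoid f m p1 (- p0) +
  trapezoid f m (- p0) (- p1) + trapezoid f m (- p1) p0.

Lemma square_edges : [/\ square_edge (1 -i* 1)%C p0 p1 r,
  square_edge (-1 -i* 1)%C p1 (- p0) r, square_edge (-1 +i* 1)%C (- p0) (- p1) r &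
  square_edge (1 +i* 1)%C (- p1) p0 r].
Proof.
have r0 := rpos.
have c0 : cabs p0 <= r by rewrite cabs_real ger0_norm // ltW.
have c1 : cabs p1 <= r.
  by rewrite cabsM cabs_i mulr1.
split; (split; [by rewrite ?cabsN|by rewrite ?cabsN|
  by apply: le_trans (cabs_le_ReIm _) _; rewrite /= ?normrN normr1|
  by rewrite /=; ring|by rewrite /=; ring]).
Qed.

(** By scaling, the sum is four times that along the segment from [1] to [i], of imaginary part at
    least [1]; the sum approximates [2 pi i]. *)
Lemma quad_inv_ge m : 4 <= cabs (quad (fun z => z^-1) m).
Proof.
have r0 := rpos.
have r0C : p0 != 0 by rewrite -cabs_gt0 cabs_real normr_gt0 gt_eqF.
have i0 : ('i%C : C) != 0 by rewrite eq_complex /= oner_eq0 andbF.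
have i2 : 'i%C * 'i%C = -1 :> C by rewrite -expr2 sqr_i.
pose t := trapezoid (fun z => z^-1) m 1 ('i%C : C).
have E c : c != 0 -> trapezoid (fun z => z^-1) m c (c * 'i%C) = t.
  by move=> c0; rewrite -{1}[c]mulr1 trapezoid_inv_scale.
have -> : quad (fun z => z^-1) m = 4 * t.
  rewrite /quad E // -/p1 (_ : - p0 = p1 * 'i%C); last by rewrite /p1 -mulrA i2 mulrN1.
  rewrite E ?mulf_neq0 // (_ : - p1 = p1 * 'i%C * 'i%C); last by rewrite -mulrA i2 mulrN1.
  rewrite E ?mulf_neq0 // (_ : p0 = p1 * 'i%C * 'i%C * 'i%C); last first.
    by rewrite -mulrA i2 mulrN1 /p1 -mulrA i2 mulrN1 opprK.
  by rewrite -/p1 E ?mulf_neq0 //; ring.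
have : 1 <= complex.Im t.
  have := Im_trapezoid_inv m (lexx (0 : R)) ler01 (lexx 1).
  by rewrite !subr0 subrr.
move=> t1; have := Im_le_cabs t; have := ler_norm (complex.Im t).
have c4 : cabs (4 : C) = 4 by have := cabs_real (4 : R); rewrite rmorph_nat => ->; rewrite ger0_norm.
by rewrite cabsM c4; lra.
Qed.

Lemma quad_bound (f : C -> C) (B : R) w m :
  (forall z, cabs z <= r -> cabs (f z) <= B) -> cabs w <= r / 4 ->
  cabs (quad (fun z => f z / (z - w)) m - quad (fun z => f z / z) m) <= 64 * B * cabs w / r.
Proof.
have r0 := rpos.
move=> fB wr; have [E1 E2 E3 E4] := square_edges.
have := edge_kernel_bound m fB E1 wr; have := edge_kernel_bound m fB E2 wr.
have := edge_kernel_bound m fB E3 wr; have := edge_kernel_bound m fB E4 wr.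
rewrite /quad; move: (trapezoid _ _ _ _) => a1; move: (trapezoid _ _ _ _) => b1.
move: (trapezoid _ _ _ _) => a2; move: (trapezoid _ _ _ _) => b2.
move: (trapezoid _ _ _ _) => a3; move: (trapezoid _ _ _ _) => b3.
move: (trapezoid _ _ _ _) => a4; move: (trapezoid _ _ _ _) => b4.
move=> h1 h2 h3 h4.
have -> : a4 + a3 + a2 + a1 - (b4 + b3 + b2 + b1) =
  (a4 - b4) + (a3 - b3) + ((a2 - b2) + (a1 - b1)) by ring.
apply: le_trans (cabsD _ _) _; apply: le_trans (lerD (cabsD _ _) (cabsD _ _)) _.
lra.
Qed.

Lemma quad_difference_quotient w (e : R) : cabs w <= r / 4 -> 0 < e ->
  eventually_le (quad (fun z => (h z - h w) / (z - w))) e.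
Proof.
have r0 := rpos.
move=> wr e0; have e4 : 0 < e / 4 by rewrite divr_gt0.
have [E1 E2 E3 E4] := square_edges.
have t1 := edge_triangle E1 wr e4; have t2 := edge_triangle E2 wr e4.
have t3 := edge_triangle E3 wr e4; have t4 := edge_triangle E4 wr e4.
have := eventually_leD (eventually_leD (eventually_leD t1 t2) t3) t4.
rewrite (_ : _ + _ + _ + _ = e); last by field.
apply: eventually_le_ext => m; rewrite /triangle_sum /quad.
rewrite (trapezoidC _ m w p1) (trapezoidC _ m w (- p0)) (trapezoidC _ m w (- p1)).
rewrite (trapezoidC _ m w p0); ring.
Qed.

(** Write [fw], [iw] for the sums of [h z / (z - w)] and [1 / (z - w)], and [f0], [i0] for those
    with [w = 0]. Up to [e], [fw = h w * iw] and [f0 = h 0 * i0], so [(h w - h 0) * iw] is close to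
    [(fw - f0) - h 0 * (iw - i0)], which [quad_bound] controls. For [cabs w <= r / 32], [iw] differs
    from [i0] by at most [2], so its modulus is at least [2]; for larger [w] the bound [2 * M]
    suffices. *)
Lemma lipschitz_origin w : cabs w <= r -> cabs (h w - h 0) <= 64 * M * cabs w / r.
Proof.
have r0 := rpos.
move=> wr; have w0 := cabs_ge0 w.
have M0 : 0 <= M.
  by apply: le_trans (hM (_ : cabs 0 <= r)); rewrite ?cabs_ge0 // cabs0 ltW.
have [wr32|wr32] := ltP (r / 32) (cabs w).
  have := cabsD (h w) (- h 0); rewrite cabsN.
  have := hM wr; have /hM : cabs (0 : C) <= r by rewrite cabs0 ltW.
  have : 2 * M <= 64 * M * cabs w / r by rewrite ler_pdivlMr //; nra.
  lra.
apply/ler_addgt0Pr => e e0.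
have wr4 : cabs w <= r / 4 by lra.
have zr4 : cabs (0 : C) <= r / 4 by rewrite cabs0; lra.
have [m1 h1] := quad_difference_quotient wr4 e0.
have [m2 h2] := quad_difference_quotient zr4 e0.
pose m := maxn m1 m2.
have {h1}k1 := h1 m (leq_maxl _ _); have {h2}k2 := h2 m (leq_maxr _ _).
have k3 := quad_bound m hM wr4.
have k4 := @quad_bound (fun=> 1) 1 w m (fun z _ => eq_ind_r (fun x => x <= 1) (lexx 1) (cabs1 R)) wr4.
have k5 := quad_inv_ge m.
have qE f k (g : C -> C) : (quad (fun z => f z + k * g z) m) = quad f m + k * quad g m.
  by rewrite /quad !trapezoid_lincomb; ring.
have E u : quad (fun z => (h z - h u) / (z - u)) m =
    quad (fun z => h z / (z - u)) m + - h u * quad (fun z => 1 / (z - u)) m.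
  by rewrite -qE; congr (quad _ m); apply/funext => z; rewrite mulrDl !mulNr mul1r.
rewrite !E in k1 k2.
have F (g : C -> C) : (fun z => g z / (z - 0)) = (fun z => g z / z).
  by apply/funext => z; rewrite subr0.
rewrite !F in k2.
rewrite (_ : (fun z : C => z^-1) = (fun z => 1 / z)) in k5; last first.
  by apply/funext => z; rewrite mul1r.
have h0M : cabs (h 0) <= M by apply: hM; rewrite cabs0 ltW.
move: k1 k2 k3 k4 k5.
move: (quad (fun z => h z / (z - w)) m) (quad (fun z => h z / z) m) => fw f0.
move: (quad (fun z => 1 / (z - w)) m) (quad (fun z => 1 / z) m) => iw i0.
move=> k1 k2 k3 k4 k5.
have wr2 : 64 * cabs w / r <= 2 by rewrite ler_pdivrMr //; lra.
have iw2 : 2 <= cabs iw.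
  have := cabsD iw (- (iw - i0)); rewrite cabsN.
  have -> : iw + - (iw - i0) = i0 by ring.
  lra.
have key : (h w - h 0) * iw = (fw - f0) - (fw + - h w * iw) + (f0 + - h 0 * i0) - h 0 * (iw - i0).
  by ring.
have kb : cabs (h w - h 0) * cabs iw <= 128 * M * cabs w / r + 2 * e.
  rewrite -cabsM key.
  apply: le_trans (cabsD _ _) _; rewrite cabsN cabsM.
  apply: le_trans (lerD (cabsD _ _) (lexx _)) _.
  apply: le_trans (lerD (lerD (cabsD _ _) (lexx _)) (lexx _)) _; rewrite cabsN.
  have := ler_pM (cabs_ge0 _) (cabs_ge0 _) h0M k4.
  have -> : M * (64 * 1 * cabs w / r) = 64 * M * cabs w / r by field; rewrite gt_eqF.
  have -> : 128 * M * cabs w / r = 64 * M * cabs w / r + 64 * M * cabs w / r.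
    by field; rewrite gt_eqF.
  lra.
have := ler_wpM2l (cabs_ge0 (h w - h 0)) iw2.
have E2 : 128 * M * cabs w / r = 2 * (64 * M * cabs w / r) by field; rewrite gt_eqF.
lra.
Qed.

End Square.

End CauchyEstimate.

(** * Taylor estimates and limits of holomorphic functions *)

Section Montel.
Variable R : realType.
Local Notation C := R[i].
Implicit Types (h : C -> C) (z w a d D : C).

Definition bounded_holomorphic h a (r M : R) := forall z, cabs (z - a) <= r ->
  complex_differentiable h z /\ cabs (h z) <= M.

Lemma bounded_holomorphic_sub h a b (r s M : R) : cabs (b - a) + s <= r ->
  bounded_holomorphic h a r M -> bounded_holomorphic h b s M.
Proof.
move=> abr hb z zb; apply: hb; have -> : z - a = (z - b) + (b - a) by ring.
by apply: le_trans (cabsD _ _) _; lra.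
Qed.

Lemma complex_differentiable_shift h a z : complex_differentiable h (z + a) ->
  complex_differentiable (fun w => h (w + a)) z.
Proof.
apply: (@complex_differentiable_comp _ (fun w => w + a) h).
apply: complex_differentiableD; first exact: complex_differentiable_id.
exact: complex_differentiable_const.
Qed.

Lemma lipschitz h a (r M : R) w : 0 < r -> bounded_holomorphic h a r M ->
  cabs (w - a) <= r -> cabs (h w - h a) <= 64 * M * cabs (w - a) / r.
Proof.
move=> r0 hb wr; have hb' z : cabs z <= r -> cabs ((z + a) - a) <= r by rewrite addrK.
have := @lipschitz_origin R (fun z => h (z + a)) r M r0 _ _ (w - a) wr.
rewrite subrK add0r; apply=> z /hb' /hb []//.
by move=> hd _; exact: complex_differentiable_shift.
Qed.

(** [lipschitz] on discs of radius [r / 2] bounds the first difference by [128 * M * cabs d / r];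
    applied again to that difference it gives the constant [64 * 128 * 2]. *)
Lemma second_difference h a (r M : R) d : 0 < r -> bounded_holomorphic h a r M ->
  cabs d <= r / 4 ->
  cabs (h (a + d + d) - h (a + d) - (h (a + d) - h a)) <= 16384 * M * cabs d ^+ 2 / r ^+ 2.
Proof.
move=> r0 hb dr; have d0 := cabs_ge0 d.
have r2 : 0 < r / 2 by rewrite divr_gt0.
have kb : bounded_holomorphic (fun z => h (z + d) - h z) a (r / 2) (128 * M * cabs d / r).
  move=> z zr.
  have zdr : cabs (z + d - a) <= r.
    have -> : z + d - a = (z - a) + d by ring.
    by apply: le_trans (cabsD _ _) _; lra.
  split.
    apply: complex_differentiableD.
      by apply: complex_differentiable_shift; exact: (hb _ zdr).1.
    by apply: complex_differentiableN; apply: (hb z _).1; lra.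
  have hz : bounded_holomorphic h z (r / 2) M by apply: bounded_holomorphic_sub hb; lra.
  have := lipschitz r2 hz (w := z + d); rewrite addrC addKr => /(_ _).
  have dr2 : cabs d <= r / 2 by lra.
  move=> /(_ dr2); rewrite addrC; congr (_ <= _).
  by field; rewrite gt_eqF.
have := lipschitz r2 kb (w := a + d); rewrite [a + d - a]addrC addKr.
have dr2 : cabs d <= r / 2 by lra.
move=> /(_ dr2); congr (_ <= _).
by field; rewrite gt_eqF.
Qed.

(** Telescoping over the halvings of [d]: the second differences form a geometric series. As [k]
    grows, the subtracted term tends to the derivative at [a] times [d], which gives [taylor]
    without a second derivative. *)
Lemma dyadic_difference h a (r M : R) d k : 0 < r -> bounded_holomorphic h a r M ->
  cabs d <= r / 2 ->
  cabs (h (a + d) - h a - 2 ^+ k * (h (a + d / 2 ^+ k) - h a)) <=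
    8192 * M * cabs d ^+ 2 / r ^+ 2 * (1 - (2 ^+ k)^-1).
Proof.
move=> r0 hb dr; elim: k => [|k IH].
  by rewrite !expr0 divr1 mul1r subrr cabs0 invr1 subrr mulr0.
pose d' := d / 2 ^+ k.+1.
have c2k : cabs (2 ^+ k : C) = 2 ^+ k by rewrite cabsX cabs2.
have k0 : (2 ^+ k : R) != 0 by rewrite expf_neq0.
have k0' : (2 ^+ k : C) != 0 by rewrite expf_neq0.
have d'E : cabs d' = cabs d / (2 * 2 ^+ k) by rewrite /d' cabsM cabsV cabsX cabs2 exprS.
have kp : 0 < 2 ^+ k :> R by rewrite exprn_gt0.
have k1 : 1 <= 2 ^+ k :> R by rewrite exprn_ege1 // ler1n.
have d'r : cabs d' <= r / 4.
  rewrite d'E ler_pdivrMr ?mulr_gt0 //; nra.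
have E : a + d / 2 ^+ k = a + d' + d' by rewrite /d' exprS; field.
have := second_difference r0 hb d'r; rewrite -E => h2.
have -> : h (a + d) - h a - 2 ^+ k.+1 * (h (a + d / 2 ^+ k.+1) - h a) =
  (h (a + d) - h a - 2 ^+ k * (h (a + d / 2 ^+ k) - h a)) +
  2 ^+ k * (h (a + d / 2 ^+ k) - h (a + d') - (h (a + d') - h a)).
  by rewrite -/d' exprS; ring.
apply: le_trans (cabsD _ _) _; rewrite cabsM c2k.
apply: le_trans (lerD IH (ler_wpM2l (ltW kp) h2)) _.
rewrite d'E (exprS 2 k); move: (2 ^+ k) k0 => u u0.
by rewrite le_eqVlt; apply/orP; left; apply/eqP; field; rewrite u0 gt_eqF.
Qed.

Lemma derivative_bound h a (r M : R) D : 0 < r -> bounded_holomorphic h a r M ->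
  complex_derivative h a D -> cabs D <= 64 * M / r.
Proof.
move=> r0 hb hD; apply/ler_addgt0Pr => e e0; have [d d0 dP] := hD e e0.
pose t := Num.min (d / 2) r.
have t0 : 0 < t by rewrite lt_min r0 divr_gt0.
have td : t < d by rewrite gt_min ltr_pdivrMr // ltr_pMr // ltr1n.
have tr : t <= r by rewrite ge_min lexx orbT.
have ct : cabs (t%:C%C : C) = t by rewrite cabs_real gtr0_norm.
have := dP (t%:C%C + a); rewrite addrK ct => /(_ td) h1.
have := lipschitz r0 hb (w := t%:C%C + a); rewrite addrK ct => /(_ tr) h2.
rewrite -(ler_pM2r t0) -{1}ct -cabsM.
have -> : D * t%:C%C = (h (t%:C%C + a) - h a) - (h (t%:C%C + a) - h a - D * t%:C%C) by ring.
apply: le_trans (cabsD _ _) _; rewrite cabsN mulrDl; apply: lerD => //.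
by apply: le_trans h2 _; rewrite mulrAC.
Qed.

Lemma taylor h a (r M : R) D d : 0 < r -> bounded_holomorphic h a r M ->
  complex_derivative h a D -> cabs d <= r / 2 ->
  cabs (h (a + d) - h a - D * d) <= 8192 * M * cabs d ^+ 2 / r ^+ 2.
Proof.
move=> r0 hb hD dr; have d0 := cabs_ge0 d.
have M0 : 0 <= M.
  have [] := hb a; first by rewrite subrr cabs0 ltW.
  by move=> _; apply: le_trans; exact: cabs_ge0.
have B0 : 0 <= 8192 * M * cabs d ^+ 2 / r ^+ 2.
  apply: mulr_ge0; last by rewrite invr_ge0 exprn_ge0 // ltW.
  by apply: mulr_ge0; [apply: mulr_ge0 M0; rewrite ler0n|rewrite exprn_ge0].
apply/ler_addgt0Pr => e e0.
have e1 : 0 < e / (cabs d + 1) by rewrite divr_gt0 // ltr_wpDl.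
have [t t0 tP] := hD _ e1; have [k kt] := half_pow_small (cabs d) t0.
have k0' : (2 ^+ k : C) != 0 by rewrite expf_neq0.
have k0 : 0 < 2 ^+ k :> R by rewrite exprn_gt0.
have := dyadic_difference k r0 hb dr => h1.
have dk : cabs (d / 2 ^+ k) = cabs d / 2 ^+ k by rewrite cabsM cabsV cabsX cabs2.
have := tP (a + d / 2 ^+ k); rewrite [a + _ - a]addrC addKr dk => /(_ kt) h2.
have -> : h (a + d) - h a - D * d =
  (h (a + d) - h a - 2 ^+ k * (h (a + d / 2 ^+ k) - h a)) +
  2 ^+ k * (h (a + d / 2 ^+ k) - h a - D * (d / 2 ^+ k)) by field.
apply: le_trans (cabsD _ _) _; rewrite cabsM cabsX cabs2; apply: lerD.
  apply: le_trans h1 _; rewrite ler_piMr // lerBlDr lerDl invr_ge0 ltW //.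
apply: le_trans (ler_wpM2l (ltW k0) h2) _.
have -> : 2 ^+ k * (e / (cabs d + 1) * (cabs d / 2 ^+ k)) = e * (cabs d / (cabs d + 1)).
  by move: (2 ^+ k) (lt0r_neq0 k0) => u u0; field; rewrite u0 gt_eqF // ltr_wpDl.
rewrite ler_piMr ?(ltW e0) // ler_pdivrMr ?ltr_wpDl //; lra.
Qed.

(** The derivatives at [a] are bounded, so they have an ultralimit [D]; the remainder in [taylor]
    does not depend on [n], so it passes to the limit. *)
Lemma ulim_complex_differentiable U (hn : nat -> C -> C) h a (r M : R) :
  free_ultrafilter U -> 0 < r -> U [set n | bounded_holomorphic (hn n) a r M] ->
  (forall z, cabs (z - a) <= r -> ulim U (hn ^~ z) (h z)) ->
  complex_differentiable h a.
Proof.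
move=> Uf r0 hb hl; have [UF _ _] := Uf.
have aa : cabs (a - a) <= r by rewrite subrr cabs0 ltW.
have /choice[Dn DnP] : forall n, exists D, bounded_holomorphic (hn n) a r M ->
    complex_derivative (hn n) a D.
  move=> n; have [b|nb] := pselect (bounded_holomorphic (hn n) a r M).
    by have [[D hD] _] := b a aa; exists D.
  by exists 0.
have [|D DL] := @complex_ultralimit R U Uf Dn (64 * M / r).
  by apply: filterS hb => n /= b; exact: derivative_bound r0 b (DnP n b).
have M0 : 0 <= M.
  have [n /= b] := filter_ex hb.
  by have [_] := b a aa; apply: le_trans; exact: cabs_ge0.
exists D => e e0; pose B := 8192 * M / r ^+ 2 + 1.
have B0 : 0 < B.
  apply: ltr_wpDl ltr01; apply: mulr_ge0; last by rewrite invr_ge0 exprn_ge0 // ltW.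
  by apply: mulr_ge0 M0; rewrite ler0n.
exists (Num.min (r / 2) (e / B)); first by rewrite lt_min !divr_gt0.
move=> w; rewrite lt_min => /andP[wr we].
have w0 := cabs_ge0 (w - a).
have wr' : cabs (w - a) <= r by lra.
have lim : ulim U (fun n => hn n w - hn n a - Dn n * (w - a)) (h w - h a - D * (w - a)).
  apply: (ulimB Uf); first by apply: (ulimB Uf); exact: hl.
  by apply: (ulimM Uf) => //; exact: ulim_const.
apply: (ulim_le Uf lim); apply: filterS hb => n /= b.
have := taylor r0 b (DnP n b) (d := w - a) (ltW wr).
rewrite [a + _]addrC subrK => /le_trans; apply.
have -> : 8192 * M * cabs (w - a) ^+ 2 / r ^+ 2 = (8192 * M / r ^+ 2) * cabs (w - a) * cabs (w - a).
  by field; rewrite gt_eqF.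
rewrite ler_wpM2r //; rewrite ltr_pdivlMr // in we; apply: le_trans (ltW we).
by rewrite mulrC ler_wpM2l // lerDl.
Qed.

End Montel.

(** * The metric of projectors *)

Section FubiniStudy.
Variables (R : realType) (N : nat).
Local Notation C := R[i].
Local Notation PP := (Defs.PP R N).
Implicit Types (v w : 'rV[C]_N.+1) (x y z : PP) (i j k : 'I_N.+1).

Lemma cabs_conj (z : C) : cabs z^* = cabs z.
Proof. by apply: complexI; rewrite -!cabsE norm_conjC. Qed.

Lemma mul_conj (z : C) : z * z^* = (cabs z ^+ 2)%:C%C.
Proof. by rewrite -normCK cabsE rmorphXn. Qed.

Definition normsq v : R := \sum_k cabs (v 0 k) ^+ 2.

Lemma cabs_le_normsq v i : cabs (v 0 i) ^+ 2 <= normsq v.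
Proof.
rewrite /normsq (bigD1 i) //= lerDl sumr_ge0 // => k _.
by rewrite exprn_ge0 // cabs_ge0.
Qed.

Lemma normsq_gt0 v : v != 0 -> 0 < normsq v.
Proof.
move=> /rV0Pn[j vj]; apply: lt_le_trans (cabs_le_normsq v j).
by rewrite exprn_gt0 // cabs_gt0.
Qed.

Lemma normsqZ (a : C) v : normsq (a *: v) = cabs a ^+ 2 * normsq v.
Proof. by rewrite mulr_sumr; apply: eq_bigr => k _; rewrite mxE cabsM exprMn. Qed.

Lemma exists_unit_representative x : exists v, represents v x /\ normsq v = 1.
Proof.
have [v vx] := proj_represents x; have s0 := normsq_gt0 vx.1.
pose a : C := ((Num.sqrt (normsq v))^-1)%:C%C.
have ca : cabs a ^+ 2 = (normsq v)^-1.
  by rewrite cabs_real ger0_norm ?invr_ge0 ?sqrtr_ge0 // exprVn sqr_sqrtr // ltW.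
exists (a *: v); split; last by rewrite normsqZ ca mulVf // gt_eqF.
apply: representsZ => //; rewrite -cabs_eq0 -sqrf_eq0 ca invr_eq0 gt_eqF //.
Qed.

(** The phase is arbitrary; [projector] does not depend on it. *)
Definition unit_rep x := sval (cid (exists_unit_representative x)).

Lemma unit_repP x : represents (unit_rep x) x.
Proof. exact: (svalP (cid (exists_unit_representative x))).1. Qed.

Lemma unit_rep_norm x : normsq (unit_rep x) = 1.
Proof. exact: (svalP (cid (exists_unit_representative x))).2. Qed.

(* The matrix of the orthogonal projection onto the line x. *)
Definition projector x i j : C := unit_rep x 0 i * (unit_rep x 0 j)^*.

Lemma projectorE v x i j : represents v x ->
  projector x i j = v 0 i * (v 0 j)^* / (normsq v)%:C%C.
Proof.
move=> vx; have [a a0 vE] := represents_scale (unit_repP x) vx.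
rewrite vE !mxE normsqZ unit_rep_norm mulr1 rmorphM -mul_conj /projector.
by field; rewrite conjC_eq0 a0.
Qed.

Lemma cabs_projector v x i j : represents v x ->
  cabs (projector x i j) = cabs (v 0 i) * cabs (v 0 j) / normsq v.
Proof.
move=> vx; rewrite (projectorE _ _ vx) cabsM cabsV cabs_real ger0_norm ?ltW ?normsq_gt0 ?vx.1 //.
by rewrite cabsM cabs_conj.
Qed.

Lemma cabs_projector_le1 x i j : cabs (projector x i j) <= 1.
Proof.
rewrite (cabs_projector _ _ (unit_repP x)) unit_rep_norm divr1.
have := cabs_le_normsq (unit_rep x) i; have := cabs_le_normsq (unit_rep x) j.
rewrite unit_rep_norm => h1 h2.
have := cabs_ge0 (unit_rep x 0 i); have := cabs_ge0 (unit_rep x 0 j).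
by rewrite !expr_le1 // ?cabs_ge0 // in h1 h2; nra.
Qed.

(** The entries of the projector involve conjugates, but these quotients are the affine coordinates
    of the chart [j], hence holomorphic along holomorphic maps. *)
Lemma projector_ratio v x i j : represents v x ->
  projector x i j / projector x j j = v 0 i / v 0 j.
Proof.
move=> vx; rewrite !(projectorE _ _ vx).
have s0 : ((normsq v)%:C%C : C) != 0.
  by rewrite -cabs_gt0 cabs_real normr_gt0 gt_eqF // normsq_gt0 // vx.1.
have [vj|vj] := eqVneq (v 0 j) 0; first by rewrite vj conjC0 !mulr0 !mul0r invr0 !mulr0.
by field; rewrite conjC_eq0 vj s0.
Qed.

Lemma represents_projector_ratio x j : projector x j j != 0 ->
  represents (\row_i (projector x i j / projector x j j)) x.
Proof.
move=> xj; have uj : unit_rep x 0 j != 0.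
  by apply: contra_neq xj; rewrite /projector => ->; rewrite mul0r.
rewrite (_ : \row_i _ = (unit_rep x 0 j)^-1 *: unit_rep x).
  by apply: representsZ; [rewrite invr_eq0|exact: unit_repP].
by apply/rowP => i; rewrite !mxE (projector_ratio _ _ (unit_repP _)) mulrC.
Qed.

(* Some diagonal entry of a projector, which has trace 1, is at least this. *)
Definition large_coordinate : R := N.+1%:R^-1.
Local Notation kappa := large_coordinate.

Lemma exists_large_coordinate x : exists j, kappa <= cabs (projector x j j).
Proof.
apply: contrapT => /forallNP h.
have : \sum_j cabs (projector x j j) < \sum_(j < N.+1) N.+1%:R^-1 :> R.
  apply: ltr_sum => //; first by apply/hasP; exists ord0; rewrite // mem_index_enum.
  by move=> j _; rewrite ltNge; apply/negP; exact: h.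
rewrite sumr_const card_ord -[_ *+ _]mulr_natl mulfV ?pnatr_eq0 // ltNge => /negP; apply.
rewrite -(unit_rep_norm x); apply: ler_sum => j _.
by rewrite (cabs_projector _ _ (unit_repP x)) unit_rep_norm divr1 expr2.
Qed.

Definition dist x y : R := \sum_i \sum_j cabs (projector x i j - projector y i j).

Lemma dist_ge0 x y : 0 <= dist x y.
Proof. by apply: sumr_ge0 => i _; apply: sumr_ge0 => j _; exact: cabs_ge0. Qed.

Lemma distxx x : dist x x = 0.
Proof. by apply: big1 => i _; apply: big1 => j _; rewrite subrr cabs0. Qed.

Lemma dist_triangle x y z : dist x z <= dist x y + dist y z.
Proof.
rewrite -big_split; apply: ler_sum => i _; rewrite -big_split; apply: ler_sum => j _.
rewrite -[_ - projector z i j](subrKA (projector y i j)); exact: cabsD.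
Qed.

Lemma dist_sym x y : dist x y = dist y x.
Proof.
by apply: eq_bigr => i _; apply: eq_bigr => j _; rewrite -cabsN opprB.
Qed.

Lemma projector_le_dist x y i j : cabs (projector x i j - projector y i j) <= dist x y.
Proof.
rewrite /dist (bigD1 i) //= (bigD1 j) //= -addrA lerDl addr_ge0 //.
  by apply: sumr_ge0 => k _; exact: cabs_ge0.
by apply: sumr_ge0 => l _; apply: sumr_ge0 => k _; exact: cabs_ge0.
Qed.

Lemma dist_le (x y : PP) (e : R) :
  (forall i j, cabs (projector x i j - projector y i j) <= e) ->
  dist x y <= N.+1%:R ^+ 2 * e.
Proof.
move=> h; apply: le_trans (_ : \sum_(i < N.+1) \sum_(j < N.+1) e <= _).
  by apply: ler_sum => i _; apply: ler_sum => j _; exact: h.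
by rewrite !sumr_const card_ord -mulrnA -[e *+ _]mulr_natl natrM expr2.
Qed.

Lemma dist_eq0 x y : dist x y = 0 -> x = y.
Proof.
move=> xy; have E i j : projector x i j = projector y i j.
  apply/eqP; rewrite -subr_eq0 -cabs_eq0 eq_le cabs_ge0 andbT.
  by apply: le_trans (projector_le_dist x y i j) _; rewrite xy.
have [ux uy] := (unit_repP x, unit_repP y).
have /rV0Pn[j uj] := ux.1.
have uyj : unit_rep y 0 j != 0.
  apply: contra_neq uj => uj0; have := E j j; rewrite /projector uj0 mul0r.
  by move/eqP; rewrite mulf_eq0 conjC_eq0 orbb => /eqP.
apply: (@represents_inj _ _ (unit_rep x)) => //.
have -> : unit_rep x = (unit_rep x 0 j / unit_rep y 0 j) *: unit_rep y; last first.
  by apply: representsZ => //; rewrite mulf_neq0 // invr_eq0.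
apply/rowP => i; rewrite !mxE.
have h : unit_rep x 0 i / unit_rep x 0 j = unit_rep y 0 i / unit_rep y 0 j.
  by rewrite -!(projector_ratio _ _ (unit_repP _)) !E.
rewrite -mulrA [_^-1 * _]mulrC -h mulrC -mulrA mulVf // mulr1 //.
Qed.

Lemma dist_le2 x y : dist x y <= N.+1%:R ^+ 2 * 2.
Proof.
apply: dist_le => i j; apply: le_trans (cabsD _ _) _; rewrite cabsN.
have := cabs_projector_le1 x i j; have := cabs_projector_le1 y i j; lra.
Qed.

Lemma dist_coordinates (B m e : R) v w x y j : represents v x -> represents w y ->
  0 < m -> m <= cabs (v 0 j) -> 0 <= B ->
  (forall i, cabs (v 0 i) <= B) -> (forall i, cabs (w 0 i) <= B) ->
  (forall i, cabs (v 0 i - w 0 i) <= e) ->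
  dist x y <= N.+1%:R ^+ 2 * (2 * B * N.+2%:R / m ^+ 2) * e.
Proof.
move=> vx wy m0 mv B0 vB wB vw.
have s0 := normsq_gt0 vx.1; have s0' := normsq_gt0 wy.1.
have e0 : 0 <= e by apply: le_trans (vw j); exact: cabs_ge0.
have sm : m ^+ 2 <= normsq v.
  by apply: le_trans (cabs_le_normsq v j); rewrite lerXn2r ?nnegrE ?cabs_ge0 // ltW.
have prod i k : cabs (v 0 i * (v 0 k)^* - w 0 i * (w 0 k)^*) <= 2 * B * e.
  have -> : v 0 i * (v 0 k)^* - w 0 i * (w 0 k)^* =
    v 0 i * (v 0 k - w 0 k)^* + (v 0 i - w 0 i) * (w 0 k)^* by rewrite rmorphB; ring.
  apply: le_trans (cabsD _ _) _; rewrite !cabsM !cabs_conj.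
  have := ler_pM (cabs_ge0 _) (cabs_ge0 _) (vB i) (vw k).
  have := ler_pM (cabs_ge0 _) (cabs_ge0 _) (vw i) (wB k); lra.
have ss : `|normsq v - normsq w| <= N.+1%:R * (2 * B * e).
  rewrite -sumrB; apply: le_trans (ler_norm_sum _ _ _) _.
  apply: le_trans (_ : \sum_(k < N.+1) (2 * B * e) <= _); last first.
    by rewrite sumr_const card_ord -[_ *+ _]mulr_natl.
  apply: ler_sum => k _; by have := prod k k; rewrite !mul_conj -rmorphB cabs_real.
rewrite -[leRHS]mulrA; apply: dist_le => i k.
set sv := normsq v in s0 sm ss *; set sw := normsq w in s0' ss *.
have svC : (sv%:C%C : C) != 0 by rewrite -cabs_gt0 cabs_real normr_gt0 gt_eqF.
have swC : (sw%:C%C : C) != 0 by rewrite -cabs_gt0 cabs_real normr_gt0 gt_eqF.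
have -> : projector x i k - projector y i k =
    ((v 0 i * (v 0 k)^* - w 0 i * (w 0 k)^*) + projector y i k * (sw - sv)%:C%C) / sv%:C%C.
  rewrite (projectorE _ _ vx) (projectorE _ _ wy) -/sv -/sw rmorphB.
  by field; rewrite svC swC.
rewrite cabsM cabsV cabs_real (gtr0_norm s0).
have h : cabs ((v 0 i * (v 0 k)^* - w 0 i * (w 0 k)^*) + projector y i k * (sw - sv)%:C%C)
    <= 2 * B * N.+2%:R * e.
  apply: le_trans (cabsD _ _) _; rewrite cabsM cabs_real distrC.
  have := ler_pM (cabs_ge0 _) (normr_ge0 _) (cabs_projector_le1 y i k) ss.
  have := prod i k; rewrite -[N.+2]addn1 natrD; lra.
have -> : 2 * B * N.+2%:R / m ^+ 2 * e = 2 * B * N.+2%:R * e / m ^+ 2 by rewrite mulrAC.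
apply: ler_pM; rewrite ?cabs_ge0 ?invr_ge0 ?(ltW s0) //.
by rewrite lef_pV2 ?posrE // exprn_gt0.
Qed.

End FubiniStudy.

(** * Holomorphic maps to projective space *)

Section HolomorphicMaps.
Variables (R : realType) (N : nat).
Local Notation C := R[i].
Local Notation PP := (Defs.PP R N).
Local Notation kappa := (large_coordinate R N).
Implicit Types (f g : C -> PP) (x y : PP) (a b z w : C) (X : set PP) (i j k : 'I_N.+1).

Definition holomorphic_at f z0 := exists F : 'I_N.+1 -> C -> C,
  exists2 d : R, 0 < d & forall w, cabs (w - z0) < d ->
    (forall j, complex_differentiable (F j) w) /\ represents (\row_j F j w) (f w).

Lemma holomorphic_onP (D : set C) f :
  holomorphic_on D f <-> forall z0, D z0 -> holomorphic_at f z0.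
Proof.
split=> h z0 /h[F]; last first.
  move=> [d d0 dP]; exists F; apply/nbhs_cabs; exists d => // w /dP[Fd Fw].
  by split=> // j; apply/derivable_complex_differentiable.
move=> /nbhs_cabs[d d0 dP]; exists F, d => // w /dP[Fd Fw].
by split=> // j; apply/derivable_complex_differentiable.
Qed.

Lemma complex_differentiable_continuous (h : C -> C) z (e : R) :
  complex_differentiable h z -> 0 < e ->
  \forall w \near (z : C^o), cabs (h w - h z) < e.
Proof.
move=> [D /complex_derivative_bounded[d d0 dP]] e0.
have D0 : 0 < 1 + cabs D by rewrite ltr_pwDl // cabs_ge0.
apply/nbhs_cabs; exists (Num.min d (e / (1 + cabs D))).
  by rewrite lt_min d0 divr_gt0.
move=> w; rewrite lt_min => /andP[wd we]; apply: le_lt_trans (dP _ wd) _.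
by rewrite mulrC -ltr_pdivlMr.
Qed.

Lemma complex_differentiable_eq (h k : C -> C) z (d : R) : 0 < d ->
  (forall w, cabs (w - z) < d -> h w = k w) ->
  complex_differentiable h z -> complex_differentiable k z.
Proof.
move=> d0 hk [D hD]; exists D => e /hD[t t0 tP]; exists (Num.min d t).
  by rewrite lt_min d0.
by move=> w; rewrite lt_min => /andP[wd /tP]; rewrite !hk // subrr cabs0.
Qed.

Lemma holomorphic_at_comp f (phi : C -> C) z (d : R) : 0 < d ->
  (forall w, cabs (w - z) < d -> complex_differentiable phi w) ->
  holomorphic_at f (phi z) -> holomorphic_at (f \o phi) z.
Proof.
move=> d0 phid [F [r r0 rP]]; exists (fun j => F j \o phi).
have /phid pz : cabs (z - z) < d by rewrite subrr cabs0.
have /nbhs_cabs[t t0 tP] := complex_differentiable_continuous pz r0.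
exists (Num.min d t) => [|w]; first by rewrite lt_min d0.
rewrite lt_min => /andP[wd /tP /rP[Fd Fw]]; split=> // j.
by apply: complex_differentiable_comp; [exact: phid|exact: Fd].
Qed.

Lemma projector_ratio_differentiable f z i j : holomorphic_at f z ->
  projector (f z) j j != 0 ->
  complex_differentiable (fun w => projector (f w) i j / projector (f w) j j) z.
Proof.
move=> [F [d d0 dP]] pj; have zz : cabs (z - z) < d by rewrite subrr cabs0.
have [Fd Fz] := dP z zz.
have Fj : F j z != 0.
  by apply: contra_neq pj => Fj0; rewrite (projectorE _ _ Fz) !mxE Fj0 mul0r mul0r.
apply: (complex_differentiable_eq (h := fun w => F i w / F j w) d0).
  by move=> w /dP[_ Fw]; rewrite (projector_ratio _ _ Fw) !mxE.
by apply: complex_differentiableM => //; apply: complex_differentiableV.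
Qed.

Lemma holomorphic_at_continuous f z (e : R) : holomorphic_at f z -> 0 < e ->
  exists2 d : R, 0 < d & forall w, cabs (w - z) < d -> dist (f z) (f w) < e.
Proof.
move=> [F [d d0 dP]] e0; have zz : cabs (z - z) < d by rewrite subrr cabs0.
have [Fd Fz] := dP z zz; have /rV0Pn[j] := Fz.1; rewrite mxE => Fj.
pose m := cabs (F j z); have m0 : 0 < m by rewrite cabs_gt0.
pose B := \sum_i cabs (F i z) + 1.
have FB i : cabs (F i z) + 1 <= B.
  by rewrite lerD2r (bigD1 i) //= lerDl sumr_ge0 // => k _; exact: cabs_ge0.
have B0 : 0 <= B by apply: le_trans (FB j); rewrite addr_ge0 // cabs_ge0.
pose K := N.+1%:R ^+ 2 * (2 * B * N.+2%:R / m ^+ 2).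
have K0 : 0 <= K.
  by rewrite mulr_ge0 ?exprn_ge0 // mulr_ge0 ?invr_ge0 ?exprn_ge0 // ?mulr_ge0 // ltW.
have K1 : 0 < K + 1 by rewrite ltr_wpDl.
pose e' := Num.min 1 (e / (K + 1)).
have e'0 : 0 < e' by rewrite lt_min ltr01 divr_gt0.
have near : \forall w \near (z : C^o), forall i, cabs (F i w - F i z) < e'.
  apply: (@filter_forall _ _ (fun i w => cabs (F i w - F i z) < e') (nbhs (z : C^o))) => i.
  exact: complex_differentiable_continuous.
have /nbhs_cabs[t t0 tP] := near.
exists (Num.min d t) => [|w]; first by rewrite lt_min d0.
rewrite lt_min => /andP[/dP[_ Fw] /tP wt].
have e'1 : e' <= 1 by rewrite ge_min lexx.
have e'e : e' <= e / (K + 1) by rewrite ge_min lexx orbT.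
apply: le_lt_trans (_ : K * e' < e).
  apply: (dist_coordinates Fz Fw m0 (j := j)) => //; first by rewrite mxE.
  - by move=> i; rewrite mxE; apply: le_trans (FB i); rewrite lerDl.
  - move=> i; rewrite mxE; apply: le_trans (FB i).
    rewrite -[F i w](subrK (F i z)) addrC; apply: le_trans (cabsD _ _) _.
    by rewrite lerD2l; apply: le_trans e'1; exact: ltW.
  - by move=> i; rewrite !mxE -cabsN opprB; exact: ltW.
rewrite ler_pdivlMr // in e'e; lra.
Qed.

Definition oscillation_le f a (r : R) := forall z, cabs (z - a) <= r ->
  holomorphic_at f z /\ dist (f a) (f z) <= kappa / 4.

Lemma kappa_gt0 : 0 < kappa.
Proof. by rewrite invr_gt0 ltr0n. Qed.

Lemma projector_osc x y j (s e : R) : s <= cabs (projector x j j) -> dist x y <= e ->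
  s - e <= cabs (projector y j j).
Proof.
move=> sx xy; have := projector_le_dist x y j j.
have := cabsD (projector x j j - projector y j j) (projector y j j); rewrite subrK; lra.
Qed.

(** With oscillation at most [kappa / 4], the diagonal entry stays at least [kappa / 2], so one
    chart serves on the whole disc. Asking [3 * kappa / 4] instead of [kappa] at the centre leaves
    room for a chart chosen at a limit point. *)
Lemma chart_bounded f a (r : R) i j : oscillation_le f a r ->
  3 * kappa / 4 <= cabs (projector (f a) j j) ->
  bounded_holomorphic (fun z => projector (f z) i j / projector (f z) j j) a r (2 / kappa).
Proof.
move=> osc fj z zr; have [hz az] := osc z zr.
have k0 := kappa_gt0.
have zj := projector_osc fj az.
have zj' : kappa / 2 <= cabs (projector (f z) j j) by apply: le_trans zj; lra.
have zj0 : 0 < cabs (projector (f z) j j) by apply: lt_le_trans zj'; rewrite divr_gt0.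
split; first by apply: projector_ratio_differentiable; rewrite // -cabs_gt0.
rewrite cabsM cabsV ler_pdivrMr //; apply: le_trans (cabs_projector_le1 _ _ _) _.
rewrite mulrAC ler_pdivlMr // mul1r; lra.
Qed.

(** Cauchy's estimate in the chart of a large coordinate of [f a], carried over to [dist]. The
    coordinates are normalized by a [j]-th coordinate equal to [1], which makes [K] independent of
    the map and of the disc. *)
Lemma dist_lipschitz : exists2 K : R, 0 <= K & forall f a (r : R), 0 < r ->
  oscillation_le f a r -> forall z, cabs (z - a) <= r ->
  dist (f a) (f z) <= K * cabs (z - a) / r.
Proof.
have k0 := kappa_gt0.
pose L : R := N.+1%:R ^+ 2 * (2 * (2 / kappa) * N.+2%:R / 1 ^+ 2).
have L0 : 0 <= L.
  rewrite /L expr1n divr1 mulr_ge0 ?exprn_ge0 // mulr_ge0 // mulr_ge0 //.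
  by rewrite divr_ge0 // ltW.
exists (L * (64 * (2 / kappa))).
  by rewrite mulr_ge0 // mulr_ge0 ?ler0n // divr_ge0 // ltW.
move=> f a r r0 osc z zr.
have [j fj] := exists_large_coordinate (f a).
have fj' : 3 * kappa / 4 <= cabs (projector (f a) j j) by lra.
have chart i := chart_bounded i osc fj'.
have rep w : cabs (w - a) <= r ->
    represents (\row_i (projector (f w) i j / projector (f w) j j)) (f w).
  move=> wr; have [_ aw] := osc w wr; have wj := projector_osc fj' aw.
  by apply: represents_projector_ratio; rewrite -cabs_gt0; lra.
have aa : cabs (a - a) <= r by rewrite subrr cabs0 ltW.
have -> : L * (64 * (2 / kappa)) * cabs (z - a) / r =
  L * (64 * (2 / kappa) * cabs (z - a) / r) by rewrite -!mulrA.
apply: (dist_coordinates (rep a aa) (rep z zr) (j := j) (B := 2 / kappa)) => //.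
- have aj0 : projector (f a) j j != 0 by rewrite -cabs_gt0; lra.
  by rewrite mxE divff // cabs1.
- by rewrite divr_ge0 // ltW.
- by move=> i; rewrite mxE; exact: (chart i a aa).2.
- by move=> i; rewrite mxE; exact: (chart i z zr).2.
- move=> i; rewrite !mxE -cabsN opprB; exact: lipschitz r0 (chart i) zr.
Qed.

End HolomorphicMaps.

(** * Brody and hyperbolicity *)

Section Brody.
Variables (R : realType) (N : nat).
Local Notation C := R[i].
Local Notation PP := (Defs.PP R N).
Local Notation kappa := (large_coordinate R N).
Implicit Types (f g : C -> PP) (x y : PP) (a b z w : C) (X : set PP) (i j k : 'I_N.+1).

Definition large_oscillation f a (r : R) :=
  exists2 b, cabs (b - a) <= r & kappa / 4 < dist (f a) (f b).

(* If the conclusion fails then there are points a_k with large oscillation at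
   scale r / 2 ^ k for all k, against the continuity of f at a limit of them. *)
Lemma point_picking f (K r : R) : 0 < r -> 0 <= K -> 4 * K * r < 1 ->
  holomorphic_on (@unit_disc R) f -> large_oscillation f 0 r ->
  exists a s, [/\ 0 < s, cabs a + K * s < 1, large_oscillation f a s &
    forall b, cabs (b - a) <= K * s -> ~ large_oscillation f b (s / 2)].
Proof.
move=> r0 K0 Kr fh f0.
(* The displacements [K * r / 2 ^+ m] for [m < n] add up to this bound, which is below [1 / 2] by
   hypothesis. *)
pose A n a := cabs a <= 2 * K * r * (1 - (2 ^+ n)^-1) /\
  large_oscillation f a (r / 2 ^+ n).
have An : exists n, forall a, ~ A n a.
  apply: contrapT => /forallNP h.
  have /choice[s sA] : forall n, exists a, A n a.
    by move=> n; apply: contrapT => /forallNP; exact: h.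
  have Kr0 : 0 <= 2 * K * r by rewrite !mulr_ge0 // ltW.
  have sK n : cabs (s n) <= 2 * K * r.
    by apply: le_trans (sA n).1 _; rewrite ler_piMr // lerBlDr lerDl invr_ge0 exprn_ge0.
  have [U Uf] := exists_free_ultrafilter; have [UF _ Ucof] := Uf.
  have [|l sl] := @complex_ultralimit R U Uf s (2 * K * r); first exact: filterE.
  have l1 : unit_disc l.
    have : cabs l <= 2 * K * r by apply: (ulim_le Uf sl); exact: filterE.
    by rewrite /unit_disc /=; lra.
  have k0 := kappa_gt0 R N; have k8 : 0 < kappa / 8 by rewrite divr_gt0.
  have [d d0 dP] := holomorphic_at_continuous ((holomorphic_onP _ _).1 fh l l1) k8.
  have d2 : 0 < d / 2 by rewrite divr_gt0.
  have [n0 n0d] := half_pow_small r d2.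
  have [n [/= sn nn0]] := filter_ex (filterI (sl _ d2) (Ucof n0)).
  have [_ [b bs]] := sA n.
  have rn : r / 2 ^+ n <= r / 2 ^+ n0.
    rewrite ler_pM2l // lef_pV2 ?posrE ?exprn_gt0 //.
    by apply: ler_weXn2l => //; rewrite ler1n.
  have bl : cabs (b - l) < d.
    have -> : b - l = (b - s n) + (s n - l) by ring.
    by apply: le_lt_trans (cabsD _ _) _; lra.
  have sl' : cabs (s n - l) < d by lra.
  have := dP _ bl; have := dP _ sl'; have := dist_triangle (f (s n)) (f l) (f b).
  by rewrite (dist_sym (f (s n)) (f l)); lra.
have [n nA nmin] : exists2 n, (forall a, ~ A n a) & forall m, (m < n)%N -> exists a, A m a.
  have ex : exists n, `[< forall a, ~ A n a >] by have [n /asboolP] := An; exists n.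
  exists (ex_minn ex); first by case: ex_minnP => m /asboolP.
  case: ex_minnP => m _ mmin p pm; apply: contrapT => /forallNP h.
  by move: pm; rewrite ltnNge mmin //; apply/asboolP.
(* At the first scale where [A] fails, not [0] because of [f0], the point [a] of the preceding scale
   is picked: a nearby [b] with large oscillation at half its scale would satisfy [A]. *)
case: n nA nmin => [|n] nA nmin.
  by case: (nA 0); split; rewrite ?cabs0 expr0 ?divr1 // invr1 subrr mulr0.
have [a [aK fa]] := nmin n (leqnn _).
have p0 : 0 < 2 ^+ n :> R by rewrite exprn_gt0.
exists a, (r / 2 ^+ n); split => //; first by rewrite divr_gt0.
  have : (2 ^+ n)^-1 <= 1 :> R by rewrite invf_le1 // exprn_ege1 // ler1n.
  have : 0 < (2 ^+ n)^-1 :> R by rewrite invr_gt0.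
  have Kr0 : 0 <= K * r by rewrite mulr_ge0 // ltW.
  by move: (2 ^+ n)^-1 aK => u aK u0 u1; nra.
move=> b ba fb; apply: (nA b); split; last first.
  by rewrite exprSr invfM mulrA.
have -> : b = (b - a) + a by ring.
apply: le_trans (cabsD _ _) _; apply: le_trans (lerD ba aK) _.
by rewrite exprSr invfM; move: (2 ^+ n)^-1 => u; lra.
Qed.

Section Limits.
Variable U : set_system nat.
Hypothesis Ufree : free_ultrafilter U.
Let UF : ProperFilter U. Proof. by case: Ufree. Qed.
Local Existing Instance UF.

Lemma ulim_conj (u : nat -> C) l : ulim U u l -> ulim U (fun n => (u n)^*) l^*.
Proof.
by move=> ul e /ul; apply: filterS => n /=; rewrite -rmorphB cabs_conj.
Qed.

(** Compactness of P^N: the coordinates of unit representatives are bounded, their ultralimits form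
    a unit vector, and polynomial equations and projectors pass to the limit. *)
Lemma PP_ultralimit (x : nat -> PP) : exists y,
  (forall e : R, 0 < e -> U [set n | dist (x n) y < e]) /\
  (forall X, PPclosed X -> U [set n | X (x n)] -> X y).
Proof.
have u1 n i : cabs (unit_rep (x n) 0 i) <= 1.
  have := cabs_le_normsq (unit_rep (x n)) i; rewrite unit_rep_norm.
  by rewrite expr_le1 // cabs_ge0.
have /choice[l lP] : forall i, exists l, ulim U (fun n => unit_rep (x n) 0 i) l.
  by move=> i; apply: (complex_ultralimit Ufree (M := 1)); apply: filterE => n; exact: u1.
pose v : 'rV[C]_N.+1 := \row_i l i.
have v1 : normsq v = 1.
  apply: (@complexI R); apply: (ulim_unique Ufree (u := fun=> (1 : C))); last exact: ulim_const.
  rewrite rmorph_sum /=.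
  rewrite (_ : (fun=> (1 : C)) = fun n => \sum_i unit_rep (x n) 0 i * (unit_rep (x n) 0 i)^*).
    apply: ulim_sum => // i; rewrite -mul_conj mxE.
    by apply: ulimM => //; exact: ulim_conj.
  apply/funext => n; rewrite -[RHS](eq_bigr _ (fun i _ => esym (mul_conj _))).
  by rewrite -rmorph_sum -/(normsq _) unit_rep_norm.
have v0 : v != 0.
  apply/eqP => vE; move: v1; rewrite vE /normsq big1 => [/esym/eqP|i _].
    by rewrite oner_eq0.
  by rewrite mxE cabs0 expr0n.
have [y vy] := line_proj v0; exists y; split=> [e e0|X /PPclosed_mpoly[S SX] Xx].
  have N0 : 0 < N.+1%:R ^+ 2 :> R by rewrite exprn_gt0.
  pose e' := e / (2 * N.+1%:R ^+ 2); have e'0 : 0 < e' by rewrite divr_gt0 // mulr_gt0.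
  have prj i j : ulim U (fun n => projector (x n) i j) (projector y i j).
    rewrite (projectorE _ _ vy) v1 divr1 !mxE.
    by apply: ulimM => //; exact: ulim_conj.
  have near : \forall n \near U, forall p : 'I_N.+1 * 'I_N.+1,
      cabs (projector (x n) p.1 p.2 - projector y p.1 p.2) < e'.
    apply: (@filter_forall _ _ (fun p n =>
      cabs (projector (x n) p.1 p.2 - projector y p.1 p.2) < e')) => p.
    exact: prj.
  apply: filterS near => n /= h; apply: le_lt_trans (_ : N.+1%:R ^+ 2 * e' < e).
    by apply: dist_le => i j; apply: ltW; exact: (h (i, j)).
  rewrite /e'; have -> : N.+1%:R ^+ 2 * (e / (2 * N.+1%:R ^+ 2)) = e / 2.
    by field; rewrite gt_eqF // ltr0n.
  by rewrite ltr_pdivrMr // ltr_pMr // ltr1n.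
apply/(SX _ _ vy) => p Sp; apply: (ulim_unique Ufree (u := fun n => ev (unit_rep (x n)) p)).
  rewrite /meval; apply: ulim_sum => // m.
  apply: ulimM => //; first exact: ulim_const.
  apply: ulim_prod => // i; apply: ulimX => //.
  rewrite mxE; exact: lP.
move=> e e0; apply: filterS Xx => n /= Xn.
by rewrite ((SX _ _ (unit_repP (x n))).1 Xn p Sp) subrr cabs0.
Qed.

End Limits.

(** The small oscillation on discs of radius [1 / 2] keeps one chart valid for almost all [g n] near
    each point, so that [ulim_complex_differentiable] applies to the affine coordinates. The
    separation of [g n 0] and [g n 1] prevents the limit from being constant. *)
Lemma brody_limit X (g : nat -> C -> PP) : PPclosed X ->
  (forall n a, cabs a <= n.+1%:R -> X (g n a) /\ oscillation_le (g n) a (1 / 2)) ->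
  (forall n, kappa / 4 < dist (g n 0) (g n 1)) ->
  exists2 f, entire_curve X f & nonconstant f.
Proof.
move=> Xc gX g01; have [U Uf] := exists_free_ultrafilter; have [UF _ Ucof] := Uf.
have /choice[f fP] z := PP_ultralimit Uf (fun n => g n z).
have k0 := kappa_gt0 R N.
have big z : U [set n | cabs z + 1 <= n.+1%:R].
  apply: filterS (Ucof (Num.truncn (cabs z + 1))) => n /= h.
  apply: ltW; apply: lt_le_trans (truncnS_gt _) _; rewrite ler_nat ltnS //.
have ent z : X (f z).
  apply: (fP z).2 Xc _; apply: filterS (big z) => n /= nz.
  by have [] := gX n z; [lra|].
exists f; last first.
  exists 0, 1 => f01; have k8 : 0 < kappa / 8 by rewrite divr_gt0.
  have [n [/= h0 h1]] := filter_ex (filterI ((fP 0).1 _ k8) ((fP 1).1 _ k8)).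
  have := dist_triangle (g n 0) (f 0) (g n 1); have := g01 n.
  by rewrite f01 (dist_sym (f 1)) in h0 *; lra.
split=> //; apply/holomorphic_onP => z0 _.
have [j fj] := exists_large_coordinate (f z0).
pose u n i z := projector (g n z) i j / projector (g n z) j j.
have k4 : 0 < kappa / 4 by rewrite divr_gt0.
have nearU : U ([set n | cabs z0 + 1 <= n.+1%:R] `&`
    [set n | dist (g n z0) (f z0) < kappa / 4]).
  by apply: filterI; [exact: big|exact: (fP z0).1].
have gj n : dist (g n z0) (f z0) < kappa / 4 -> 3 * kappa / 4 <= cabs (projector (g n z0) j j).
  move=> h; rewrite dist_sym in h; have := projector_osc fj (ltW h); lra.
have ub : U [set n | forall i, bounded_holomorphic (u n i) z0 (1 / 2) (2 / kappa)].
  apply: filterS nearU => n [/= nz gn] i.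
  have [|_ osc] := gX n z0; first by lra.
  exact: chart_bounded osc (gj n gn).
have pl z i k : ulim U (fun n => projector (g n z) i k) (projector (f z) i k).
  move=> e /(fP z).1; apply: filterS => n /=; apply: le_lt_trans.
  exact: projector_le_dist.
have fzj z : cabs (z - z0) <= 1 / 2 -> projector (f z) j j != 0.
  move=> zz; rewrite -cabs_gt0; apply: lt_le_trans (_ : kappa / 2 <= _); first by rewrite divr_gt0.
  apply: (ulim_ge Uf (pl z j j)); apply: filterS nearU => n [/= nz gn].
  have [|_ osc] := gX n z0; first by lra.
  have := projector_osc (gj n gn) (osc z zz).2; lra.
have ul z i : cabs (z - z0) <= 1 / 2 ->
    ulim U (fun n => u n i z) (projector (f z) i j / projector (f z) j j).
  by move=> zz; apply: ulimM => //; apply: ulimV => //; exact: fzj.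
(* Discs of radius [1 / 4] around these points stay within [1 / 2] of [z0], where the bounds
   hold. *)
exists (fun i z => projector (f z) i j / projector (f z) j j), (1 / 4).
  by rewrite divr_gt0.
move=> z zz; split=> [i|].
  apply: (@ulim_complex_differentiable R U (fun n => u n i) _ _ (1 / 4) (2 / kappa)) => //.
    apply: filterS ub => n /= /(_ i); apply: bounded_holomorphic_sub; lra.
  move=> w wz; apply: ul; have -> : w - z0 = (w - z) + (z - z0) by ring.
  by apply: le_trans (cabsD _ _) _; lra.
by apply: represents_projector_ratio; apply: fzj; lra.
Qed.

Definition no_entire_curve X := forall f, entire_curve X f -> ~ nonconstant f.

Lemma brody X : PPclosed X -> no_entire_curve X -> exists2 r : R, 0 < r & forall f,
  holomorphic_on (@unit_disc R) f -> (forall z, unit_disc z -> X (f z)) ->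
  ~ large_oscillation f 0 r.
Proof.
move=> Xc Xno; apply: contrapT => h.
(* With [K = n.+2] in [point_picking], this makes [4 * K * r] equal to [1 / 2]. *)
pose r n : R := (8 * n.+2%:R)^-1.
have r0 n : 0 < r n by rewrite invr_gt0 mulr_gt0 // ltr0n.
have /choice[f fP] : forall n, exists f, [/\ holomorphic_on (@unit_disc R) f,
    (forall z, unit_disc z -> X (f z)) & large_oscillation f 0 (r n)].
  move=> n; apply: contrapT => /forallNP hn; apply: h; exists (r n) => // f fh fX fo.
  by apply: (hn f); split.
have /choice[s sP] : forall n, exists s : C * C * R,
    [/\ cabs s.1.1 + n.+2%:R * s.2 < 1, cabs (s.1.2 - s.1.1) <= s.2,
      kappa / 4 < dist (f n s.1.1) (f n s.1.2) &
      forall b, cabs (b - s.1.1) <= n.+2%:R * s.2 -> ~ large_oscillation (f n) b (s.2 / 2)].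
  move=> n; have [fh fX fo] := fP n.
  have [] := point_picking (r0 n) (ler0n R n.+2) _ fh fo.
    have -> : 4 * n.+2%:R * r n = 1 / 2 by rewrite /r; field; rewrite -natrD pnatr_eq0.
    lra.
  by move=> a [t [t0 at1 [b ba fab] osc]]; exists (a, b, t).
(* The points [0] and [1] go to the pair of large oscillation, at distance at most [t]. Discs of
   radius [1 / 2] go to discs of radius at most [t / 2], where the oscillation is small; [n.+2]
   exceeds the radius [n.+1] by enough to contain them. *)
pose g n z := f n ((s n).1.1 + ((s n).1.2 - (s n).1.1) * z).
have [||e eX ne] := @brody_limit X g Xc; last by exact: Xno eX ne.
  move=> n z zn; have [fh fX _] := fP n; have := sP n; rewrite /g.
  move: (s n) => [[a b] t] /= [at1 ab fab osc].
  have bz w : cabs w <= n.+2%:R -> cabs ((a + (b - a) * w) - a) <= n.+2%:R * t.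
    move=> wn; rewrite addrC addKr cabsM mulrC.
    by apply: ler_pM => //; exact: cabs_ge0.
  have dz w : cabs w <= n.+2%:R -> unit_disc (a + (b - a) * w).
    move=> /bz h'; rewrite /unit_disc /= -[_ + _](subrK a) addrC.
    by apply: le_lt_trans (cabsD _ _) _; lra.
  have t0 : 0 < t.
    rewrite lt_neqAle (le_trans (cabs_ge0 _) ab) andbT; apply/eqP => t0.
    have : a = b.
      apply/eqP; rewrite eq_sym -subr_eq0 -cabs_eq0 eq_le cabs_ge0 andbT.
      by apply: le_trans ab _; rewrite -t0.
    by move=> E; move: fab; rewrite E distxx; apply/negP; rewrite -leNgt divr_ge0 // ltW // kappa_gt0.
  have zn' : cabs z <= n.+2%:R by apply: le_trans zn _; rewrite ler_nat.
  split; first exact: fX (dz z zn').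
  move=> w wz.
  have aw : a + (b - a) * w - (a + (b - a) * z) = (b - a) * (w - z) by ring.
  have cw : cabs ((a + (b - a) * w) - (a + (b - a) * z)) <= t / 2.
    rewrite aw cabsM; apply: le_trans (ler_pM (cabs_ge0 _) (cabs_ge0 _) ab wz) _; lra.
  split; last first.
    rewrite leNgt; apply/negP => hd; apply: (osc _ (bz z zn')).
    by exists (a + (b - a) * w).
  have wn : unit_disc (a + (b - a) * w).
    apply: dz; rewrite -[w](subrK z); apply: le_trans (cabsD _ _) _.
    by move: zn; rewrite -[n.+2]addn1 natrD; lra.
  apply: (@holomorphic_at_comp _ _ (f n) (fun z => a + (b - a) * z) w 1) => //.
    move=> w' _; apply: complex_differentiableD; first exact: complex_differentiable_const.
    apply: complex_differentiableM; first exact: complex_differentiable_const.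
    exact: complex_differentiable_id.
  exact: (holomorphic_onP _ _).1 fh _ wn.
move=> n; have := sP n; rewrite /g; move: (s n) => [[a b] t] /= [_ _ + _].
by rewrite mulr0 addr0 mulr1 addrC subrK.
Qed.

End Brody.

(** * From bounded oscillation of discs to the Kobayashi distance *)

Section Kobayashi.
Variables (R : realType) (N : nat).
Local Notation C := R[i].
Local Notation PP := (Defs.PP R N).
Implicit Types (f : C -> PP) (x y : PP) (a b z : C) (X : set PP).

Lemma sqr_cabs z : cabs z ^+ 2 = complex.Re z ^+ 2 + complex.Im z ^+ 2.
Proof. by rewrite /cabs normc_def /= sqr_sqrtr // addr_ge0 // sqr_ge0. Qed.

Definition mobius a z : C := (z + a) / (1 + a^* * z).

Lemma mobius_denominator a z : unit_disc a -> unit_disc z -> 1 + a^* * z != 0.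
Proof.
rewrite /unit_disc /= => a1 z1; rewrite -cabs_gt0.
have := cabsD (1 + a^* * z) (- (a^* * z)); rewrite addrK cabs1 cabsN cabsM cabs_conj.
have := ler_pM (cabs_ge0 a) (cabs_ge0 z) (ltW a1) (lexx _); lra.
Qed.

Lemma mobius_disc a z : unit_disc a -> unit_disc z -> unit_disc (mobius a z).
Proof.
move=> a1 z1; have d0 := mobius_denominator a1 z1.
rewrite /unit_disc /mobius /= cabsM cabsV ltr_pdivrMr ?cabs_gt0 // mul1r.
have E : cabs (1 + a^* * z) ^+ 2 - cabs (z + a) ^+ 2 = (1 - cabs a ^+ 2) * (1 - cabs z ^+ 2).
  by rewrite !sqr_cabs; case: a z {d0 a1 z1} => [p q] [u v] /=; ring.
have : 0 < (1 - cabs a ^+ 2) * (1 - cabs z ^+ 2).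
  by rewrite mulr_gt0 // subr_gt0 expr_lt1 ?cabs_ge0.
by rewrite -E subr_gt0 ltr_pXn2r ?nnegrE ?cabs_ge0.
Qed.

Lemma ln_ratio_ge (r : R) : 0 <= r -> r < 1 -> r <= ln ((1 + r) / (1 - r)).
Proof.
move=> r0 r1; have p : 0 < 1 - r by rewrite subr_gt0.
have q : 0 < 1 + r by rewrite ltr_pwDl.
rewrite -[leLHS]expRK ler_ln ?posrE ?expR_gt0 ?divr_gt0 //.
have := expR_ge1Dx (- r); rewrite expRN => h.
have h' : expR r <= (1 - r)^-1.
  by rewrite -[expR r]invrK lef_pV2 ?posrE ?invr_gt0 ?expR_gt0.
by apply: le_trans h' _; rewrite ler_peMl ?invr_ge0 ?(ltW p) // lerDl.
Qed.

(** Up to the scale [s] provided by [brody], the oscillation is small and [dist_lipschitz] applies.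
    Beyond it, the bound of [dist] by its maximal value suffices. Taking [s <= 1 / 2] keeps the
    closed disc inside the unit disc. *)
Lemma disc_derivative_bound X : PPclosed X -> no_entire_curve X ->
  exists2 K : R, 0 <= K & forall f, holomorphic_on (@unit_disc R) f ->
    (forall z, unit_disc z -> X (f z)) ->
    forall z, unit_disc z -> dist (f 0) (f z) <= K * cabs z.
Proof.
move=> Xc Xno; have [r r0 rP] := brody Xc Xno; have [L L0 LP] := dist_lipschitz R N.
pose s := Num.min r (1 / 2); have s0 : 0 < s by rewrite lt_min r0 divr_gt0.
have M0 : 0 <= N.+1%:R ^+ 2 * 2 :> R by rewrite mulr_ge0 // exprn_ge0.
exists ((L + N.+1%:R ^+ 2 * 2) / s); first by rewrite divr_ge0 ?addr_ge0 // ltW.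
move=> f fh fX z z1; have z0 := cabs_ge0 z.
rewrite mulrAC ler_pdivlMr // mulrDl.
have [zs|zs] := leP (cabs z) s; last first.
  have := dist_le2 (f 0) (f z); have := dist_ge0 (f 0) (f z).
  have : 0 <= L * cabs z by rewrite mulr_ge0.
  set D := dist _ _; nra.
have osc : oscillation_le f 0 s.
  move=> w; rewrite subr0 => ws; split.
    apply: (holomorphic_onP _ _).1 fh _ _; rewrite /unit_disc /=.
    by apply: le_lt_trans ws _; rewrite gt_min; apply/orP; right; lra.
  rewrite leNgt; apply/negP => h; apply: (rP f fh fX); exists w => //.
  by rewrite subr0; apply: le_trans ws _; rewrite ge_min lexx.
have := LP f 0 s s0 osc z; rewrite subr0 => /(_ zs).
rewrite ler_pdivlMr //; have := mulr_ge0 M0 z0; lra.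
Qed.

(** A Moebius map moves [a] to the origin, so every disc in [X] is Lipschitz from [poincare_dist] to
    [dist], by [ln_ratio_ge]. Adding along chains bounds the Kobayashi distance below by
    [dist x y / (K + 1)], where [K] itself may be [0]. *)
Lemma hyperbolic_of_no_entire_curve X : PPclosed X -> no_entire_curve X ->
  kobayashi_hyperbolic X.
Proof.
move=> Xc Xno; have [K K0 KP] := disc_derivative_bound Xc Xno.
have step f a b : holomorphic_on (@unit_disc R) f -> (forall z, unit_disc z -> X (f z)) ->
    unit_disc a -> unit_disc b -> dist (f a) (f b) <= K * poincare_dist a b.
  move=> fh fX a1 b1; pose w := (b - a) / (1 - a^* * b).
  have n1 : unit_disc (- a) by rewrite /unit_disc /= cabsN.
  have wE : w = mobius (- a) b by rewrite /w /mobius rmorphN mulNr.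
  have w1 : unit_disc w by rewrite wE; exact: mobius_disc.
  have dab : 1 - a^* * b != 0.
    by have := mobius_denominator n1 b1; rewrite rmorphN mulNr.
  have h : holomorphic_on (@unit_disc R) (f \o mobius a).
    apply/holomorphic_onP => z0 z01; have d0 : 0 < 1 - cabs z0 by rewrite subr_gt0.
    apply: (@holomorphic_at_comp _ _ f (mobius a) z0 _ d0).
      move=> z zz; have z1 : unit_disc z.
        rewrite /unit_disc /= -[z](subrK z0); apply: le_lt_trans (cabsD _ _) _; lra.
      apply: complex_differentiableM.
        apply: complex_differentiableD; first exact: complex_differentiable_id.
        exact: complex_differentiable_const.
      apply: complex_differentiableV; first exact: mobius_denominator.
      apply: complex_differentiableD; first exact: complex_differentiable_const.
      apply: complex_differentiableM; last exact: complex_differentiable_id.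
      exact: complex_differentiable_const.
    by apply: (holomorphic_onP _ _).1 fh _ _; exact: mobius_disc.
  have hX z : unit_disc z -> X ((f \o mobius a) z) by move=> z1; exact/fX/mobius_disc.
  have := KP _ h hX w w1.
  have -> : (f \o mobius a) 0 = f a by rewrite /mobius /= mulr0 addr0 add0r divr1.
  have -> : (f \o mobius a) w = f b.
    have aa : 1 - a^* * a != 0.
      rewrite mulrC mul_conj -(rmorph1 (real_complex R)) -rmorphB -cabs_gt0 cabs_real.
      by rewrite normr_gt0 gt_eqF // subr_gt0 expr_lt1 // cabs_ge0.
    rewrite /mobius /w /=; congr (f _).
    have -> : (b - a) / (1 - a^* * b) + a = b * (1 - a^* * a) / (1 - a^* * b) by field.
    have -> : 1 + a^* * ((b - a) / (1 - a^* * b)) = (1 - a^* * a) / (1 - a^* * b) by field.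
    by field; rewrite aa dab.
  move=> h1; apply: le_trans h1 _; apply: ler_wpM2l => //.
  rewrite /poincare_dist (_ : cabs ((a - b) / _) = cabs w); last first.
    by rewrite -cabsN -mulNr opprB.
  by apply: ln_ratio_ge; [exact: cabs_ge0|exact: w1].
have chain x y l : disc_chain X x y l -> dist x y <= K * l.
  elim=> [z _|f a b z l' fh fX a1 b1 _ IH]; first by rewrite distxx mulr0.
  rewrite mulrDr; apply: le_trans (dist_triangle _ (f b) _) _.
  by apply: lerD => //; exact: step.
move=> x y Xx Xy xy; have d0 : 0 < dist x y.
  by rewrite lt_neqAle dist_ge0 andbT; apply/eqP => h; apply: xy; exact: dist_eq0.
have K1 : 0 < K + 1 by rewrite ltr_wpDl.
apply: (@lt_le_trans _ _ (dist x y / (K + 1))%:E); first by rewrite lte_fin divr_gt0.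
apply: le_ereal_inf_tmp => _ [l /= ch <-]; rewrite lee_fin ler_pdivrMr //.
have := chain _ _ _ ch => h; have l0 : 0 <= l.
  rewrite leNgt; apply/negP => l0; have : K * l <= 0 by rewrite mulr_ge0_le0 // ltW.
  lra.
lra.
Qed.

End Kobayashi.

(** * Dimension and conclusion *)

Section Dimension.
Variables (R : realType) (N : nat).
Local Notation C := R[i].
Local Notation PP := (Defs.PP R N).
Local Notation PForm := (Defs.PForm R N).
Implicit Types (f : C -> PP) (X Y : set PP).

Lemma intersection_closed c (d : 'I_c -> nat) (t : forall i, PForm (d i)) :
  PPclosed (intersection t).
Proof.
rewrite (_ : intersection t = \bigcap_(i in [set: 'I_c]) hypersurface (t i)).
  apply: zariski_closed_bigcap => i _.
  exact: (slice_closed (t i) (universal_hypersurface_closed R N (d i))).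
by apply/seteqP; split=> x h i //; exact: h.
Qed.

Lemma bounded_entire_constant (h : C -> C) (M : R) :
  (forall z, complex_differentiable h z) -> (forall z, cabs (h z) <= M) ->
  forall z w, h z = h w.
Proof.
move=> hd hM z w; have M0 : 0 <= M by apply: le_trans (hM 0); exact: cabs_ge0.
apply/eqP; rewrite -subr_eq0 -cabs_eq0 eq_le cabs_ge0 andbT leNgt; apply/negP => e0.
set e := cabs (h z - h w) in e0; pose B := 64 * M * cabs (z - w).
have B0 : 0 <= B by apply: mulr_ge0 (cabs_ge0 _); apply: mulr_ge0 M0; rewrite ler0n.
pose r := cabs (z - w) + B / e + 1.
have Be : 0 <= B / e by rewrite divr_ge0 // ltW.
have z0 := cabs_ge0 (z - w).
have r0 : 0 < r by rewrite /r; lra.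
have zr : cabs (z - w) <= r by rewrite /r; lra.
have hb : bounded_holomorphic h w r M by move=> u _; split; [exact: hd|exact: hM].
have := lipschitz r0 hb zr; rewrite -/B -/e ler_pdivlMr //; apply/negP; rewrite -ltNge.
have : B = e * (B / e) by rewrite mulrC divfK // gt_eqF.
by move=> {1}->; rewrite ltr_pM2l // /r; lra.
Qed.

(** [closed_cone_bounded] with the single coordinate [j] bounds all affine coordinates on [Y], and
    Liouville's theorem makes them constant along the curve. *)
Lemma entire_curve_avoiding_constant Y (j : 'I_N.+1) f : PPclosed Y ->
  (forall v, cone Y v -> v 0 j != 0) -> entire_curve Y f -> ~ nonconstant f.
Proof.
move=> Yc Yj [/holomorphic_onP fh fY] [z [w fzw]].
have [M M0 MP] := @closed_cone_bounded R _ (cone Y) 1 (fun=> j) (PPclosed_closed_cone Yc)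
  (fun v Yv => ex_intro _ ord0 (Yj v Yv)).
pose h i z := projector (f z) i j / projector (f z) j j.
have rep u : cone Y (unit_rep (f u)) by exists (f u) => //; exact: unit_repP.
have hE i u : h i u = unit_rep (f u) 0 i / unit_rep (f u) 0 j.
  exact: projector_ratio (unit_repP _).
have pj u : projector (f u) j j != 0.
  by rewrite /projector mulf_neq0 ?conjC_eq0 // (Yj _ (rep u)).
have hd i u : complex_differentiable (h i) u.
  by apply: projector_ratio_differentiable; [exact: fh|exact: pj].
have hM i u : cabs (h i u) <= M.
  rewrite hE cabsM cabsV ler_pdivrMr ?cabs_gt0 ?(Yj _ (rep u)) //.
  by have := MP _ i (rep u); rewrite big_ord1.
have hC i := bounded_entire_constant (hd i) (hM i) z w.
have hrep u : represents (\row_i h i u) (f u).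
  by apply: represents_projector_ratio; exact: pj.
apply: fzw; apply: (represents_inj (hrep z)).
by rewrite (_ : \row_i h i z = \row_i h i w) //; apply/rowP => i; rewrite !mxE.
Qed.

Lemma irreducible_chain_cat p q (V W : nat -> set PP) n : irreducible_chain p V ->
  irreducible_chain (n + q) W -> V p `<=` W n ->
  exists Z, irreducible_chain (p + q) Z /\ Z (p + q)%N `<=` W (n + q)%N.
Proof.
move=> [Vi Vs] [Wi Ws] VW.
(* [W n] is skipped, since [V p] may equal it; strictness at the junction comes from [W n] being
   strictly inside its successor. *)
pose Z i := if (i <= p)%N then V i else W (n + (i - p))%N.
exists Z; split; last first.
  rewrite /Z addKn; case: ifP => [h|_]; last exact: subset_refl.
  have -> : q = 0%N by lia.
  by rewrite !addn0.
split=> i ip; rewrite /Z.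
  by case: ifP => h; [exact: Vi|apply: Wi; lia].
case: (ltnP i p) => [h|h]; first by rewrite (ltnW h); exact: Vs.
have [->|h'] := eqVneq i p.
  rewrite leqnn subSnn addn1.
  have := Ws n; have -> : (n < n + q)%N by lia.
  move=> /(_ isT)[W1 W2]; split; first exact: subset_trans W1.
  by move=> W3; apply: W2; exact: subset_trans VW.
have -> : (i <= p)%N = false by lia.
have -> : (n + (i.+1 - p) = (n + (i - p)).+1)%N by lia.
by apply: Ws; lia.
Qed.

(* The degeneracy set may be too small: it is enlarged by the member of the
   right dimension of a maximal chain in [X]. *)
Lemma has_dim_add_member X Y n q : PPclosed Y -> Y `<=` X ->
  has_dim X (n + q)%N%:Z ->
  (forall m W, irreducible_chain m W -> W m `<=` Y -> (m <= n)%N) ->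
  exists Y', [/\ PPclosed Y', Y' `<=` X, has_dim Y' n%:Z & Y `<=` Y'].
Proof.
move=> Yc YX [[W [Wc WX]] Xmax] Ymax.
have [Wi Ws] := Wc.
have WnX : W n `<=` X.
  suff h k : (k <= q)%N -> W n `<=` W (n + k)%N by exact: subset_trans (h q (leqnn q)) WX.
  elim: k => [|k IH] kq; first by rewrite addn0.
  apply: subset_trans (IH (ltnW kq)) _; rewrite addnS.
  by have [] := Ws (n + k)%N _; [lia|].
exists (Y `|` W n); split.
- by apply: zariski_closedU => //; have [] := Wi n (leq_addr _ _).
- by move=> x [/YX|/WnX].
- split.
    exists W; split; last by move=> x; right.
    by split=> i ip; [apply: Wi; lia|apply: Ws; lia].
  move=> p V Vc VY.
  have [Vp _ Virr] := Vc.1 p (leqnn p).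
  have [Wn _ _] := Wi n (leq_addr _ _).
  (* The irreducible top of the chain lies in [Y] or in [W n]. In the second case the chain
     continues along [W] to length [p + q] in [X], so [p <= n]. *)
  have [VY'|VW] := Virr _ _ Yc Wn VY; first exact: Ymax Vc VY'.
  have [Z [Zc ZW]] := irreducible_chain_cat Vc Wc VW.
  have := Xmax _ _ Zc (subset_trans ZW WX); lia.
- by move=> x; left.
Qed.

End Dimension.

Theorem corollary2p4 (R : realType) (N delta : nat)
    (hdelta : degeneracy_bound R N delta)
    (c : nat) (d : 'I_c -> nat) (hd : forall i, (delta <= d i)%N) :
  exists U : set (forall i : 'I_c, PForm R N (d i)),
    [/\ PForms_open U, U !=set0 &
      forall t, U t -> smooth_complete_intersection t ->
        (exists Y : set (PP R N),
           [/\ PPclosed Y, Y `<=` intersection t,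
               has_dim Y (N%:Z - (3 * c)%:Z) &
               dl (intersection t) `<=` Y]) /\
        ((N <= 3 * c)%N -> kobayashi_hyperbolic (intersection t))].
Proof.
have [U [Uo U0 UP]] := generic_degeneracy hdelta hd.
exists U; split=> // t Ut [Xdim _]; have [Y [Yc Yj YP]] := UP t Ut.
have Xc := intersection_closed t; set X := intersection t in Xdim Xc YP *.
(* No index [j <= N] satisfies [3 * c <= j], so [Y] has no point. *)
have no_curve : (N < 3 * c)%N -> no_entire_curve X.
  move=> Nc f fX fn; have [v vx] := proj_represents (f 0).
  have [|j jc _] := Yj v; first by exists (f 0) => //; exact: YP.
  by have := ltn_ord j; lia.
split; last first.
  (* For [N = 3 * c] the only such index is [N], so the last coordinate never vanishes on [Y]. *)
  rewrite leq_eqVlt => /orP[/eqP Nc|/no_curve]; last exact: hyperbolic_of_no_entire_curve.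
  apply: hyperbolic_of_no_entire_curve => // f fX fn.
  apply: (@entire_curve_avoiding_constant _ _ Y ord_max f Yc _ _ fn).
    move=> v /Yj[j jc]; suff -> : j = ord_max by [].
    by apply: val_inj => /=; have := ltn_ord j; lia.
  by split; [case: fX|exact: YP].
have dlY (Z : set (PP R N)) : PPclosed Z ->
    (forall f, entire_curve X f -> nonconstant f -> forall z, Z (f z)) -> dl X `<=` Z.
  by move=> Zc ZP; apply: smallest_sub => // x [f [fX fn] [z _ <-]]; exact: ZP.
have [Nc|Nc] := ltnP N (3 * c).
  exists set0; split=> //; first exact: zariski_closed0.
    by case E : (_ - _) => [k|k] //; exfalso; lia.
  by apply: dlY; [exact: zariski_closed0|move=> f fX fn; case: (no_curve Nc f fX fn)].
(* In [has_dim_add_member], [n] is the wanted dimension [N - 3 * c] and [q = 2 * c] the excess of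
   the dimension of [X]. *)
have Ndim : N%:Z - c%:Z = ((N - 3 * c) + 2 * c)%N%:Z by lia.
rewrite Ndim in Xdim; have -> : N%:Z - (3 * c)%:Z = (N - 3 * c)%N%:Z by lia.
have YXc : PPclosed (Y `&` X) by exact: zariski_closedI.
(* The [N - 3 * c + 1] coordinates from [3 * c] on have no common zero on [Y], which bounds the
   chains. *)
have Ymax m W : irreducible_chain m W -> W m `<=` Y `&` X -> (m <= N - 3 * c)%N.
  move=> Wc WY; rewrite -ltnS.
  have lt (k : 'I_(N - 3 * c).+1) : (3 * c + k < N.+1)%N by have := ltn_ord k; lia.
  apply: (chain_avoiding_lt (iota := fun k => Ordinal (lt k)) Yc _ Wc).
    move=> v /Yj[j jc vj]; have jl : (j - 3 * c < (N - 3 * c).+1)%N by have := ltn_ord j; lia.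
    exists (Ordinal jl); rewrite (_ : Ordinal _ = j) //.
    by apply: val_inj => /=; lia.
  by move=> x /WY[].
have [Y' [Y'c Y'X Y'dim YY']] := has_dim_add_member YXc (@subIsetr _ _ _) Xdim Ymax.
exists Y'; split=> //; apply: dlY => // f fX fn z; apply: YY'; split; first exact: YP.
by case: fX.
Qed.
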